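(* Let $N>2s>1$ with $s\in(\tfrac12,1)$, let $\lambda>0$ and $R_0>0$, and let $p,q$ be real numbers. Assume that $f\colon(0,\infty)\to(0,\infty)$ is a continuous function satisfying $$\liminf_{t\to0^+}\frac{f(t)}{t^p}>0 .$$ If either $$1<q<\frac{N}{N+1-2s}\quad\text{and}\quad 0<p<\frac{(2s-1)q}{2s-q},$$ or $$q\ge\frac{N}{N+1-2s}\quad\text{and}\quad 0<p<\frac{N}{N-2s},$$ then there are no positive classical supersolutions $u$ of $$(-\Delta)^s u+|\nabla u|^q=\lambda f(u)\quad\text{in }\mathbb{R}^N\setminus B_{R_0}$$ which do not blow up at infinity.
   Context: $N\ge1$ is an integer and $B_R$ denotes the ball in $\mathbb{R}^N$ of radius $R$ centred at $0$. The fractional Laplacian is $(-\Delta)^s u(x)=C_{N,s}\,\mathrm{P.V.}\int_{\mathbb{R}^N}\frac{u(x)-u(y)}{|x-y|^{N+2s}}\,dy$, with $C_{N,s}>0$ a normalization constant. $\mathcal{L}_{2s}$ is the set of functions $u\colon\mathbb{R}^N\to\mathbb{R}$ with $\int_{\mathbb{R}^N}\frac{|u(x)|}{1+|x|^{N+2s}}\,dx<\infty$. A classical supersolution of $(-\Delta)^s u+|\nabla u|^q=\lambda f(u)$ in $\mathbb{R}^N\setminus B_{R_0}$ is a function $u\in \mathcal{C}^2(\mathbb{R}^N\setminus B_{R_0})\cap\mathcal{L}_{2s}$ such that $(-\Delta)^s u(x)+|\nabla u(x)|^q\ge\lambda f(u(x))$ for all $x\in\mathbb{R}^N\setminus B_{R_0}$.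 ''Positive'' means $u>0$ in $\mathbb{R}^N$. ''$u$ does not blow up at infinity'' means that $u(x)$ does not tend to $+\infty$ as $|x|\to\infty$, i.e. $\liminf_{|x|\to\infty}u(x)<\infty$. *)

(* Defs.v *)
From HB Require Import structures.
From mathcomp Require Import all_boot all_order all_algebra.
From mathcomp Require Import all_classical all_reals all_analysis.
Set Implicit Arguments.
Unset Strict Implicit.
Unset Printing Implicit Defensive.
Import Order.TTheory GRing.Theory Num.Theory.
Import numFieldNormedType.Exports.
Local Open Scope classical_set_scope.
Local Open Scope ring_scope.

(* Vectors of R^n are row vectors 'rV[R]_n, with the topology of the library.
   Its norm `|x| is the sup norm, hence the separate Euclidean norm. *)
Definition enorm (R : realType) (n : nat) (x : 'rV[R]_n) : R :=
  Num.sqrt (\sum_(i < n) x ord0 i ^+ 2).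

Definition rV_coord (R : realType) (n : nat) (i : 'I_n) (x : 'rV[R]_n) :
  measurableTypeR R := x ord0 i.

Definition rV_display : measure_display. Proof. exact. Qed.

(* The product (that is, Borel) sigma-algebra, generated by the coordinates. *)
Section rV_measurable.
Variables (R : realType) (n : nat).

Let rV_set0 : g_sigma_preimage (@rV_coord R n) set0.
Proof. exact: sigma_algebra0. Qed.

Let rV_setC A : g_sigma_preimage (@rV_coord R n) A ->
  g_sigma_preimage (@rV_coord R n) (~` A).
Proof. exact: sigma_algebraC. Qed.

Let rV_bigcup (F : (set 'rV[R]_n)^nat) :
  (forall i, g_sigma_preimage (@rV_coord R n) (F i)) ->
  g_sigma_preimage (@rV_coord R n) (\bigcup_i F i).
Proof. exact: sigma_algebra_bigcup. Qed.

HB.instance Definition _ := @isMeasurable.Build rV_display 'rV[R]_n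
  (g_sigma_preimage (@rV_coord R n)) rV_set0 rV_setC rV_bigcup.

End rV_measurable.

Section rV_measurability.
Variable R : realType.

Lemma measurable_rV_coord (n : nat) (i : 'I_n) :
  measurable_fun [set: 'rV[R]_n] (rV_coord i).
Proof.
move=> _ Y mY; rewrite setTI; apply: sub_sigma_algebra => /=.
rewrite -bigcup_seq/=; exists i => /=; first by rewrite mem_index_enum.
by exists Y => //; rewrite setTI.
Qed.

Lemma measurable_fun_rVP d (T : measurableType d) (n : nat)
    (f : T -> 'rV[R]_n) :
  (forall i, measurable_fun [set: T] (rV_coord i \o f)) ->
  measurable_fun [set: T] f.
Proof.
move=> mf _ A mA; rewrite setTI.
rewrite -[f @^-1` A]setTI.
suff : g_sigma_preimage (@rV_coord R n) `<=` image_set_system setT f measurable.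
  by apply.
apply: smallest_sub.
  exact/sigma_algebra_image/sigma_algebra_measurable.
rewrite -bigcup_seq/= => B [i _ [Y mY <-]].
by have := mf i measurableT _ mY; rewrite /image_set_system /= !setTI.
Qed.

Definition rV_cons (n : nat) (x : measurableTypeR R * 'rV[R]_n) : 'rV[R]_n.+1 :=
  \row_i (if unlift ord0 i is Some j then x.2 ord0 j else x.1).

Definition rV_uncons (n : nat) (x : 'rV[R]_n.+1) :
    measurableTypeR R * 'rV[R]_n :=
  (x ord0 ord0, \row_j x ord0 (lift ord0 j)).

Lemma measurable_rV_cons (n : nat) : measurable_fun setT (@rV_cons n).
Proof.
apply: measurable_fun_rVP => i; rewrite /rV_coord /comp.
under eq_fun do rewrite mxE.
case: unliftP => [j _|_]; last exact: measurable_fst.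
exact: (measurableT_comp (measurable_rV_coord j) measurable_snd).
Qed.

Lemma measurable_rV_uncons (n : nat) : measurable_fun setT (@rV_uncons n).
Proof.
apply/measurable_fun_pairP; split; first exact: (measurable_rV_coord ord0).
apply: measurable_fun_rVP => i; rewrite /rV_coord /comp /=.
under eq_fun do rewrite mxE.
exact: (measurable_rV_coord (lift ord0 i)).
Qed.

Lemma rV_consK (n : nat) : cancel (@rV_cons n) (@rV_uncons n).
Proof.
move=> [a x]; rewrite /rV_uncons /rV_cons mxE unlift_none /=; congr pair.
by apply/rowP => j; rewrite !mxE liftK.
Qed.

Section step.
Variables (n : nat) (mu : {sigma_finite_measure set 'rV[R]_n -> \bar R}).

Definition lebesgue_rV_step : set 'rV[R]_n.+1 -> \bar R :=
  pushforward (lebesgue_measure \x mu)%E (@rV_cons n).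

Let step0 : lebesgue_rV_step set0 = 0%E.
Proof. by rewrite /lebesgue_rV_step /pushforward preimage_set0 measure0. Qed.

Let step_ge0 A : (0 <= lebesgue_rV_step A)%E.
Proof. by rewrite /lebesgue_rV_step /pushforward; apply: measure_ge0. Qed.

Let step_sigma_additive : semi_sigma_additive lebesgue_rV_step.
Proof.
pose mf := @measurable_rV_cons n.
exact: (@measure_semi_sigma_additive _ _ _
  (measure_function_pushforward__canonical__measure_function_Measure _ mf)).
Qed.

HB.instance Definition _ := isMeasure.Build _ _ _ lebesgue_rV_step
  step0 step_ge0 step_sigma_additive.

Let step_setT : sigma_finite setT lebesgue_rV_step.
Proof.
have /sigma_finiteP[F [FT ndF mF]] :=
  sigma_finiteT (@lebesgue_measure R : {sigma_finite_measure set _ -> \bar R}).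
have /sigma_finiteP[G [GT ndG mG]] := sigma_finiteT mu.
exists (fun k => @rV_uncons n @^-1` (F k `*` G k)).
  apply/esym/seteqP; split=> // x _.
  have : (setT : set (measurableTypeR R)) (rV_uncons x).1 by [].
  rewrite FT => -[i _ Fi].
  have : (setT : set 'rV[R]_n) (rV_uncons x).2 by [].
  rewrite GT => -[j _ Gj].
  exists (maxn i j) => //; split.
    by move: Fi; apply/subsetPset/ndF/leq_maxl.
  by move: Gj; apply/subsetPset/ndG/leq_maxr.
move=> k; have [mFk Fk] := mF k; have [mGk Gk] := mG k; split.
  rewrite -[X in measurable X]setTI; apply: measurable_rV_uncons => //.
  exact: measurableX.
rewrite /lebesgue_rV_step /pushforward -comp_preimage.
rewrite (_ : _ @^-1` _ = F k `*` G k).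
  rewrite product_measure1E// lte_mul_pinfty//.
  by rewrite ge0_fin_numE.
by apply/seteqP; split=> x; rewrite /preimage /mkset /comp rV_consK.
Qed.

HB.instance Definition _ :=
  @Measure_isSigmaFinite.Build _ _ _ lebesgue_rV_step step_setT.

End step.

(* The n-fold product of the Lebesgue measure of R. *)
Fixpoint lebesgue_rV (n : nat) :
    {sigma_finite_measure set 'rV[R]_n -> \bar R} :=
  if n is m.+1 then lebesgue_rV_step (lebesgue_rV m) else \d_(0 : 'rV[R]_0).
End rV_measurability.

(* Measurability with respect to the Lebesgue sigma-algebra, that is, the
   completion of the Borel one.  On such functions the integral with respect to
   the Borel measure [lebesgue_rV] already is the Lebesgue integral. *)
Definition lebesgue_measurable (R : realType) (n : nat) (u : 'rV[R]_n -> R) :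
  Prop :=
  exists2 v : 'rV[R]_n -> measurableTypeR R, measurable_fun setT v &
    {ae lebesgue_rV R n, forall x, u x = v x}.

Definition L2s (R : realType) (n : nat) (s : R) (u : 'rV[R]_n -> R) : Prop :=
  lebesgue_measurable u /\
  (\int[lebesgue_rV R n]_x
     (`|u x| / (1 + enorm x `^ (n%:R + 2 * s)))%:E < +oo)%E.

(* The principal value exists whenever u is C^2 near x and belongs to
   L2s s; the positive constant C stands for C_{n,s}. *)
Definition fractional_laplacian (R : realType) (n : nat) (C s : R)
    (u : 'rV[R]_n -> R) (x : 'rV[R]_n) : R :=
  C * lim ((\int[lebesgue_rV R n]_(y in [set y | (eps < enorm (x - y))%R])
      ((u x - u y) / enorm (x - y) `^ (n%:R + 2 * s))) @[eps --> 0^'+]).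

Definition partial (R : realType) (n : nat) (i : 'I_n) (u : 'rV[R]_n -> R) :
  'rV[R]_n -> R := fun x => 'D_(delta_mx ord0 i) u x.

Definition gradient (R : realType) (n : nat) (u : 'rV[R]_n -> R)
    (x : 'rV[R]_n) : 'rV[R]_n := \row_i partial i u x.

(* The set U is meant to be open. *)
Fixpoint Ck_on (R : realType) (n k : nat) (U : set 'rV[R]_n)
    (u : 'rV[R]_n -> R) : Prop :=
  (forall x, U x -> {for x, continuous u}) /\
  (if k is k'.+1 then
     forall i : 'I_n, (forall x, U x -> derivable u x (delta_mx ord0 i)) /\
                      Ck_on k' U (partial i u)
   else True).

(* The complement of the closed ball: an open set. *)
Definition exterior (R : realType) (n : nat) (r : R) : set 'rV[R]_n :=
  [set x | r < enorm x].

Definition classical_supersolution (R : realType) (n : nat)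
    (C s q lambda : R) (f : R -> R) (R0 : R) (u : 'rV[R]_n -> R) : Prop :=
  [/\ Ck_on 2 (exterior R0) u,
      L2s s u &
      forall x, exterior R0 x ->
        lambda * f (u x) <=
          fractional_laplacian C s u x + enorm (gradient u x) `^ q].

Definition at_infinity (R : realType) (n : nat) : set_system 'rV[R]_n :=
  filter_from setT (@exterior R n).

Definition blows_up_at_infinity (R : realType) (n : nat)
    (u : 'rV[R]_n -> R) : Prop :=
  u x @[x --> @at_infinity R n] --> +oo.

(* Main.v *)
(** Let gamma > N - 2s and let phi(y) = |y|^(-gamma) for |y| >= R1, extended by 0.
For |x| = rho large, the truncated integrals defining (-Delta)^s phi(x) are symmetrized by
the inversion y |-> rho^2 y / |y|^2, under which |x - y| becomes rho |x - y| / |y| and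
|y|^(-N) dy is invariant: with t = |y| / rho and kappa = N - 2s the symmetrized weight is
(1 - t^(-gamma)) (1 - t^(gamma - kappa)) <= 0.  Hence (-Delta)^s phi(x) <=
- c |x|^(-gamma - 2s), and since gamma + 2s <= q (gamma + 1), a small multiple of phi
cannot touch u from below: u >= c |x|^(-gamma).

Conversely, touching u from below by the paraboloid u(z) (1 - |y - z|^2 / r^2), r = |z| / 2,
gives a point x near z with u(x) <= u(z) and
lambda f(u(x)) <= M u(z) r^(-2s) + (2 N u(z) / r)^q.
As u does not blow up this forces inf u = 0 at infinity.  Choosing z to minimize
max(u |y|^(gamma + 1), const u), one gets u(x) >= u(z) / 2^(gamma + 1), so
f(u(x)) >= a u(x)^p bounds u(z)^p by u(z) r^(-2s) + (u(z) / r)^q, which for r large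
contradicts c r^(-gamma) <= u(z) <= 1, because gamma p < gamma + 2s <= q (gamma + 1).  The
hypotheses on p and q say exactly that such a gamma exists. *)

Require Import Defs.
From mathcomp Require Import all_boot all_order all_algebra.
From mathcomp Require Import all_classical all_reals all_analysis.
From mathcomp Require Import measurable_realfun ring lra.
Set Implicit Arguments.
Unset Strict Implicit.
Unset Printing Implicit Defensive.
Import Order.TTheory GRing.Theory Num.Theory.
Import numFieldNormedType.Exports.
Local Open Scope classical_set_scope.
Local Open Scope ring_scope.

(** Three features of the definitions shape the development. [lim] is total, so bounds on truncated
    integrals say something about [fractional_laplacian] only once the principal value is known to
    exist; hence the second-order expansion of [u]. [Ck_on] speaks of partial derivatives alone, so
    that expansion and the gradient bounds run along coordinate axes. And [u] agrees with a Borel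
    function only off a null set, which is removed from the domain before integrals of [u] are split
    or compared. The invariance of |y|^(-n) dy under inversion is obtained on each orbit of the
    dilations, where inversion becomes a reflection of the real line. Since the integral for phi
    converges only as a principal value, symmetrization takes place at a fixed truncation; the
    inversion does not preserve the excised ball, and the mismatch is estimated separately. At gamma
    = N - 2s the symmetrized weight would vanish identically, so strict inequality is essential to
    the sign. *)

(** * Affine changes of variables on R and on row vectors *)

Lemma ge0_integral_lebesgue_affine (R : realType) (a c : R)
    (f : R -> \bar R) :
  a != 0 -> measurable_fun setT f -> (forall x, (0 <= f x)%E) ->
  (`|a|%:E * \int[lebesgue_measure]_t f (a * t + c)%R =
   \int[lebesgue_measure]_t f t)%E.
Proof.
move=> a0 mf f0.
pose phi (t : measurableTypeR R) : measurableTypeR R := a * t + c.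
have mphi : measurable_fun setT phi.
  by apply: measurable_funD => //; exact: measurable_funM.
have a_ge0 : 0 <= `|a| by [].
pose mu : {measure set (measurableTypeR R) -> \bar R} :=
  measure_function_pushforward__canonical__measure_function_Measure
    (@lebesgue_measure R) mphi.
(* Uniqueness of Lebesgue measure: the pushforward under [phi], scaled by |a|, is tested on
   half-open intervals ]x, y]. For negative [a] the preimage is closed on the left instead, which
   does not change its length. *)
transitivity (\int[mscale (NngNum a_ge0) mu]_t f t)%E; last first.
  apply: eq_measure_integral => A mA _; apply/esym/lebesgue_measure_unique => //.
  move=> _ [[x y] _ <-] /=.
  rewrite /mscale /= /pushforward lebesgue_measure_itv /= lte_fin.
  have [xy|yx] := ltP x y; last first.
    rewrite set_itv_ge; last by rewrite bnd_simp -leNgt.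
    by rewrite preimage_set0 measure0 mule0.
  have [ap|an] := ltP 0 a.
    rewrite (_ : phi @^-1` _ = `](x - c) / a, (y - c) / a]%classic).
      rewrite lebesgue_measure_itv /= lte_fin ltr_pM2r ?invr_gt0 // ltrD2r xy.
      by rewrite gtr0_norm // -!EFinD -EFinM; congr EFin; field.
    apply/seteqP; split=> t; rewrite /preimage /= !in_itv /= /phi.
      by rewrite ltr_pdivrMr // ler_pdivlMr // ltrBlDr lerBrDr mulrC.
    by rewrite ltr_pdivrMr // ler_pdivlMr // ltrBlDr lerBrDr mulrC.
  have {}an : a < 0 by rewrite lt_neqAle a0.
  rewrite (_ : phi @^-1` _ = `[(y - c) / a, (x - c) / a[%classic).
    rewrite lebesgue_measure_itv /= lte_fin ltr_nM2r ?invr_lt0 // ltrD2r xy.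
    by rewrite ltr0_norm // -!EFinD -EFinM; congr EFin; field.
  apply/seteqP; split=> t; rewrite /preimage /= !in_itv /= /phi.
    by rewrite ler_ndivrMr // ltr_ndivlMr // lerBrDr ltrBlDr mulrC andbC.
  by rewrite ler_ndivrMr // ltr_ndivlMr // lerBrDr ltrBlDr mulrC andbC.
rewrite ge0_integral_mscale//=; congr (_ * _)%E.
by rewrite (ge0_integral_pushforward mphi).
Qed.

Lemma ge0_integral_rVS (R : realType) (n : nat) (f : 'rV[R]_n.+1 -> \bar R) :
  measurable_fun setT f -> (forall x, (0 <= f x)%E) ->
  (\int[lebesgue_rV R n.+1]_x f x =
   \int[lebesgue_measure]_t \int[lebesgue_rV R n]_y f (rV_cons (t, y)))%E.
Proof.
move=> mf f0; rewrite /= /lebesgue_rV_step.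
rewrite (ge0_integral_pushforward (@measurable_rV_cons R n)) //.
rewrite preimage_setT fubini_tonelli1 //=.
by apply: measurableT_comp => //; exact: measurable_rV_cons.
Qed.

Lemma measurable_rV_affine (R : realType) (n : nat) (a : R) (c : 'rV[R]_n) :
  measurable_fun setT (fun y : 'rV[R]_n => a *: y + c).
Proof.
apply: measurable_fun_rVP => i; rewrite /rV_coord /comp.
under eq_fun do rewrite !mxE.
apply: measurable_funD => //; apply: measurable_funM => //.
exact: measurable_rV_coord.
Qed.

(** Induction on the dimension, each coordinate contributing one factor |a|. Negative [a] matters:
    [a = -1] gives the reflections that move kernels to the origin and cancel odd integrands. *)
Lemma ge0_integral_rV_affine (R : realType) (n : nat) (a : R) (c : 'rV[R]_n)
    (f : 'rV[R]_n -> \bar R) :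
  a != 0 -> measurable_fun setT f -> (forall x, (0 <= f x)%E) ->
  ((`|a| ^+ n)%:E * \int[lebesgue_rV R n]_y f (a *: y + c)%R =
   \int[lebesgue_rV R n]_y f y)%E.
Proof.
move=> a0; elim: n c f => [|n IH] c f mf f0.
  rewrite expr0 mul1e; apply: eq_integral => x _.
  by congr f; apply/rowP => -[].
have mfa : measurable_fun setT (fun y : 'rV[R]_n.+1 => f (a *: y + c)).
  by apply: measurableT_comp => //; exact: measurable_rV_affine.
rewrite !ge0_integral_rVS //.
pose c' : 'rV[R]_n := \row_j c ord0 (lift ord0 j).
have E t y : a *: rV_cons (t, y) + c = rV_cons (a * t + c ord0 ord0, a *: y + c').
  apply/rowP => i; rewrite !mxE /=.
  by case: unliftP => [j ->|->] /=; rewrite ?mxE.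
under eq_integral do under eq_integral do rewrite E.
have mfc (t : R) : measurable_fun setT (fun y : 'rV[R]_n => f (rV_cons (t, y))).
  apply: measurableT_comp => //; apply: measurableT_comp => //.
  exact: measurable_rV_cons.
pose g (t : R) := (\int[lebesgue_rV R n]_y f (rV_cons (t, y)))%E.
have mg : measurable_fun setT (g : measurableTypeR R -> _).
  apply: (@measurable_fun_fubini_tonelli_F _ _ _ _ _ (lebesgue_rV R n)
    (fun x => f (rV_cons x))).
    by apply: measurableT_comp => //; exact: measurable_rV_cons.
  by move=> x; exact: f0.
have g0 t : (0 <= g t)%E by apply: integral_ge0.
rewrite -[RHS](ge0_integral_lebesgue_affine (c ord0 ord0) a0 mg g0).
rewrite exprS EFinM -muleA; congr (_ * _)%E.
rewrite -ge0_integralZl//; last 2 first.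
- have -> : (fun x : measurableTypeR R => \int[lebesgue_rV R n]_y f (rV_cons (a * x + c ord0 ord0, a *: y + c')%R))%E =
     (fun x => \int[lebesgue_rV R n]_y f (a *: (rV_cons (x, y)) + c)%R)%E.
    by apply/funext => x; apply: eq_integral => y _; rewrite E.
  apply: (@measurable_fun_fubini_tonelli_F _ _ _ _ _ (lebesgue_rV R n)
    (fun x => f (a *: rV_cons x + c))).
    by apply: (measurableT_comp mfa); exact: measurable_rV_cons.
  by move=> x; exact: f0.
- by move=> t _; apply: integral_ge0.
apply: eq_integral => t _.
by rewrite (IH c' (fun y => f (rV_cons (a * t + c ord0 ord0, y)))).
Qed.

(** * Euclidean geometry and the kernels |y|^(-n-a) *)

Definition dotv (R : realType) (n : nat) (x y : 'rV[R]_n) : R :=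
  \sum_(i < n) x ord0 i * y ord0 i.

Section euclidean_norm.
Variables (R : realType) (n : nat).
Implicit Types x y : 'rV[R]_n.

Lemma dotvC x y : dotv x y = dotv y x.
Proof. by apply: eq_bigr => i _; rewrite mulrC. Qed.

Lemma dotvDl x y z : dotv (x + y) z = dotv x z + dotv y z.
Proof. by rewrite /dotv -big_split; apply: eq_bigr => i _; rewrite mxE mulrDl. Qed.

Lemma dotvZl a x y : dotv (a *: x) y = a * dotv x y.
Proof. by rewrite /dotv mulr_sumr; apply: eq_bigr => i _; rewrite mxE mulrA. Qed.

Lemma dotvDr x y z : dotv z (x + y) = dotv z x + dotv z y.
Proof. by rewrite dotvC dotvDl !(dotvC z). Qed.

Lemma dotvZr a x y : dotv x (a *: y) = a * dotv x y.
Proof. by rewrite dotvC dotvZl dotvC. Qed.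

Lemma dotvNr x y : dotv x (- y) = - dotv x y.
Proof. by rewrite -scaleN1r dotvZr mulN1r. Qed.

Lemma dotvv_ge0 x : 0 <= dotv x x.
Proof. by apply: sumr_ge0 => i _; rewrite -expr2 sqr_ge0. Qed.

Lemma enorm_ge0 x : 0 <= enorm x.
Proof. exact: sqrtr_ge0. Qed.

Lemma sqr_enorm x : enorm x ^+ 2 = dotv x x.
Proof.
rewrite /enorm sqr_sqrtr; first by apply: eq_bigr => i _; rewrite expr2.
by apply: sumr_ge0 => i _; rewrite sqr_ge0.
Qed.

Lemma enormE x : enorm x = Num.sqrt (dotv x x).
Proof. by rewrite -sqr_enorm sqrtr_sqr ger0_norm // enorm_ge0. Qed.

Lemma coord_le_enorm x i : `|x ord0 i| <= enorm x.
Proof.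
rewrite -sqrtr_sqr /enorm ler_sqrt; last by apply: sumr_ge0 => j _; rewrite sqr_ge0.
by rewrite (bigD1 i) //= lerDl; apply: sumr_ge0 => j _; rewrite sqr_ge0.
Qed.

Lemma enormZ a x : enorm (a *: x) = `|a| * enorm x.
Proof.
by rewrite !enormE dotvZl dotvZr mulrA sqrtrM ?sqr_ge0 // -expr2 sqrtr_sqr.
Qed.

Lemma enorm_eq0 x : (enorm x == 0) = (x == 0).
Proof.
apply/eqP/eqP => [x0|->]; last by rewrite -(scale0r 0) enormZ normr0 mul0r.
apply/rowP => i; rewrite mxE; apply/eqP; rewrite -normr_eq0 eq_le normr_ge0.
by rewrite andbT -x0 coord_le_enorm.
Qed.

Lemma enorm0 : enorm (0 : 'rV[R]_n) = 0.
Proof. by apply/eqP; rewrite enorm_eq0. Qed.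

Lemma enorm_gt0 x : (0 < enorm x) = (x != 0).
Proof. by rewrite lt_def enorm_ge0 andbT enorm_eq0. Qed.

Lemma enormN x : enorm (- x) = enorm x.
Proof. by rewrite -scaleN1r enormZ normrN1 mul1r. Qed.

Lemma enormBC x y : enorm (x - y) = enorm (y - x).
Proof. by rewrite -enormN opprB. Qed.

Lemma dotv_le x y : dotv x y <= enorm x * enorm y.
Proof.
have [->|x0] := eqVneq x 0; first by rewrite -(scale0r 0) dotvZl enormZ normr0 !mul0r.
have [->|y0] := eqVneq y 0; first by rewrite -(scale0r 0) dotvZr enormZ normr0 !mul0r mulr0.
have xy0 : 0 < enorm x * enorm y by rewrite mulr_gt0 ?enorm_gt0.
(* The square expands to 2 |x|^2 |y|^2 - 2 |x| |y| (x . y), from which the positive factor |x| |y|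
   is cancelled. *)
have := dotvv_ge0 (enorm y *: x - enorm x *: y).
rewrite -scaleNr !(dotvDl, dotvDr, dotvZl, dotvZr) (dotvC y x) -!sqr_enorm => h.
rewrite -(ler_pM2l xy0).
nra.
Qed.

Lemma sqr_enormD x y :
  enorm (x + y) ^+ 2 = enorm x ^+ 2 + 2 * dotv x y + enorm y ^+ 2.
Proof. by rewrite !sqr_enorm !(dotvDl, dotvDr) (dotvC y x); ring. Qed.

Lemma sqr_enormB x y :
  enorm (x - y) ^+ 2 = enorm x ^+ 2 - 2 * dotv x y + enorm y ^+ 2.
Proof. by rewrite sqr_enormD dotvNr enormN mulrN. Qed.

Lemma ler_enormD x y : enorm (x + y) <= enorm x + enorm y.
Proof.
rewrite -(@ler_pXn2r _ 2) ?nnegrE ?addr_ge0 ?enorm_ge0 //.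
by rewrite sqr_enormD; have := dotv_le x y; nra.
Qed.

Lemma ler_enormB x y : enorm x - enorm y <= enorm (x - y).
Proof. by rewrite lerBlDr -{1}(subrK y x) ler_enormD. Qed.

Lemma enorm_le_sum x : enorm x <= \sum_(i < n) `|x ord0 i|.
Proof.
have s0 : 0 <= \sum_(i < n) `|x ord0 i| by apply: sumr_ge0.
rewrite -(ger0_norm s0) -sqrtr_sqr /enorm ler_sqrt ?sqr_ge0 // expr2 mulr_suml.
apply: ler_sum => i _; rewrite -real_normK ?num_real // expr2.
by apply: ler_wpM2l => //; rewrite (bigD1 i) //= lerDl; apply: sumr_ge0.
Qed.

Lemma enorm_le_const x M : (forall i, `|x ord0 i| <= M) -> enorm x <= n%:R * M.
Proof.
move=> xM; apply: (le_trans (enorm_le_sum x)).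
rewrite -[n in n%:R]card_ord -sum1_card natr_sum mulr_suml.
by apply: ler_sum => i _; rewrite mul1r.
Qed.

Lemma norm_le_enorm x : `|x| <= enorm x.
Proof.
rewrite /Num.norm /= mx_normrE; apply: bigmax_le; first exact: enorm_ge0.
by move=> -[i j] _ /=; rewrite (ord1 i) coord_le_enorm.
Qed.

Lemma continuous_enorm : continuous (@enorm R n).
Proof.
move=> x; apply: (@continuous_comp _ _ _ (fun x => \sum_(i < n) x ord0 i ^+ 2)).
  suff : continuous (fun x : 'rV[R]_n => \sum_(i < n) x ord0 i ^+ 2) by exact.
  apply: (@continuous_big R _ +%R 0 xpredT) => [|i _ z].
    exact: add_continuous.
  by apply: (@cvgM R _ (nbhs z)); exact: coord_continuous.
exact: sqrt_continuous.
Qed.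

Lemma measurable_enorm : measurable_fun setT (@enorm R n).
Proof.
apply: (@measurableT_comp _ _ _ _ _ _ (@Num.sqrt R)).
  by apply: continuous_measurable_fun; exact: sqrt_continuous.
apply: measurable_sum => i; apply: measurable_funX.
exact: measurable_rV_coord.
Qed.

End euclidean_norm.

(** * Measure of cubes and balls; scaling of the homogeneous kernels *)

Section cube.
Variables (R : realType) (I : set R).
Hypothesis mI : measurable I.

Lemma measurable_rV_cube (n : nat) : measurable [set x : 'rV[R]_n | forall i, I (x ord0 i)].
Proof.
rewrite [X in measurable X](_ : _ =
    \bigcap_(i in setT) [set x : 'rV[R]_n | I (x ord0 i)]); last first.
  by apply/seteqP; split=> x /= h i; [move=> _|]; exact: h.
apply: fin_bigcap_measurable; first exact: finite_finset.
move=> i _; rewrite -[X in measurable X]setTI.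
exact: (measurable_rV_coord i measurableT).
Qed.

(** Serves two bounds: a cube containing a ball makes the ball finite, and a cube outside the unit
    ball keeps tail integrals positive. *)
Lemma lebesgue_rV_cube (n : nat) (r : R) : lebesgue_measure I = r%:E ->
  lebesgue_rV R n [set x : 'rV[R]_n | forall i, I (x ord0 i)] = (r ^+ n)%:E.
Proof.
move=> Ir; elim: n => [|n IH].
  by rewrite /= diracE mem_set // => -[].
rewrite /= /lebesgue_rV_step /pushforward.
rewrite (_ : _ @^-1` _ = I `*` [set x : 'rV[R]_n | forall i, I (x ord0 i)]); last first.
  apply/seteqP; split=> -[t x] /=.
    move=> h; split=> [|i].
      by have := h ord0; rewrite !mxE unlift_none.
    by have := h (lift ord0 i); rewrite !mxE liftK.
  by move=> [ht hx] i; rewrite !mxE; case: unliftP => [j _|_] /=; [exact: hx|].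
rewrite product_measure1E //; last exact: measurable_rV_cube.
by rewrite [X in (X * _)%E]Ir IH exprS EFinM.
Qed.

End cube.

Section annuli.
Variables (R : realType) (n : nat).
Local Notation mu := (lebesgue_rV R n).
Implicit Types (x y : 'rV[R]_n) (r : R).

Lemma measurable_enormB x : measurable_fun setT (fun y : 'rV[R]_n => enorm (x - y)).
Proof.
apply: measurableT_comp; first exact: measurable_enorm.
have := @measurable_rV_affine R n (-1) x.
by under eq_fun do rewrite scaleN1r addrC.
Qed.

Lemma measurable_enorm_itv (i : interval R) x :
  measurable [set y : 'rV[R]_n | enorm (x - y) \in i].
Proof.
rewrite -[X in measurable X]setTI.
exact: (measurable_enormB x measurableT (measurable_itv i)).
Qed.

Lemma measurable_enorm_gt r x : measurable [set y : 'rV[R]_n | r < enorm (x - y)].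
Proof.
rewrite [X in measurable X](_ : _ = [set y : 'rV[R]_n | enorm (x - y) \in `]r, +oo[]).
  exact: measurable_enorm_itv.
by apply/seteqP; split=> y /=; rewrite in_itv /= andbT.
Qed.

Lemma measurable_enorm_le r x : measurable [set y : 'rV[R]_n | enorm (x - y) <= r].
Proof.
rewrite [X in measurable X](_ : _ = [set y : 'rV[R]_n | enorm (x - y) \in `]-oo, r]]).
  exact: measurable_enorm_itv.
by apply/seteqP; split=> y /=; rewrite in_itv /=.
Qed.

Lemma lebesgue_rV_ball r x : (mu [set y : 'rV[R]_n | enorm (x - y) <= r]%R < +oo)%E.
Proof.
pose M := enorm x + r; pose I : set R := `[- M, M]%classic.
have mI : measurable I by exact: measurable_itv.
have [c Ic] : exists c, lebesgue_measure I = c%:E.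
  rewrite /I lebesgue_measure_itv /=; case: ifP => _; last by exists 0.
  by rewrite -EFinB; eexists.
apply: (@le_lt_trans _ _ (mu [set y : 'rV[R]_n | forall i, I (y ord0 i)])).
  apply: le_measure; rewrite ?inE; [exact: measurable_enorm_le|exact: measurable_rV_cube|].
  move=> y /= xy i; rewrite /I /= in_itv /= -ler_norml; apply: (le_trans (coord_le_enorm _ _)).
  by rewrite /M; have := ler_enormB y x; rewrite enormBC; lra.
by rewrite (lebesgue_rV_cube mI _ Ic) ltry.
Qed.

(** Indexing by the excess [a] over the dimension makes dilation by [c] scale integrals by c^(-a):
    [a = 2 * s] is the kernel at infinity, [a = - (2 - 2 * s)] its product with |y|^2 near 0, and
    [a = 0] the dilation-invariant density. If n + a is nonzero, the value at the origin is 0. *)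
Definition power_kernel (a : R) y : \bar R := ((enorm y `^ (n%:R + a))^-1)%:E.

Lemma power_kernel_ge0 a y : (0 <= power_kernel a y)%E.
Proof. by rewrite lee_fin invr_ge0 powR_ge0. Qed.

Lemma measurable_power_kernel a : measurable_fun setT (power_kernel a).
Proof.
apply/measurable_EFinP; under eq_fun do rewrite -powRN.
by apply: (measurableT_comp (measurable_powR _)); exact: measurable_enorm.
Qed.

Lemma power_kernelZ a c y : c != 0 ->
  power_kernel a (c *: y) =
  ((`|c| ^+ n)^-1%:E * ((`|c| `^ a)^-1%:E * power_kernel a y))%E.
Proof.
move=> c0; rewrite /power_kernel -!EFinM enormZ powRM ?enorm_ge0 // invfM.
by rewrite powRD ?normr_eq0 ?c0 ?implybT // powR_mulrn // invfM !mulrA.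
Qed.

Lemma integral_power_kernelZ a c (D : set R) : 0 < c -> measurable D ->
  (\int[mu]_(y in [set y | D (enorm y)]) power_kernel a y =
   (c `^ a)^-1%:E *
   \int[mu]_(y in [set y | D (c * enorm y)%R]) power_kernel a y)%E.
Proof.
move=> c0 mD.
have m1 : measurable [set y : 'rV[R]_n | D (enorm y)].
  by rewrite -[X in measurable X]setTI; exact: measurable_enorm.
have m2 : measurable [set y : 'rV[R]_n | D (c * enorm y)].
  have : measurable_fun setT (fun y : 'rV[R]_n => c * enorm y).
    by apply: measurable_funM => //; exact: measurable_enorm.
  by rewrite -[X in measurable X]setTI; exact.
rewrite integral_mkcond [in RHS]integral_mkcond.
have cn0 : c != 0 by rewrite gt_eqF.
have mk : measurable_fun setT (power_kernel a \_ [set y | D (enorm y)]).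
  by apply: (measurable_restrictT _ m1).1; apply: measurable_funTS; exact: measurable_power_kernel.
have k0 y : (0 <= (power_kernel a \_ [set y | D (enorm y)]) y)%E.
  by rewrite erestrict_ge0 // => z _; exact: power_kernel_ge0.
rewrite -[LHS](ge0_integral_rV_affine 0 cn0 mk k0).
have mk2 : measurable_fun setT
    (fun y : 'rV[R]_n => (power_kernel a \_ [set y | D (enorm y)]) (c *: y + 0)).
  by apply: (measurableT_comp mk); exact: measurable_rV_affine.
have mk3 : measurable_fun setT (power_kernel a \_ [set y : 'rV[R]_n | D (c * enorm y)]).
  by apply: (measurable_restrictT _ m2).1; apply: measurable_funTS; exact: measurable_power_kernel.
rewrite -[LHS](ge0_integralZl _ measurableT mk2) //.
have k30 y : setT y ->
    (0 <= (power_kernel a \_ [set y : 'rV[R]_n | D (c * enorm y)%R]) y)%E.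
  by move=> _; rewrite erestrict_ge0 // => z _; exact: power_kernel_ge0.
have c30 : (0 <= (c `^ a)^-1%:E)%E by rewrite lee_fin invr_ge0 powR_ge0.
rewrite -[RHS](ge0_integralZl _ measurableT mk3 k30 c30).
apply: eq_integral => y _; rewrite addr0 /patch.
have cy : enorm (c *: y) = c * enorm y by rewrite enormZ gtr0_norm.
rewrite (_ : (c *: y \in _) = (y \in [set y | D (c * enorm y)])); last first.
  by apply/idP/idP; rewrite !inE /= cy.
case: (_ \in _); last by rewrite !mule0.
rewrite power_kernelZ // gtr0_norm // muleA -EFinM mulfV; first by rewrite mul1r EFinM.
by rewrite expf_neq0.
Qed.

Lemma integral_power_kernel_translate a (D : set R) x : measurable D ->
  (\int[mu]_(y in [set y | D (enorm (x - y))]) power_kernel a (x - y) =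
   \int[mu]_(y in [set y | D (enorm y)]) power_kernel a y)%E.
Proof.
move=> mD.
have m1 : measurable [set y : 'rV[R]_n | D (enorm y)].
  by rewrite -[X in measurable X]setTI; exact: measurable_enorm.
rewrite integral_mkcond [RHS]integral_mkcond.
have n1 : -1 != 0 :> R by rewrite oppr_eq0 oner_eq0.
have mk : measurable_fun setT (power_kernel a \_ [set y | D (enorm y)]).
  by apply: (measurable_restrictT _ m1).1; apply: measurable_funTS; exact: measurable_power_kernel.
have k0 y : (0 <= (power_kernel a \_ [set y | D (enorm y)]) y)%E.
  by rewrite erestrict_ge0 // => z _; exact: power_kernel_ge0.
rewrite -[RHS](ge0_integral_rV_affine x n1 mk k0).
rewrite normrN1 expr1n mul1e; apply: eq_integral => y _.
rewrite scaleN1r addrC /patch.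
by congr (if _ then _ else _); apply/idP/idP; rewrite !inE.
Qed.

End annuli.

Lemma powRV (R : realType) (x a : R) : 0 <= x -> x^-1 `^ a = (x `^ a)^-1.
Proof. by move=> x0; rewrite -(powR_inv1 x0) -powRrM mulN1r powRN. Qed.

Lemma powR_gt1 (R : realType) (x a : R) : 1 < x -> 0 < a -> 1 < x `^ a.
Proof.
move=> x1 a0; have := gt0_ltr_powR a0; rewrite /= => /(_ 1 x); rewrite powR1.
by apply; rewrite ?nnegrE // ltW // (lt_trans ltr01).
Qed.

Section power_kernel_integrals.
Variables (R : realType) (n : nat).
Local Notation mu := (lebesgue_rV R n).
Implicit Types (x y : 'rV[R]_n) (r : R).
Local Notation J a D := (\int[mu]_(y in [set y | D (enorm y)]) power_kernel a y)%E.

Lemma measurable_enorm_set (D : set R) : measurable D ->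
  measurable [set y : 'rV[R]_n | D (enorm y)].
Proof.
by move=> mD; rewrite -[X in measurable X]setTI; exact: measurable_enorm.
Qed.

Lemma integral_power_kernel_bounded a r1 r2 : 0 <= n%:R + a -> 0 < r1 ->
  (J a `]r1, r2]%classic < +oo)%E.
Proof.
move=> na r10.
have mD : measurable [set y : 'rV[R]_n | `]r1, r2]%classic (enorm y)].
  by apply: measurable_enorm_set; exact: measurable_itv.
apply: (@le_lt_trans _ _ (\int[mu]_(y in [set y | `]r1, r2]%classic (enorm y)])
    cst ((r1 `^ (n%:R + a))^-1)%:E y)%E).
  apply: ge0_le_integral => //=.
  - by move=> y _; exact: power_kernel_ge0.
  - by apply: measurable_funTS; exact: measurable_power_kernel.
  - move=> y; rewrite in_itv /= => /andP[r1y _]; rewrite lee_fin.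
    have y0 := lt_trans r10 r1y.
    by rewrite lef_pV2 ?posrE ?powR_gt0 // ge0_ler_powR // ?nnegrE ltW.
rewrite integral_cst // lte_mul_pinfty ?lee_fin ?invr_ge0 ?powR_ge0 //.
apply: le_lt_trans (lebesgue_rV_ball r2 (0 : 'rV[R]_n)).
apply: le_measure; rewrite ?inE //; first exact: measurable_enorm_le.
by move=> y /=; rewrite in_itv /= sub0r enormN => /andP[].
Qed.

(* Summing over the dilates of one annulus by powers of [c] gives a geometric
   series of ratio [(c `^ a)^-1]. *)
Lemma integral_power_kernel_dilates a (c : R) (D : nat -> set R) :
  0 < c -> 1 < c `^ a -> (forall k, measurable (D k)) ->
  nondecreasing_seq D -> D 0%N = set0 -> (J a (D 1%N) < +oo)%E ->
  (forall k, [disjoint D 1%N & [set t | D k (t / c)]]) ->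
  (forall k, D k.+1 = D 1%N `|` [set t | D k (t / c)]) ->
  (J a (\bigcup_k D k) < +oo)%E.
Proof.
move=> c0 ca mD ndD D0 D1 disj DS.
have Jge0 k : (0 <= J a (D k))%E.
  by apply: integral_ge0 => y _; exact: power_kernel_ge0.
have [C C0 JC] : exists2 C, 0 <= C & J a (D 1%N) = C%:E.
  exists (fine (J a (D 1%N))); first exact: fine_ge0.
  by rewrite fineK // ge0_fin_numE.
pose th := (c `^ a)^-1.
have th0 : 0 <= th by rewrite invr_ge0 powR_ge0.
have th1 : th < 1 by rewrite invf_lt1 // (lt_trans _ ca).
have mDc k : measurable [set t | D k (t / c)].
  have : measurable_fun setT (fun t : R => t / c) by exact: measurable_funM.
  by move=> /(_ measurableT _ (mD k)); rewrite setTI.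
pose D' k : set R := [set t | D k (t / c)].
have step k : J a (D k.+1) = (C%:E + th%:E * J a (D k))%E.
  have -> : (th%:E * J a (D k))%E = J a (D' k).
    rewrite (integral_power_kernelZ _ _ c0 (mDc k)); congr (_ * integral _ _ _)%E.
    apply/seteqP; split=> y /=; rewrite /D' /= mulrAC divff ?mul1r // gt_eqF //.
  rewrite -JC -ge0_integral_setU.
  - by rewrite DS.
  - exact: measurable_enorm_set.
  - exact: (measurable_enorm_set (mDc k)).
  - by apply: measurable_funTS; exact: measurable_power_kernel.
  - by move=> y _; exact: power_kernel_ge0.
  - rewrite disj_set2E; apply/eqP; rewrite -subset0 => y /= [y1 yk].
    by have /disj_setPS := disj k; apply; split; [exact: y1|exact: yk].
(* [B] solves [B = C + th * B]; this uniform bound passes to the union by monotone convergence. *)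
pose B := C / (1 - th).
have bound k : (J a (D k) <= B%:E)%E.
  elim: k => [|k IH].
    rewrite D0 (_ : [set _ | _] = set0) // integral_set0 lee_fin.
    by rewrite divr_ge0 // subr_ge0 ltW.
  rewrite step; apply: (@le_trans _ _ (C%:E + th%:E * B%:E)%E).
    by rewrite leeD2l // lee_wpmul2l // lee_fin.
  rewrite -EFinM -EFinD lee_fin /B le_eqVlt; apply/orP; left; apply/eqP.
  by field; rewrite subr_eq0 gt_eqF.
apply: le_lt_trans (ltry B).
have cvgJ : J a (D k) @[k --> \oo] --> J a (\bigcup_k D k).
  rewrite (_ : [set y | _] = \bigcup_k [set y : 'rV[R]_n | D k (enorm y)]) //.
  apply: ge0_nondecreasing_set_cvg_integral.
  - move=> i j ij; apply/subsetPset => y; exact: (subsetPset _ _ (ndD _ _ ij)).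
  - by move=> k; exact: measurable_enorm_set.
  - by move=> k; apply: measurable_funTS; exact: measurable_power_kernel.
  - by move=> k y _; exact: power_kernel_ge0.
rewrite -(cvg_lim _ cvgJ) //; apply: lime_le.
  by apply/cvg_ex; eexists; exact: cvgJ.
by apply: nearW.
Qed.

Lemma tail_integral_fin (a : R) : 0 < a -> (J a `]1%R, +oo[%classic < +oo)%E.
Proof.
move=> a0.
have -> : `]1, +oo[%classic = \bigcup_k `]1, 2 ^+ k]%classic :> set R.
  apply/seteqP; split=> t /=; rewrite in_itv /= ?andbT; last first.
    by case=> k _; rewrite /= in_itv /= => /andP[].
  move=> t1; exists (Num.bound t) => //=; rewrite in_itv /= t1 /=.
  apply: ltW; apply: lt_le_trans (_ : (Num.bound t)%:R <= _).
    exact/archi_boundP/ltW/(lt_trans ltr01).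
  by rewrite -natrX ler_nat ltnW // ltn_expl.
apply: (@integral_power_kernel_dilates _ 2) => //.
- by rewrite powR_gt1 // ltr1n.
- move=> i j ij; apply/subsetPset => t /=; rewrite !in_itv /= => /andP[-> /= h].
  by rewrite (le_trans h) // ler_weXn2l // ler1n.
- by rewrite expr0 set_itv_ge // -leNgt.
- by apply: integral_power_kernel_bounded; rewrite // addr_ge0 // ltW.
- move=> k; rewrite disj_set2E; apply/eqP; rewrite -subset0 => t /= [].
  rewrite !in_itv /= => /andP[_ h] /andP[h' _]; move: h'.
  by rewrite ltr_pdivlMr // mul1r ltNge h.
- move=> k; apply/seteqP; split=> t /=; rewrite !in_itv /=.
    move=> /andP[t1 tk]; have [t2|t2] := leP t (2 ^+ 1); [left|right].
      by rewrite t1.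
    by rewrite ltr_pdivlMr // mul1r t2 ler_pdivrMr // -exprSr.
  case=> /andP[h1 h2].
    by rewrite h1 (le_trans h2) // ler_weXn2l // ler1n.
  rewrite exprSr -ler_pdivrMr // h2 andbT.
  by move: h1; rewrite ltr_pdivlMr // mul1r; apply: lt_trans; rewrite ltr1n.
Qed.

(** Dilates by 1/2 of the annulus ]1/2, 1], with ratio 2^(-t). The condition [t <= n%:R] keeps the
    exponent n - t nonnegative, so that on each annulus the kernel is bounded by its value at the
    inner radius. *)
Lemma origin_integral_fin (t : R) : 0 < t -> t <= n%:R ->
  (J (- t) `]0%R, 1%R]%classic < +oo)%E.
Proof.
move=> t0 tn.
have h01 : 0 < 2^-1 :> R by rewrite invr_gt0.
have -> : `]0, 1]%classic = \bigcup_k `]2^-1 ^+ k, 1]%classic :> set R.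
  apply/seteqP; split=> u /=; rewrite in_itv /=; last first.
    case=> k _; rewrite /= in_itv /= => /andP[h ->]; rewrite andbT.
    by apply: lt_trans h; rewrite exprn_gt0.
  move=> /andP[u0 u1]; exists (Num.bound u^-1) => //=; rewrite in_itv /= u1 andbT.
  rewrite exprVn invf_plt ?posrE ?exprn_gt0 //.
  apply: lt_le_trans (_ : (Num.bound u^-1)%:R <= _).
    by apply: archi_boundP; rewrite invr_ge0 ltW.
  by rewrite -natrX ler_nat ltnW // ltn_expl.
apply: (@integral_power_kernel_dilates _ 2^-1) => //.
- rewrite powRN powRV // invrK.
  by rewrite powR_gt1 // ltr1n.
- move=> i j ij; apply/subsetPset => u /=; rewrite !in_itv /= => /andP[h ->].
  rewrite andbT; apply: le_lt_trans h; rewrite ler_wiXn2l ?(ltW h01) //.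
  by rewrite invf_le1 // ler1n.
- by rewrite expr0 set_itv_ge // -leNgt.
- by apply: integral_power_kernel_bounded; rewrite ?subr_ge0 // exprn_gt0.
- move=> k; rewrite disj_set2E; apply/eqP; rewrite -subset0 => u /= [].
  rewrite !in_itv /= invrK => /andP[h _] /andP[_ h']; move: h'.
  by rewrite -ler_pdivlMr // mul1r leNgt -[2^-1]expr1 h.
- move=> k; apply/seteqP; split=> u /=; rewrite !in_itv /=.
    move=> /andP[t1 tk]; have [t2|t2] := ltP (2^-1 ^+ 1) u; [left|right].
      by rewrite tk andbT.
    rewrite invrK -ler_pdivlMr // mul1r -[2^-1]expr1 t2 andbT.
    by rewrite -ltr_pdivrMr // -exprSr.
  case=> /andP[h1 h2].
    rewrite h2 andbT; apply: le_lt_trans h1; rewrite ler_wiXn2l ?(ltW h01) //.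
    by rewrite invf_le1 // ler1n.
  move: h1 h2; rewrite invrK -ltr_pdivrMr // -exprSr => -> /=.
  rewrite -ler_pdivlMr // mul1r => /le_trans; apply.
  by rewrite invf_le1 // ler1n.
Qed.

(** A zero integral would force the kernel to vanish almost everywhere outside the unit ball, but it
    is positive on the cube ]1, 2]^n, which has measure 1 and lies there because n > 0. *)
Lemma tail_integral_gt0 (a : R) : (0 < n)%N -> (0 < J a `]1%R, +oo[%classic)%E.
Proof.
move=> n0; rewrite lt_def; apply/andP; split; last first.
  by apply: integral_ge0 => y _; exact: power_kernel_ge0.
apply/eqP => J0.
have m1 : measurable (`]1, +oo[%classic : set R) by exact: measurable_itv.
have mD := measurable_enorm_set m1.
have mk : measurable_fun [set y : 'rV[R]_n | `]1, +oo[%classic (enorm y)] (power_kernel a).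
  by apply: measurable_funTS; exact: measurable_power_kernel.
have : (\int[mu]_(y in [set y | `]1%R, +oo[%classic (enorm y)]) `|power_kernel a y| = 0)%E.
  by under eq_integral do rewrite gee0_abs ?power_kernel_ge0 //.
move=> /(ae_eq_integral_abs mu mD mk)[B [mB B0 hB]].
pose I : set R := `]1, 2]%classic.
have mI : measurable I by exact: measurable_itv.
have lI : lebesgue_measure I = 1%:E.
  rewrite /I lebesgue_measure_itv /= lte_fin ltr1n /= -EFinB; congr EFin; ring.
have := lebesgue_rV_cube mI n lI; rewrite expr1n => c1.
have : (mu [set y : 'rV[R]_n | forall i, I (y ord0 i)] <= mu B)%E.
  apply: le_measure; rewrite ?inE //; first exact: measurable_rV_cube.
  move=> y yI; apply: hB => /= h.
  have y1 : 1 < enorm y.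
    have := yI (Ordinal n0); rewrite /I /= in_itv /= => /andP[y1 _].
    by apply: (lt_le_trans y1); apply: le_trans (ler_norm _) (coord_le_enorm _ _).
  have := h; rewrite in_itv /= y1 => /(_ isT) [] /eqP.
  by rewrite invr_eq0 gt_eqF // powR_gt0 // (lt_trans _ y1).
by rewrite c1 B0 lee_fin ler10.
Qed.

(** Strict positivity of [c] is what later makes the far part of the symmetrized integral strictly
    negative. *)
Lemma tail_integralE (a : R) : (0 < n)%N -> 0 < a -> exists2 c : R, 0 < c &
  forall r x, 0 < r ->
    (\int[mu]_(y in [set y | r < enorm (x - y)]%R) power_kernel a (x - y) =
     (c / r `^ a)%:E)%E.
Proof.
move=> n0 a0; have fin := tail_integral_fin a0.
have Jgt0 := tail_integral_gt0 a n0; have J0 := ltW Jgt0.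
exists (fine (J a `]1%R, +oo[%classic)); first by rewrite fine_gt0 // Jgt0 fin.
move=> r x r0.
transitivity (\int[mu]_(y in [set y | `]r, +oo[%classic (enorm (x - y))])
    power_kernel a (x - y))%E.
  by congr integral; apply/seteqP; split=> y /=; rewrite in_itv /= andbT.
rewrite (@integral_power_kernel_translate R n a `]r, +oo[%classic) //.
rewrite (integral_power_kernelZ _ _ r0) // mulrC EFinM fineK ?ge0_fin_numE //.
congr (_ * integral _ _ _)%E; apply/seteqP.
by split=> y /=; rewrite !in_itv /= !andbT -ltr_pdivrMl // mulVf ?gt_eqF.
Qed.

Lemma origin_integralE (t : R) : 0 < t -> t <= n%:R -> exists2 c : R, 0 <= c &
  forall r x, 0 < r ->
    (\int[mu]_(y in [set y | 0 < enorm (x - y) <= r]%R)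
       power_kernel (- t) (x - y) = (c * r `^ t)%:E)%E.
Proof.
move=> t0 tn; have fin := origin_integral_fin t0 tn.
have J0 : (0 <= J (- t) `]0%R, 1%R]%classic)%E.
  by apply: integral_ge0 => y _; exact: power_kernel_ge0.
exists (fine (J (- t) `]0%R, 1%R]%classic)); first exact: fine_ge0.
move=> r x r0.
transitivity (\int[mu]_(y in [set y | `]0%R, r]%classic (enorm (x - y))])
    power_kernel (- t) (x - y))%E.
  by congr integral; apply/seteqP; split=> y /=; rewrite in_itv /=.
rewrite (@integral_power_kernel_translate R n (- t) `]0%R, r]%classic) //.
rewrite (integral_power_kernelZ _ _ r0) // mulrC EFinM fineK ?ge0_fin_numE //.
rewrite powRN invrK; congr (_ * integral _ _ _)%E; apply/seteqP.
split=> y /=; rewrite !in_itv /= -ler_pdivlMl // mulVf ?gt_eqF //.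
  by rewrite pmulr_rgt0.
by rewrite pmulr_rgt0.
Qed.

End power_kernel_integrals.

(** * The inversion *)

Section inversion.
Variables (R : realType) (n : nat).
Hypothesis n_gt0 : (0 < n)%N.
Local Notation mu := (lebesgue_rV R n).
Local Notation leb := (@lebesgue_measure R).
Local Notation w := (@power_kernel R n 0).
Implicit Types y z : 'rV[R]_n.

Definition unit_shell : set 'rV[R]_n := [set y | 1 <= enorm y < expR 1].

Lemma measurable_unit_shell : measurable unit_shell.
Proof.
rewrite /unit_shell [X in measurable X](_ : _ =
    [set y | `[1, expR 1[%classic (enorm y)]).
  by apply: measurable_enorm_set; exact: measurable_itv.
by apply/seteqP; split=> y /=; rewrite in_itv.
Qed.

Lemma measurable_dilation :
  measurable_fun setT (fun p : 'rV[R]_n * R => expR p.2 *: p.1).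
Proof.
apply: measurable_fun_rVP => i; rewrite /rV_coord /comp.
under eq_fun do rewrite mxE.
apply: measurable_funM.
  by apply: measurableT_comp => //; exact: measurable_expR.
exact: (measurableT_comp (measurable_rV_coord i) measurable_fst).
Qed.

(** The origin is fixed by all dilations and never enters [unit_shell]; the convention 0^-1 = 0
    makes it contribute 0 on both sides of the orbit identity. *)
Lemma power_kernel0_0 : w 0 = 0%E.
Proof.
by rewrite /power_kernel enorm0 addr0 powR0 ?invr0 // pnatr_eq0 -lt0n.
Qed.

Lemma integral_dilated_shell y : y != 0 ->
  (\int[leb]_t (\1_unit_shell (expR t *: y)%R : R)%:E = 1)%E.
Proof.
move=> y0; have ey0 : 0 < enorm y by rewrite enorm_gt0.
pose I : set R := `[- ln (enorm y), 1 - ln (enorm y)[%classic.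
transitivity (\int[leb]_t (\1_I t : R)%:E)%E.
  apply: eq_integral => t _; rewrite !indicE; congr (_ %:R %:E).
  have -> : (t \in I) = (expR t *: y \in unit_shell); last by [].
  apply/idP/idP; rewrite !inE /I /unit_shell /= in_itv /= enormZ gtr0_norm ?expR_gt0 //.
    move=> /andP[h1 h2].
    rewrite -[X in _ * X]lnK ?posrE // -expRD -{1}expR0 ler_expR ltr_expR.
    by rewrite -lerBlDr sub0r h1 /= -ltrBrDr h2.
  rewrite -[X in _ * X]lnK ?posrE // -expRD -{1}expR0 ler_expR ltr_expR.
  by rewrite -lerBlDr sub0r -ltrBrDr.
have lI : (lebesgue_measure I = 1)%E.
  rewrite /I lebesgue_measure_itv /= lte_fin.
  rewrite ifT; last by rewrite -[X in X < _]add0r ltrD2r ltr01.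
  by rewrite -EFinB opprK subrK.
by rewrite integral_indic ?setIT //; exact: measurable_itv.
Qed.

(* Fubini over the dilations [expR t]: every orbit spends total time 1 in
   [unit_shell], and the measure |y|^(-n) dy is dilation invariant.  On the right
   only [t |-> - t] is needed to invert the orbits. *)
Lemma integral_dilations (h : 'rV[R]_n -> \bar R) :
  measurable_fun setT h -> (forall y, (0 <= h y)%E) ->
  (\int[mu]_y (w y * h y) =
   \int[mu]_y (w y * (\1_unit_shell y : R)%:E *
               \int[leb]_t h (expR t *: y)%R))%E.
Proof.
move=> mh h0.
have mw := @measurable_power_kernel R n 0.
have w0 := @power_kernel_ge0 R n 0.
have mS : measurable_fun setT (fun y : 'rV[R]_n => (\1_unit_shell y : R)%:E).
  by apply/measurable_EFinP; apply: measurable_indic; exact: measurable_unit_shell.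
have S0 y : (0 <= (\1_unit_shell y : R)%:E)%E by rewrite lee_fin indicE.
have mwh : measurable_fun setT (fun y => (w y * h y)%E).
  exact: emeasurable_funM.
have wh0 y : (0 <= w y * h y)%E by rewrite mule_ge0.
pose F (p : 'rV[R]_n * R) := (w p.1 * h p.1 * (\1_unit_shell (expR p.2 *: p.1)%R : R)%:E)%E.
have mF : measurable_fun setT F.
  apply: emeasurable_funM; first exact: (measurableT_comp mwh measurable_fst).
  exact: (measurableT_comp mS measurable_dilation).
have F0 p : (0 <= F p)%E by rewrite mule_ge0.
pose G (p : 'rV[R]_n * R) := (w p.1 * (\1_unit_shell p.1 : R)%:E * h (expR p.2 *: p.1)%R)%E.
have mG : measurable_fun setT G.
  apply: emeasurable_funM; last exact: (measurableT_comp mh measurable_dilation).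
  apply: emeasurable_funM; first exact: (measurableT_comp mw measurable_fst).
  exact: (measurableT_comp mS measurable_fst).
have G0 p : (0 <= G p)%E by rewrite !mule_ge0.
transitivity (\int[mu]_y \int[leb]_t F (y, t))%E.
  apply: eq_integral => y _; rewrite /F /=.
  have [->|y0] := eqVneq y 0.
    rewrite power_kernel0_0 mul0e integral0_eq // => t _.
    by rewrite mul0e.
  rewrite ge0_integralZl //.
  - by rewrite integral_dilated_shell // mule1.
  - exact: (measurable_fun_pair2 y (measurableT_comp mS measurable_dilation)).
rewrite fubini_tonelli //.
(* For fixed [t], substituting e^(-t) y for y moves the dilation from the shell to [h]; the Jacobian
   cancels against the degree -n homogeneity of [w]. *)
transitivity (\int[leb]_t \int[mu]_y G (y, - t)%R)%E.
  apply: eq_integral => t _; rewrite /F /G /=.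
  have mFt : measurable_fun setT (fun y => F (y, t)).
    exact: (measurable_fun_pair1 t mF).
  have F0t y : (0 <= F (y, t))%E by [].
  have et : expR (- t) != 0 by rewrite gt_eqF // expR_gt0.
  rewrite -[LHS](ge0_integral_rV_affine 0 et mFt F0t) -[LHS]ge0_integralZl //; last first.
    exact: (measurableT_comp mFt (@measurable_rV_affine R n (expR (- t)) 0)).
  apply: eq_integral => y _; rewrite /F /= addr0 power_kernelZ // powRr0 invr1 mul1e.
  rewrite scalerA -expRD subrr expR0 scale1r !muleA -EFinM divff ?mul1r; last first.
    by rewrite expf_neq0 // normr_eq0.
  by rewrite /power_kernel muleAC.
pose G' (p : 'rV[R]_n * R) := G (p.1, (- p.2)%R).
have mG' : measurable_fun setT G'.
  apply: (measurableT_comp mG); apply: measurable_fun_pair => //=.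
  by apply: measurable_funN; exact: measurable_snd.
have G'0 p : (0 <= G' p)%E by exact: G0.
rewrite -[LHS](fubini_tonelli (m1 := mu) (m2 := lebesgue_measure) G' mG' G'0).
apply: eq_integral => y _; rewrite /G' /G /=.
have mhy : measurable_fun setT (fun t : R => h (expR t *: y)).
  exact: (measurable_fun_pair2 y (measurableT_comp mh measurable_dilation)).
have n1 : -1 != 0 :> R by rewrite oppr_eq0 oner_eq0.
rewrite -[X in (_ = _ * X)%E](ge0_integral_lebesgue_affine 0 n1 mhy) //.
rewrite normrN1 mul1e.
have mhN : measurable_fun setT (fun t : R => h (expR (- t) *: y)).
  apply: (measurableT_comp mhy (f := fun t : R => h (expR t *: y))).
  exact: oppr_measurable.
have c0 : (0 <= w y * (\1_unit_shell y : R)%:E)%E by exact: mule_ge0.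
rewrite [LHS](ge0_integralZl leb measurableT mhN (fun t _ => h0 _) c0).
by congr (_ * _)%E; apply: eq_integral => t _; rewrite mulN1r addr0.
Qed.

End inversion.

(** The origin is sent to itself; hence the condition [G 0 = 0] in the changes of variables
    below. *)
Definition inversion (R : realType) (n : nat) (rho : R) (y : 'rV[R]_n) : 'rV[R]_n :=
  (rho ^+ 2 / enorm y ^+ 2) *: y.

Section inversion_change_of_variables.
Variables (R : realType) (n : nat) (rho : R).
Hypotheses (n_gt0 : (0 < n)%N) (rho_gt0 : 0 < rho).
Local Notation mu := (lebesgue_rV R n).
Local Notation w := (@power_kernel R n 0).
Local Notation inv := (@inversion R n rho).
Implicit Types y z : 'rV[R]_n.

Lemma enorm_inversion y : enorm (inv y) = rho ^+ 2 / enorm y.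
Proof.
rewrite enormZ ger0_norm ?divr_ge0 ?sqr_ge0 //.
have [->|y0] := eqVneq (enorm y) 0; first by rewrite mulr0 invr0 mulr0.
by rewrite expr2 invfM -!mulrA mulVf // mulr1.
Qed.

Lemma enormB_inversion x y : enorm x = rho -> y != 0 ->
  enorm (x - inv y) = rho * enorm (x - y) / enorm y.
Proof.
move=> xr y0; have ey0 : 0 < enorm y by rewrite enorm_gt0.
apply/eqP; rewrite -(@eqrXn2 _ 2) ?divr_ge0 ?mulr_ge0 ?enorm_ge0 ?(ltW rho_gt0) //.
apply/eqP; rewrite exprMn exprMn exprVn !sqr_enormB enorm_inversion dotvZr xr.
by field; rewrite gt_eqF.
Qed.

Lemma measurable_inversion : measurable_fun setT inv.
Proof.
apply: measurable_fun_rVP => i; rewrite /rV_coord /comp.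
under eq_fun do rewrite mxE.
apply: measurable_funM; last exact: measurable_rV_coord.
under eq_fun do rewrite -(powR_mulrn 2 (enorm_ge0 _)) -powRN.
apply: measurable_funM => //.
by apply: (measurableT_comp (measurable_powR _)); exact: measurable_enorm.
Qed.

(** On the orbit of [y] the inversion is t |-> b - t with b = ln (rho^2 / |y|^2), a
    measure-preserving map of the line; [integral_dilations] reduces both sides to such orbit
    integrals. *)
Lemma integral_inversion0 (h : 'rV[R]_n -> \bar R) :
  measurable_fun setT h -> (forall y, (0 <= h y)%E) ->
  (\int[mu]_y (w y * h y) = \int[mu]_y (w y * h (inv y)))%E.
Proof.
move=> mh h0.
have mhi : measurable_fun setT (fun y => h (inv y)).
  by apply: (measurableT_comp mh); exact: measurable_inversion.
rewrite (integral_dilations n_gt0 mh h0).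
rewrite (integral_dilations n_gt0 mhi (fun y => h0 (inv y))).
apply: eq_integral => y _; have [->|y0] := eqVneq y 0.
  by rewrite power_kernel0_0 // !mul0e.
congr (_ * _)%E; have ey0 : 0 < enorm y by rewrite enorm_gt0.
pose b := ln (rho ^+ 2 / enorm y ^+ 2).
have E t : inv (expR t *: y) = expR (-1 * t + b) *: y.
  rewrite /inversion enormZ gtr0_norm ?expR_gt0 // scalerA; congr (_ *: _).
  rewrite expRD lnK ?posrE ?divr_gt0 ?exprn_gt0 // mulN1r expRN.
  by field; rewrite !gt_eqF ?expR_gt0.
under [RHS]eq_integral do rewrite E.
have n1 : -1 != 0 :> R by rewrite oppr_eq0 oner_eq0.
have mhy : measurable_fun setT (fun t : R => h (expR t *: y)).
  exact: (measurable_fun_pair2 y (measurableT_comp mh (@measurable_dilation R n))).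
rewrite -[LHS](ge0_integral_lebesgue_affine b n1 mhy) //.
by rewrite normrN1 mul1e.
Qed.

(** [G] is split as |y|^(-n) times |y|^n G; composing the second factor with the inversion produces
    the Jacobian (rho / |y|)^(2n). *)
Lemma ge0_integral_inversion (G : 'rV[R]_n -> \bar R) :
  measurable_fun setT G -> (forall y, (0 <= G y)%E) -> G 0 = 0%E ->
  (\int[mu]_y G y =
   \int[mu]_y (((rho / enorm y) ^+ (2 * n))%:E * G (inv y)))%E.
Proof.
move=> mG G0 G00.
have mn : measurable_fun setT (fun y : 'rV[R]_n => (enorm y ^+ n)%:E).
  by apply/measurable_EFinP; apply: measurable_funX; exact: measurable_enorm.
transitivity (\int[mu]_y (w y * ((enorm y ^+ n)%:E * G y)))%E.
  apply: eq_integral => y _; have [->|y0] := eqVneq y 0.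
    by rewrite G00 !mule0.
  rewrite muleA -EFinM addr0 powR_mulrn ?enorm_ge0 // mulVf ?mul1e //.
  by rewrite expf_neq0 // enorm_eq0.
rewrite (integral_inversion0 (h := fun y => ((enorm y ^+ n)%:E * G y)%E)); last 2 first.
- exact: emeasurable_funM.
- by move=> y; rewrite mule_ge0 // lee_fin exprn_ge0 // enorm_ge0.
apply: eq_integral => y _; have [->|y0] := eqVneq y 0.
  by rewrite /inversion scaler0 G00 !mule0.
rewrite muleA -EFinM addr0 powR_mulrn ?enorm_ge0 // enorm_inversion.
congr (_%:E * _)%E; rewrite -exprVn -exprMn exprM; congr (_ ^+ _).
by field; rewrite enorm_eq0.
Qed.

Lemma integral_inversion (G : 'rV[R]_n -> \bar R) :
  measurable_fun setT G -> G 0 = 0%E ->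
  (\int[mu]_y G y =
   \int[mu]_y (((rho / enorm y) ^+ (2 * n))%:E * G (inv y)))%E.
Proof.
move=> mG G00.
have J0 y : 0 <= (rho / enorm y) ^+ (2 * n).
  by rewrite exprn_ge0 // divr_ge0 ?enorm_ge0 // ltW.
rewrite integralE [RHS]integralE.
rewrite ge0_integral_inversion //; last by rewrite !funeposE G00 maxxx.
  rewrite [X in (_ - X)%E](ge0_integral_inversion (measurable_funeneg mG)) //.
    congr (_ - _)%E; apply: eq_integral => y _.
      by rewrite !funeposE maxe_pMr ?mule0 ?lee_fin.
    by rewrite !funenegE -muleN maxe_pMr ?mule0 ?lee_fin.
  by rewrite !funenegE G00 oppe0 maxxx.
exact: measurable_funepos.
Qed.

End inversion_change_of_variables.

(** * Removing null sets and dominating integrands *)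

Section null_sets.
Context d (T : measurableType d) (R : realType).
Variables (mu : {measure set T -> \bar R}) (A : set T).
Hypotheses (mA : measurable A) (A0 : mu A = 0%E).

Import HBNNSimple.

(* No measurability of [f]: below [f], the simple functions supported off [A]
   have the same integrals as all simple functions. *)
Lemma ge0_integral_setD_null (D : set T) (f : T -> \bar R) :
  (forall x, D x -> (0 <= f x)%E) ->
  (\int[mu]_(x in D) f x = \int[mu]_(x in D `\` A) f x)%E.
Proof.
move=> f0; rewrite !ge0_integralE //; last by move=> x [Dx _]; exact: f0.
apply/eqP; rewrite eq_le; apply/andP; split.
  apply: ge_ereal_sup => _ [h hf <-].
  have mAC : measurable (~` A) by exact: measurableC.
  apply: ereal_sup_ubound; exists (proj_nnsfun h mAC).
    move=> x /=; rewrite /patch; case: ifPn => [|xDA].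
      rewrite inE => -[Dx nAx]; rewrite mindicE mem_set //= mulr1.
      by have := hf x; rewrite /patch mem_set.
    have [xA|nxA] := pselect (A x).
      by rewrite mindicE memNset /= ?mulr0 // => /(_ xA).
    have := hf x; rewrite /patch memNset ?lee_fin; last first.
      by move=> Dx; move/negP: xDA; apply; rewrite inE.
    by move=> h0; rewrite mindicE mem_set //= mulr1.
  rewrite -!integralT_nnsfun.
  have mh : measurable_fun setT (EFin \o h) by exact/measurable_EFinP.
  rewrite [RHS](@ge0_negligible_integral _ _ _ _ _ A) //; last first.
    by move=> x _; rewrite /= lee_fin.
  rewrite setTD [RHS]integral_mkcond; apply: eq_integral => x _.
  rewrite /patch /= mindicE in_setC; case: (x \in A) => /=; first by rewrite mulr0.
  by rewrite mulr1.
apply: le_ereal_sup => _ [h hf <-]; exists h => // x.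
apply: (le_trans (hf x)); rewrite /patch; case: ifPn => [|xDA].
  by rewrite inE => -[Dx _]; rewrite mem_set.
by case: ifPn => // /set_mem; exact: f0.
Qed.

Lemma integral_setD_null (D : set T) (f : T -> \bar R) :
  (\int[mu]_(x in D) f x = \int[mu]_(x in D `\` A) f x)%E.
Proof.
by rewrite integralE [RHS]integralE; congr (_ - _)%E; exact: ge0_integral_setD_null.
Qed.

Lemma Rintegral_setD_null (D : set T) (f : T -> R) :
  \int[mu]_(x in D) f x = \int[mu]_(x in D `\` A) f x.
Proof. by rewrite /Rintegral integral_setD_null. Qed.

End null_sets.

Lemma le_integrable_EFin d (T : measurableType d) (R : realType)
    (mu : {measure set T -> \bar R}) (D : set T) (f g : T -> R) :
  measurable D -> measurable_fun D f -> (forall x, D x -> `|f x| <= g x) ->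
  mu.-integrable D (EFin \o g) -> mu.-integrable D (EFin \o f).
Proof.
move=> mD mf fg ig; apply: le_integrable ig => //; first exact/measurable_EFinP.
by move=> x Dx; rewrite /= lee_fin (le_trans (fg x Dx)) // ler_norm.
Qed.

(** * The fractional Laplacian *)

Definition kern (R : realType) (n : nat) (s : R) (x y : 'rV[R]_n) : R :=
  (enorm (x - y) `^ (n%:R + 2 * s))^-1.

Section kernel.
Variables (R : realType) (n : nat) (s : R).
Hypotheses (s_gt0 : 0 < s) (s_lt1 : s < 1) (s_n : 2 * s < n%:R) (n_ge2 : (2 <= n)%N).
Local Notation mu := (lebesgue_rV R n).
Implicit Types x y : 'rV[R]_n.

Lemma kern_ge0 x y : 0 <= kern s x y.
Proof. by rewrite invr_ge0 powR_ge0. Qed.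

Lemma measurable_kern x : measurable_fun setT (kern s x).
Proof.
rewrite /kern; under eq_fun do rewrite -powRN.
by apply: (measurableT_comp (measurable_powR _)); exact: measurable_enormB.
Qed.

Lemma kern_sqr x y : 0 < enorm (x - y) ->
  (enorm (x - y) ^+ 2 * kern s x y)%:E = power_kernel (- (2 - 2 * s)) (x - y).
Proof.
move=> h; rewrite /kern /power_kernel; congr EFin.
rewrite -powR_mulrn ?enorm_ge0 // -!powRN -powRD ?(gt_eqF h) ?implybT //.
by congr powR; ring.
Qed.

Lemma kern_tail : exists2 c : R, 0 < c & forall r x, 0 < r ->
  (\int[mu]_(y in [set y | r < enorm (x - y)]%R) (kern s x y)%:E =
   (c / r `^ (2 * s))%:E)%E.
Proof. by apply: tail_integralE; rewrite ?mulr_gt0 // (ltn_trans _ n_ge2). Qed.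

(** [s < 1] makes the exponent 2 - 2s positive, and [2 <= n] keeps it at most n, as
    [origin_integralE] requires. *)
Lemma kern_origin : exists2 c : R, 0 <= c & forall r x, 0 < r ->
  (\int[mu]_(y in [set y | 0 < enorm (x - y) <= r]%R)
     (enorm (x - y) ^+ 2 * kern s x y)%:E = (c * r `^ (2 - 2 * s))%:E)%E.
Proof.
have [] := @origin_integralE R n (2 - 2 * s).
- by rewrite subr_gt0 -[X in _ < X]mulr1 ltr_pM2l.
- have n2 : 2%:R <= n%:R :> R by rewrite ler_nat.
  by move: s_gt0; lra.
move=> c c0 cE; exists c => // r x r0; rewrite -(cE r x r0).
by apply: eq_integral => y; rewrite inE => /andP[h _]; rewrite kern_sqr.
Qed.

Lemma integrable_kern r x : 0 < r ->
  mu.-integrable [set y | r < enorm (x - y)] (EFin \o kern s x).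
Proof.
move=> r0; have [c _ cE] := kern_tail; apply/integrableP; split.
  by apply/measurable_EFinP; apply: measurable_funTS; exact: measurable_kern.
under eq_integral do rewrite /= ger0_norm ?kern_ge0 //.
by rewrite cE // ltry.
Qed.

Lemma integrable_sqr_kern r x : 0 < r ->
  mu.-integrable [set y | 0 < enorm (x - y) <= r]
    (fun y => (enorm (x - y) ^+ 2 * kern s x y)%:E).
Proof.
move=> r0; have [c _ cE] := kern_origin; apply/integrableP; split.
  apply/measurable_EFinP; apply: measurable_funTS; apply: measurable_funM.
    by apply: measurable_funX; exact: measurable_enormB.
  exact: measurable_kern.
rewrite (_ : (\int[mu]_(y in _) _)%E = (c * r `^ (2 - 2 * s))%:E) ?ltry // -(cE r x r0).
apply: eq_integral => y _; rewrite gee0_abs // lee_fin.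
by rewrite mulr_ge0 ?sqr_ge0 ?kern_ge0.
Qed.

Lemma Rintegral_kern : exists2 c : R, 0 < c & forall r x, 0 < r ->
  \int[mu]_(y in [set y | r < enorm (x - y)]) kern s x y = c / r `^ (2 * s).
Proof.
have [c c0 cE] := kern_tail; exists c => // r x r0.
by rewrite /Rintegral cE.
Qed.

Lemma Rintegral_sqr_kern : exists2 c : R, 0 <= c & forall r x, 0 < r ->
  \int[mu]_(y in [set y | 0 < enorm (x - y) <= r])
     (enorm (x - y) ^+ 2 * kern s x y) = c * r `^ (2 - 2 * s).
Proof.
have [c c0 cE] := kern_origin; exists c => // r x r0.
by rewrite /Rintegral cE.
Qed.

Lemma measurable_enorm_oc r1 r2 x : measurable [set y : 'rV[R]_n | r1 < enorm (x - y) <= r2].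
Proof.
rewrite [X in measurable X](_ : _ = [set y | enorm (x - y) \in `]r1, r2]]).
  exact: measurable_enorm_itv.
by apply/seteqP; split=> y /=; rewrite in_itv.
Qed.

Lemma measurable_dotvB b x : measurable_fun setT (fun y : 'rV[R]_n => dotv b (y - x)).
Proof.
apply: measurable_sum => i; apply: measurable_funM => //.
under eq_fun do rewrite !mxE.
apply: measurable_funD => //; exact: measurable_rV_coord.
Qed.

Lemma integrable_dotv_kern b x (r1 r2 : R) : 0 < r1 ->
  mu.-integrable [set y | r1 < enorm (x - y) <= r2]
    (EFin \o (fun y => dotv b (y - x) * kern s x y)).
Proof.
move=> r10; have mS := measurable_enorm_oc r1 r2 x.
apply: (@le_integrable_EFin _ _ _ mu _ _ (fun y => (enorm b * r2) * kern s x y)) => //.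
- apply: measurable_funTS; apply: measurable_funM; first exact: measurable_dotvB.
  exact: measurable_kern.
- move=> y /andP[_ yr]; rewrite normrM (ger0_norm (kern_ge0 x y)).
  rewrite ler_wpM2r ?kern_ge0 // (@le_trans _ _ (enorm b * enorm (y - x))) //.
    by rewrite ler_norml dotv_le andbT lerNl -dotvNr (le_trans (dotv_le _ _)) // enormN.
  by rewrite enormBC ler_wpM2l // enorm_ge0.
- have ik : mu.-integrable [set y | r1 < enorm (x - y) <= r2] (EFin \o kern s x).
    apply: (integrableS (measurable_enorm_gt r1 x) mS _ (integrable_kern x r10)).
    by move=> y /andP[].
  rewrite (_ : EFin \o _ = (fun y => (enorm b * r2)%:E * (EFin \o kern s x) y)%E) //.
  exact: integrableZl.
Qed.

(** The reflection y |-> 2 x - y preserves the annulus and exchanges the positive and negative parts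
    of the integrand. Should both parts be infinite, [fine] still returns 0. *)
Lemma Rintegral_odd_kern b x r1 r2 :
  \int[mu]_(y in [set y | r1 < enorm (x - y) <= r2]) (dotv b (y - x) * kern s x y) = 0.
Proof.
set S := [set y | _]; have mS : measurable S by exact: measurable_enorm_oc.
pose g y := (dotv b (y - x) * kern s x y)%:E.
have mg : measurable_fun setT g.
  apply/measurable_EFinP; apply: measurable_funM; first exact: measurable_dotvB.
  exact: measurable_kern.
rewrite /Rintegral -/(g _) integralE.
suff -> : (\int[mu]_(y in S) g^\- y = \int[mu]_(y in S) g^\+ y)%E.
  have : (0 <= \int[mu]_(y in S) g^\+ y)%E by apply: integral_ge0.
  by case: (\int[mu]_(y in S) _)%E => [a||] // _; rewrite -EFinB subrr.
rewrite integral_mkcond [RHS]integral_mkcond.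
have n1 : -1 != 0 :> R by rewrite oppr_eq0 oner_eq0.
have mp : measurable_fun setT (g^\+ \_ S)%E.
  by apply: (measurable_restrictT _ mS).1; apply: measurable_funTS; exact: measurable_funepos.
have p0 y : (0 <= (g^\+ \_ S) y)%E by apply: erestrict_ge0 => z _; exact: funepos_ge0.
rewrite -[RHS](ge0_integral_rV_affine (x + x) n1 mp p0) normrN1 expr1n mul1e.
apply: eq_integral => y _; rewrite /patch.
have xy : x - (-1 *: y + (x + x)) = - (x - y).
  by apply/rowP => i; rewrite !mxE; ring.
have -> : (-1 *: y + (x + x) \in S) = (y \in S).
  by apply/idP/idP; rewrite !inE /S /= xy enormN.
case: (y \in S) => //; rewrite funenegE funeposE /g -EFinN.
have xy' : -1 *: y + (x + x) - x = - (y - x) by apply/rowP => i; rewrite !mxE; ring.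
by rewrite /kern xy enormN xy' dotvNr mulNr.
Qed.

End kernel.

Section real_integrable.
Context d (T : measurableType d) (R : realType).
Variables (mu : {measure set T -> \bar R}) (D : set T).
Hypothesis mD : measurable D.
Implicit Types f g : T -> R.

Lemma integrableZ_EFin f (c : R) : mu.-integrable D (EFin \o f) ->
  mu.-integrable D (EFin \o (fun y => c * f y)).
Proof. exact: integrableZl. Qed.

Lemma integrableD_EFin f g : mu.-integrable D (EFin \o f) ->
  mu.-integrable D (EFin \o g) -> mu.-integrable D (EFin \o (fun y => f y + g y)).
Proof. exact: integrableD. Qed.

End real_integrable.

(** * Truncated integrals and existence of the principal value *)

Definition truncated_integral (R : realType) (n : nat) (s : R) (u : 'rV[R]_n -> R)
    (x : 'rV[R]_n) (eps : R) : R :=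
  \int[lebesgue_rV R n]_(y in [set y | (eps < enorm (x - y))%R])
    ((u x - u y) / enorm (x - y) `^ (n%:R + 2 * s)).

Section truncated_integrals.
Variables (R : realType) (n : nat) (s : R).
Hypotheses (s_gt0 : 0 < s) (s_lt1 : s < 1) (s_n : 2 * s < n%:R) (n_ge2 : (2 <= n)%N).
Local Notation mu := (lebesgue_rV R n).
Implicit Types (x y : 'rV[R]_n) (u : 'rV[R]_n -> R) (A : set 'rV[R]_n).

Lemma kern_le_weight x (r : R) : 0 < r -> exists2 M : R, 0 <= M &
  forall y, r < enorm (x - y) -> kern s x y <= M / (1 + enorm y `^ (n%:R + 2 * s)).
Proof.
move=> r0; pose a := n%:R + 2 * s.
have a0 : 0 < a by rewrite addr_gt0 ?mulr_gt0 // (lt_trans _ s_n) // mulr_gt0.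
(* If |x - y| > r then |y| <= |x| + |x - y| <= B |x - y|; the two terms of the constant below
   account for the two terms of the weight 1 + |y|^(n + 2s). *)
pose B := enorm x / r + 1.
have B0 : 0 <= B by rewrite addr_ge0 // divr_ge0 ?enorm_ge0 // ltW.
exists ((r `^ a)^-1 + B `^ a) => [|y ry].
  by rewrite addr_ge0 ?invr_ge0 ?powR_ge0.
have xy0 : 0 < enorm (x - y) := lt_trans r0 ry.
have xya : 0 < enorm (x - y) `^ a by rewrite powR_gt0.
rewrite /kern -/a ler_pdivlMr; last by rewrite ltr_pwDl // powR_ge0.
rewrite mulrC ler_pdivrMr // mulrDl; apply: lerD.
  rewrite mulrC ler_pdivlMr ?powR_gt0 // mul1r.
  by rewrite ge0_ler_powR ?nnegrE ?(ltW a0) ?(ltW r0) ?enorm_ge0 // ltW.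
rewrite -powRM ?enorm_ge0 // ge0_ler_powR ?nnegrE ?(ltW a0) ?enorm_ge0 ?mulr_ge0 ?enorm_ge0 //.
rewrite /B mulrDl mul1r; have h := ler_enormD x (- (x - y)).
rewrite enormN opprB addrC subrK in h; apply: (le_trans h); rewrite lerD2r.
by rewrite mulrAC ler_pdivlMr // ler_wpM2l ?enorm_ge0 // ltW.
Qed.

(** [A] is a null Borel set containing the points where [u] differs from its Borel representative.
    Measurability of the truncated integrands is only available off [A], so later estimates first
    discard it. *)
Lemma L2s_integrable u : L2s s u -> exists A, [/\ measurable A, mu A = 0%E,
  measurable_fun (~` A) u & forall x r, 0 < r ->
    mu.-integrable ([set y | r < enorm (x - y)] `\` A)
      (fun y => ((u x - u y) * kern s x y)%:E)].
Proof.
move=> [[v mv [A [mA A0 uvA]]] fin]; exists A.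
have mAC : measurable (~` A) by exact: measurableC.
have uv y : (~` A) y -> u y = v y.
  by move=> nAy; apply: contrapT => h; apply: nAy; exact: uvA.
have mu_u : measurable_fun (~` A) u.
  by apply: (eq_measurable_fun v) => [y|]; [rewrite inE => /uv|exact: measurable_funTS].
split => // x r r0; set D := _ `\` A.
have mD : measurable D by apply: measurableD => //; exact: measurable_enorm_gt.
have DA : D `<=` ~` A by move=> y [].
have mDu : measurable_fun D u by exact: measurable_funS mu_u.
have mDk : measurable_fun D (kern s x) by apply: measurable_funTS; exact: measurable_kern.
have [M M0 hM] := kern_le_weight x r0.
pose wt y : R := `|u y| / (1 + enorm y `^ (n%:R + 2 * s)).
have wt1 y : 0 < 1 + enorm y `^ (n%:R + 2 * s) by rewrite ltr_pwDl // powR_ge0.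
have mwt : measurable_fun (~` A) wt.
  apply: measurable_funM; first exact: measurableT_comp.
  apply: (measurable_funS measurableT) => //.
  under eq_fun do rewrite -(powR_inv1 (ltW (wt1 _))).
  apply: (measurableT_comp (measurable_powR _)); apply: measurable_funD => //.
  by apply: (measurableT_comp (measurable_powR _)); exact: measurable_enorm.
have iwt : mu.-integrable (~` A) (EFin \o wt).
  apply/integrableP; split; first exact/measurable_EFinP.
  apply: le_lt_trans fin; rewrite [leRHS](integral_setD_null mA A0) setTD.
  rewrite le_eqVlt; apply/orP; left; apply/eqP.
  apply: eq_integral => y _; rewrite gee0_abs // lee_fin.
  by rewrite divr_ge0 // ltW.
apply: (@le_integrable_EFin _ _ _ mu _ _
    (fun y => `|u x| * kern s x y + M * wt y)) => //.
- by apply: measurable_funM => //; exact: measurable_funB.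
- move=> y [ry nAy]; rewrite normrM (ger0_norm (kern_ge0 s x y)).
  apply: (@le_trans _ _ ((`|u x| + `|u y|) * kern s x y)).
    by rewrite ler_wpM2r ?kern_ge0 // ler_normB.
  rewrite mulrDl lerD2l /wt mulrCA ler_wpM2l //.
  exact: hM.
- apply: integrableD_EFin => //; apply: integrableZ_EFin => //.
    apply: (integrableS _ mD _ (integrable_kern s_gt0 n_ge2 x r0)).
      exact: measurable_enorm_gt.
    by move=> y [].
  by apply: (integrableS mAC mD DA iwt).
Qed.

End truncated_integrals.

Section principal_value.
Variables (R : realType) (n : nat) (s : R).
Hypotheses (s_gt0 : 0 < s) (s_lt1 : s < 1) (s_n : 2 * s < n%:R) (n_ge2 : (2 <= n)%N).
Local Notation mu := (lebesgue_rV R n).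
Implicit Types (x y : 'rV[R]_n) (u : 'rV[R]_n -> R).

Lemma truncated_integral_le u x (eps : R) (G : 'rV[R]_n -> R) : 0 < eps -> L2s s u ->
  (forall y, u x - u y <= G y) ->
  mu.-integrable [set y | eps < enorm (x - y)] (EFin \o (fun y => G y * kern s x y)) ->
  truncated_integral s u x eps <=
    \int[mu]_(y in [set y | eps < enorm (x - y)]) (G y * kern s x y).
Proof.
move=> e0 L2u uG iG; have [A [mA A0 _ iu]] := L2s_integrable s_gt0 s_n n_ge2 L2u.
rewrite /truncated_integral (Rintegral_setD_null mA A0) [leRHS](Rintegral_setD_null mA A0).
have mE := measurable_enorm_gt eps x.
apply: le_Rintegral.
- exact: measurableD.
- exact: iu.
- by apply: (integrableS mE (measurableD mE mA) _ iG) => y [].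
- by move=> y _; rewrite ler_wpM2r ?kern_ge0.
Qed.

(** The linear part at [x] is odd and integrates to 0 over annuli; the remainder is O(|x - y|^2),
    which is absolutely integrable against the kernel near [x] since s < 1. *)
Lemma truncated_integral_cvg u x b (C r : R) : 0 < r -> L2s s u ->
  (forall y, enorm (x - y) <= r ->
     `|u x - u y + dotv b (y - x)| <= C * enorm (x - y) ^+ 2) ->
  cvg (truncated_integral s u x eps @[eps --> 0^'+]).
Proof.
move=> r0 L2u hQ; have [A [mA A0 mu_u iu]] := L2s_integrable s_gt0 s_n n_ge2 L2u.
have [c c0 cE] := Rintegral_sqr_kern s_gt0 s_lt1 n_ge2.
pose f y := (u x - u y) * kern s x y.
pose lin y := dotv b (y - x) * kern s x y.
pose Q y := (u x - u y + dotv b (y - x)) * kern s x y.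
pose S r1 r2 := [set y | r1 < enorm (x - y) <= r2] `\` A.
pose E eps := [set y | eps < enorm (x - y)] `\` A.
have mS r1 r2 : measurable (S r1 r2).
  by apply: measurableD => //; exact: measurable_enorm_oc.
have mE eps : measurable (E eps).
  by apply: measurableD => //; exact: measurable_enorm_gt.
have mQ : measurable_fun (~` A) Q.
  apply: measurable_funM.
    apply: measurable_funD; first exact: measurable_funB.
    by apply: measurable_funTS; exact: measurable_dotvB.
  by apply: measurable_funTS; exact: measurable_kern.
have mAC : measurable (~` A) by exact: measurableC.
have SA r1 r2 : S r1 r2 `<=` ~` A by move=> y [].
have iq t : 0 < t ->
    mu.-integrable (S 0 t) (EFin \o (fun y => C * (enorm (x - y) ^+ 2 * kern s x y))).
  move=> t0; apply: integrableZ_EFin; first exact: mS.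
  apply: (integrableS (measurable_enorm_oc 0 t x) (mS 0 t) _
    (integrable_sqr_kern s_gt0 s_lt1 n_ge2 x t0)).
  by move=> y [].
have QC y t : t <= r -> S 0 t y -> `|Q y| <= C * (enorm (x - y) ^+ 2 * kern s x y).
  move=> tr [/andP[_ yt] _]; rewrite /Q normrM (ger0_norm (kern_ge0 s x y)) mulrA.
  by rewrite ler_wpM2r ?kern_ge0 // hQ // (le_trans yt).
have iQ t : 0 < t -> t <= r -> mu.-integrable (S 0 t) (EFin \o Q).
  move=> t0 tr; apply: (le_integrable_EFin (mS 0 t) _ _ (iq t t0)).
    exact: measurable_funS mQ.
  by move=> y; exact: QC.
(* The limit. At truncation [t <= r] the error is exactly the integral of the remainder [Q] within
   distance [t], hence at most C c t^(2 - 2s). *)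
pose L := \int[mu]_(y in E r) f y + \int[mu]_(y in S 0 r) Q y.
apply: (cvgP L).
have main t : 0 < t -> t <= r ->
    truncated_integral s u x t = L - \int[mu]_(y in S 0 t) Q y.
  move=> t0 tr; rewrite /truncated_integral (Rintegral_setD_null mA A0) -/(E t).
  have EE : E t = E r `|` S t r.
    apply/seteqP; split=> y.
      move=> [/= ty nAy]; have [ry|ry] := ltP r (enorm (x - y)); first by left.
      by right; split=> //=; rewrite ty ry.
    move=> [[/= ry nAy]|[/= /andP[ty _] nAy]]; split => //=.
    exact: le_lt_trans ry.
  have iE : mu.-integrable (E t) (EFin \o f) by exact: iu.
  rewrite -[X in \int[mu]_(y in X) _]/(E t) EE Rintegral_setU //; last 2 first.
  - by rewrite -EE.
  - rewrite disj_set2E; apply/eqP; rewrite -subset0 => y [[/= ry _] [/= /andP[_ yr] _]].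
    by move: ry; rewrite ltNge yr.
  have S0 : S 0 r = S 0 t `|` S t r.
    apply/seteqP; split=> y.
      move=> [/= /andP[y0 yr] nAy]; have [ty|ty] := ltP t (enorm (x - y)).
        by right; split=> //=; rewrite ty yr.
      by left; split=> //=; rewrite y0 ty.
    move=> [[/= /andP[y0 yt] nAy]|[/= /andP[ty yr] nAy]]; split => //=.
      by rewrite y0 (le_trans yt).
    by rewrite (lt_trans t0).
  have -> : L = \int[mu]_(y in E r) f y +
      (\int[mu]_(y in S 0 t) Q y + \int[mu]_(y in S t r) Q y).
    rewrite /L S0 Rintegral_setU //; first by rewrite -S0; exact: iQ.
    rewrite disj_set2E; apply/eqP; rewrite -subset0 => y [[/= /andP[_ yt] _] [/= /andP[ty _] _]].
    by move: ty; rewrite ltNge yt.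
  rewrite -addrA; congr (_ + _); rewrite addrAC subrr add0r.
  have StE : S t r `<=` E t by rewrite EE => y; right.
  have ilin : mu.-integrable (S t r) (EFin \o lin).
    apply: (integrableS (measurable_enorm_oc t r x) (mS t r) _
      (integrable_dotv_kern s_gt0 n_ge2 b x r t0)).
    by move=> y [].
  have -> : \int[mu]_(y in S t r) Q y =
      \int[mu]_(y in S t r) f y + \int[mu]_(y in S t r) lin y.
    rewrite -RintegralD //.
    - by apply: eq_Rintegral => y _; rewrite /Q /f /lin mulrDl.
    - by apply: (integrableS (mE t) (mS t r) StE iE).
  suff -> : \int[mu]_(y in S t r) lin y = 0 by rewrite addr0.
  by rewrite -(Rintegral_setD_null mA A0); exact: Rintegral_odd_kern.
apply/cvgrPdist_le => e e0; near=> t.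
have t0 : 0 < t by [].
have tr : t <= r by near: t; apply: nbhs_right_le.
rewrite main // opprB addrCA subrr addr0.
apply: (le_trans (le_normr_Rintegral (mS 0 t) (iQ t t0 tr))).
apply: (@le_trans _ _ (\int[mu]_(y in S 0 t) (C * (enorm (x - y) ^+ 2 * kern s x y)))).
  apply: le_Rintegral; [exact: mS|exact: integrable_norm (iQ _ _ _)|exact: iq|].
  by move=> y; exact: QC.
rewrite RintegralZl //; last first.
  apply: (integrableS (measurable_enorm_oc 0 t x) (mS 0 t) _
    (integrable_sqr_kern s_gt0 s_lt1 n_ge2 x t0)).
  by move=> y [].
rewrite -(Rintegral_setD_null mA A0) (cE t x t0).
near: t.
have tau0 : 0 < 2 - 2 * s by move: s_lt1; lra.
have h : (C * (c * t `^ (2 - 2 * s))) @[t --> 0^'+] --> C * (c * 0).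
  apply: cvgM; first exact: cvg_cst.
  by apply: cvgM; [exact: cvg_cst|exact: powR_cvg0].
rewrite !mulr0 in h; move/cvgrPdist_le : h => /(_ e e0); apply: filterS => t.
by rewrite sub0r normrN; exact: le_trans (ler_norm _).
Unshelve. all: by end_near. Qed.

End principal_value.

(** * Expansions and gradient bounds from partial derivatives *)

Section directional.
Variables (R : realType) (n : nat).
Implicit Types (x y z h w : 'rV[R]_n) (v : 'rV[R]_n -> R).

Lemma is_derive_line v x w (t : R) : derivable v (x + t *: w) w ->
  is_derive t 1 (fun a : R => v (x + a *: w)) ('D_w v (x + t *: w)).
Proof.
have E : (fun a : R => a^-1 *: (((fun c : R => v (x + c *: w)) \o shift t) (a *: 1)
      - v (x + t *: w))) =
    (fun a : R => a^-1 *: ((v \o shift (x + t *: w)) (a *: w) - v (x + t *: w))).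
  apply/funext => a; congr (_ *: (v _ - _)).
  by rewrite /shift /= scalerDl [a *: 1]mulr1 addrCA.
move=> dv; split; first by rewrite /derivable E.
by rewrite /derive E.
Qed.

Lemma line_mvt v x w (a : R) :
  (forall t, `|t| <= `|a| -> derivable v (x + t *: w) w) ->
  exists2 c, `|c| <= `|a| & v (x + a *: w) - v x = 'D_w v (x + c *: w) * a.
Proof.
move=> dv.
have v0 : v x = v (x + 0 *: w) by rewrite scale0r addr0.
pose g (t : R) := v (x + t *: w); pose dg (t : R) := 'D_w v (x + t *: w).
have [a0|a0] := leP 0 a.
  have h t : t \in `[0, a] -> `|t| <= `|a|.
    by rewrite in_itv /= => /andP[t0 ta]; rewrite !ger0_norm // (le_trans t0).
  have [||c hc E] := @MVT_segment R g dg 0 a a0.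
  - move=> t ta; apply/is_derive_line/dv/h.
    by move: ta; rewrite !in_itv /= => /andP[/ltW -> /ltW ->].
  - apply: derivable_within_continuous => t ta.
    by have [] := is_derive_line (dv t (h t ta)).
  by exists c; [exact: h|rewrite v0 -/(g _) E subr0].
have h t : t \in `[a, 0] -> `|t| <= `|a|.
  by rewrite in_itv /= => /andP[ta t0]; rewrite !ler0_norm ?lerN2 // ltW.
have [||c hc E] := @MVT_segment R g dg a 0 (ltW a0).
- move=> t ta; apply/is_derive_line/dv/h.
  by move: ta; rewrite !in_itv /= => /andP[/ltW -> /ltW ->].
- apply: derivable_within_continuous => t ta.
  by have [] := is_derive_line (dv t (h t ta)).
exists c; first exact: h.
by rewrite v0 -/(g 0) -opprB E sub0r mulrN opprK.
Qed.

(** Staircase from [x] to [x + h]: [pt k] has the first [k] coordinates of [x + h]. Along the path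
    each coordinate differs from that of [x] by at most the corresponding coordinate of [h], so the
    path stays within |h| of [x]. *)
Lemma axis_mvt v x h :
  (forall z, enorm (z - x) <= enorm h -> forall i, derivable v z (delta_mx ord0 i)) ->
  exists2 xi : 'I_n -> 'rV[R]_n, forall i, enorm (xi i - x) <= enorm h &
    v (x + h) - v x = \sum_(i < n) partial i v (xi i) * h ord0 i.
Proof.
move=> dv.
pose pt (k : nat) : 'rV[R]_n := x + \row_(j < n) (if (j < k)%N then h ord0 j else 0).
have step (i : 'I_n) : exists xi, enorm (xi - x) <= enorm h /\
    v (pt i.+1) - v (pt i) = partial i v xi * h ord0 i.
  have ptS : pt i.+1 = pt i + h ord0 i *: delta_mx ord0 i.
    apply/rowP => j; rewrite !mxE eqxx /= ltnS leq_eqVlt -addrA; congr (_ + _).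
    have [->|ji] := eqVneq j i; first by rewrite eqxx ltnn mulr1 add0r.
    by rewrite mulr0 addr0 val_eqE (negPf ji).
  have near t : `|t| <= `|h ord0 i| -> enorm (pt i + t *: delta_mx ord0 i - x) <= enorm h.
    move=> th; rewrite /enorm ler_sqrt; last by apply: sumr_ge0 => j _; rewrite sqr_ge0.
    apply: ler_sum => j _; rewrite !mxE eqxx /= addrC addrA addKr.
    have [->|ji] := eqVneq j i.
      by rewrite ltnn mulr1 add0r -(real_normK (num_real t)) -(real_normK (num_real (h _ _))) ler_sqr ?nnegrE.
    by rewrite mulr0 addr0; case: ifP => // _; rewrite expr0n sqr_ge0.
  have [|c hc E] := @line_mvt v (pt i) (delta_mx ord0 i) (h ord0 i).
    by move=> t th; apply: dv; exact: near.
  by exists (pt i + c *: delta_mx ord0 i); split; [exact: near|rewrite ptS E].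
have [xi hxi] := choice step.
exists xi => [i|]; first by case: (hxi i).
have -> : v (x + h) = v (pt n).
  by congr (v (_ + _)); apply/rowP => j; rewrite mxE ltn_ord.
have -> : v x = v (pt 0%N).
  by congr v; rewrite -[LHS]addr0; congr (_ + _); apply/rowP => j; rewrite !mxE.
rewrite -(telescope_sumr (fun k => v (pt k)) (leq0n n)) big_mkord.
by apply: eq_bigr => i _; case: (hxi i).
Qed.

Lemma near_enorm x (P : set 'rV[R]_n) : (\forall z \near x, P z) ->
  exists2 r, 0 < r & forall z, enorm (z - x) <= r -> P z.
Proof.
move=> /nbhs_ballP[e /= e0 he]; exists (e / 2); first by rewrite divr_gt0.
move=> z zx; apply: he; rewrite -ball_normE /= distrC.
apply: (le_lt_trans (norm_le_enorm _)); apply: (le_lt_trans zx).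
by rewrite ltr_pdivrMr // ltr_pMr // ltr1n.
Qed.

Lemma locally_bounded (I : finType) (F : I -> 'rV[R]_n -> R) x :
  (forall i, {for x, continuous (F i)}) ->
  exists r M : R, [/\ 0 < r, 0 <= M &
    forall z i, enorm (z - x) <= r -> `|F i z| <= M].
Proof.
move=> cF; have step i : exists r : R, 0 < r /\
    forall z, enorm (z - x) <= r -> `|F i z| <= `|F i x| + 1.
  have /cvgrPdist_le /(_ 1 ltr01) := cF i.
  move=> /near_enorm[r r0 hr]; exists r; split => // z /hr.
  rewrite -lerBlDl => /(le_trans _); apply; rewrite distrC; exact: lerB_dist.
have [r hr] := choice step.
exists (\big[Num.min/1]_i r i), (\sum_i (`|F i x| + 1)); split.
- by apply: lt_bigmin => // i _; case: (hr i).
- by apply: sumr_ge0 => i _; rewrite addr_ge0.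
- move=> z i zr; apply: (@le_trans _ _ (`|F i x| + 1)).
    apply: (hr i).2; apply: (le_trans zr); exact: bigmin_le_cond.
  by rewrite (bigD1 i) //= lerDl; apply: sumr_ge0 => j _; rewrite addr_ge0.
Qed.

(** Two uses of [axis_mvt]: for [v], then for each first partial, whose variation is at most n M |h|
    where [M] bounds the second partials near [x]. *)
Lemma C2_expansion (U : set 'rV[R]_n) v x : (\forall z \near x, U z) -> Ck_on 2 U v ->
  exists r C : R, 0 < r /\ forall y, enorm (x - y) <= r ->
    `|v x - v y + dotv (gradient v x) (y - x)| <= C * enorm (x - y) ^+ 2.
Proof.
move=> nU [_ C2].
have [r0 r00 hU] := near_enorm nU.
have Ux : U x by apply: hU; rewrite subrr enorm0 ltW.
have [r1 [M [r10 M0 hM]]] := @locally_bounded _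
  (fun ij : 'I_n * 'I_n => partial ij.2 (partial ij.1 v)) x
  (fun ij => ((C2 ij.1).2.2 ij.2).2.1 x Ux).
exists (Num.min r0 r1), (n%:R * (n%:R * M)); split; first by rewrite lt_min r00.
move=> y; rewrite enormBC le_min => /andP[y0 y1]; pose h := y - x.
have hdv z i : enorm (z - x) <= enorm h -> derivable v z (delta_mx ord0 i).
  by move=> zx; apply: (C2 i).1; apply: hU; exact: le_trans zx y0.
have [xi xix E] := @axis_mvt v x h (fun z zx i => hdv z i zx).
have lip z i : enorm (z - x) <= enorm h ->
    `|partial i v z - partial i v x| <= n%:R * M * enorm h.
  move=> zx; have [|xi' xix' E'] := @axis_mvt (partial i v) x (z - x).
    move=> z' z'x j; apply: ((C2 i).2.2 j).1; apply: hU.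
    exact: le_trans z'x (le_trans zx y0).
  rewrite addrCA subrr addr0 in E'; rewrite E'.
  apply: (le_trans (ler_norm_sum _ _ _)).
  rewrite -mulrA -[n in n%:R]card_ord -sum1_card natr_sum mulr_suml.
  apply: ler_sum => j _; rewrite mul1r normrM ler_pM //.
    apply: (hM (xi' j) (i, j)); exact: le_trans (xix' j) (le_trans zx y1).
  exact: le_trans (coord_le_enorm _ _) zx.
have -> : v x - v y + dotv (gradient v x) (y - x) =
    - \sum_(i < n) (partial i v (xi i) - partial i v x) * h ord0 i.
  under eq_bigr do rewrite mulrBl.
  rewrite sumrB -E /h addrCA subrr addr0 opprB addrC opprB; congr (_ + _).
  by apply: eq_bigr => i _; rewrite mxE.
rewrite normrN -/h; apply: (le_trans (ler_norm_sum _ _ _)).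
rewrite -mulrA -[n in n%:R * (_ * _ ^+ _)]card_ord -sum1_card natr_sum mulr_suml.
apply: ler_sum => j _; rewrite mul1r normrM expr2 mulrA ler_pM //.
  by apply: lip; exact: xix.
exact: coord_le_enorm.
Qed.

(** Lower bounds on increments in both directions suffice: letting [t] tend to 0 from the right
    bounds the partial derivative below by -L, from the left above by L. The [K] term leaves room
    for the second-order part of a touching function. *)
Lemma norm_partial_le v x i (L K tau : R) : derivable v x (delta_mx ord0 i) -> 0 < tau ->
  (forall t : R, `|t| <= tau ->
     - ((L + K * `|t|) * `|t|) <= v (x + t *: delta_mx ord0 i) - v x) ->
  `|partial i v x| <= L.
Proof.
move=> dv tau0 hv.
pose q (t : R) := t^-1 * (v (x + t *: delta_mx ord0 i) - v x).
have qcvg : q t @[t --> 0^'] --> partial i v x.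
  rewrite (_ : q = fun t => t^-1 *: ((v \o shift x) (t *: delta_mx ord0 i) - v x)).
    exact: dv.
  by apply/funext => t; rewrite /q /shift /= [x + _]addrC.
apply/ler_addgt0Pr => e e0.
pose d := Num.min tau (e / (`|K| + 1)).
have d0 : 0 < d by rewrite lt_min tau0 divr_gt0.
have small (t : R) : `|t| <= d -> (L + K * `|t|) * `|t| <= (L + e) * `|t|.
  rewrite le_min => /andP[_ te]; rewrite ler_wpM2r // lerD2l.
  apply: (le_trans (ler_norm _)); rewrite normrM normr_id.
  have K1 : 0 < `|K| + 1 by rewrite ltr_wpDl.
  move: te; rewrite ler_pdivlMr // mulrDr mulr1 [`|K| * _]mulrC.
  by have := normr_ge0 t; lra.
have lo (t : R) : `|t| <= d -> - ((L + e) * `|t|) <= v (x + t *: delta_mx ord0 i) - v x.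
  move=> td; apply: le_trans (hv t _); first by rewrite lerN2 small.
  by move: td; rewrite le_min => /andP[].
rewrite ler_norml; apply/andP; split.
  apply: (@cvgr_to_ge _ _ _ _ q (partial i v x) (- (L + e)) (cvg_dnbhs_at_right qcvg)).
  near=> t.
  have t0 : 0 < t by [].
  have td : t <= d by near: t; exact: nbhs_right_le.
  have := lo t; rewrite gtr0_norm // => /(_ td).
  by rewrite /q [t^-1 * _]mulrC ler_pdivlMr // mulNr.
apply: (@cvgr_to_le _ _ _ _ q (partial i v x) (L + e) (cvg_dnbhs_at_left qcvg)).
near=> t.
have t0 : t < 0 by [].
have td : - d <= t by near: t; apply: nbhs_left_ge; rewrite oppr_lt0.
have := lo t; rewrite ltr0_norm // => /(_ _).
by rewrite /q [t^-1 * _]mulrC ler_ndivrMr // mulrN opprK; apply; rewrite lerNl.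
Unshelve. all: by end_near. Qed.

End directional.

Lemma fractional_laplacianE (R : realType) (n : nat) (C s : R) (u : 'rV[R]_n -> R) x :
  fractional_laplacian C s u x =
  C * lim (truncated_integral s u x eps @[eps --> 0^'+]).
Proof. by []. Qed.

Lemma exterior_nbhs (R : realType) (n : nat) (R0 : R) (x : 'rV[R]_n) :
  exterior R0 x -> \forall z \near x, exterior R0 z.
Proof.
move=> /= Rx; have cx : enorm y @[y --> x] --> enorm x by exact: continuous_enorm.
exact: (cvgr_gt (enorm x) cx).
Qed.

Lemma EVT_exterior (R : realType) (n : nat) (R0 M : R) (A : set 'rV[R]_n) (g : 'rV[R]_n -> R) :
  closed A -> A !=set0 -> (forall y, A y -> enorm y <= M) ->
  (forall y, A y -> {for y, continuous g}) ->
  exists2 c, A c & forall y, A y -> g c <= g y.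
Proof.
move=> cA A0 AM gc.
have kA : compact A.
  apply: bounded_closed_compact => //; exists M; split; first exact: num_real.
  move=> t Mt y Ay /=; exact: le_trans (norm_le_enorm y) (le_trans (AM y Ay) (ltW Mt)).
have [|c cA' hc] := compact_EVT_min A0 kA (f := g).
  by apply: continuous_in_subspaceT => y; rewrite inE; exact: gc.
exists c; first by rewrite inE in cA'.
by move=> y Ay; apply: hc; rewrite inE.
Qed.

Lemma continuous_enormB (R : realType) (n : nat) (z : 'rV[R]_n) :
  continuous (fun y : 'rV[R]_n => enorm (z - y)).
Proof.
move=> y; apply: (@continuous_comp _ _ _ (fun y : 'rV[R]_n => z - y) (@enorm R n)).
  by apply: continuousB; [exact: cst_continuous|exact: cvg_id].
exact: continuous_enorm.
Qed.

Lemma closed_enorm_le (R : realType) (n : nat) (z : 'rV[R]_n) (r : R) :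
  closed [set y | enorm (z - y) <= r].
Proof.
rewrite (_ : [set y | _] = (fun y => enorm (z - y)) @^-1` [set t | t <= r]) //.
by apply: preimage_closed; [move=> y _; exact: continuous_enormB|exact: closed_le].
Qed.

Lemma closed_enorm_ge (R : realType) (n : nat) (z : 'rV[R]_n) (r : R) :
  closed [set y | r <= enorm (z - y)].
Proof.
rewrite (_ : [set y | _] = (fun y => enorm (z - y)) @^-1` [set t | r <= t]) //.
by apply: preimage_closed; [move=> y _; exact: continuous_enormB|exact: closed_ge].
Qed.

Lemma enorm_delta_mx (R : realType) (n : nat) (i : 'I_n) :
  enorm (delta_mx ord0 i : 'rV[R]_n) = 1.
Proof.
rewrite /enorm (bigD1 i) //= big1 => [|j ji]; last by rewrite mxE (negPf ji) expr0n.
by rewrite mxE !eqxx expr1n addr0 sqrtr1.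
Qed.

Lemma enorm_scaled_delta_mx (R : realType) (n : nat) (i : 'I_n) (t : R) :
  enorm (t *: delta_mx ord0 i : 'rV[R]_n) = `|t|.
Proof. by rewrite enormZ enorm_delta_mx mulr1. Qed.

(** * Touching a supersolution from below *)

Section supersolution.
Variables (R : realType) (n : nat) (s C lambda R0 q : R) (f : R -> R) (u : 'rV[R]_n -> R).
Hypotheses (s_gt0 : 0 < s) (s_lt1 : s < 1) (s_n : 2 * s < n%:R) (n_ge2 : (2 <= n)%N).
Hypotheses (C_gt0 : 0 < C) (R0_gt0 : 0 < R0) (q_ge0 : 0 <= q).
Hypotheses (u_super : classical_supersolution C s q lambda f R0 u)
  (u_gt0 : forall x, 0 < u x).
Local Notation mu := (lebesgue_rV R n).
Implicit Types x y z : 'rV[R]_n.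

(** The interface for both contact arguments: [B] bounds the truncated integrals in the limit and
    [L] bounds the slope of the touching function. Existence of the principal value transfers [B] to
    it, and |grad u| <= n L follows coordinatewise. *)
Lemma supersolution_touch x (B L K tau : R) : exterior R0 x ->
  (forall e, 0 < e ->
     \forall eps \near 0^'+, truncated_integral s u x eps <= B + e) ->
  0 < tau -> (forall i (t : R), `|t| <= tau ->
     - ((L + K * `|t|) * `|t|) <= u (x + t *: delta_mx ord0 i) - u x) ->
  lambda * f (u x) <= C * B + (n%:R * L) `^ q.
Proof.
move=> Rx hB tau0 hL; have [C2 L2u /(_ x Rx) hx] := u_super.
apply: (le_trans hx); apply: lerD.
  rewrite fractional_laplacianE ler_wpM2l ?(ltW C_gt0) //.
  have [r [c [r0 hr]]] := C2_expansion (exterior_nbhs Rx) C2.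
  have cv := truncated_integral_cvg s_gt0 s_lt1 s_n n_ge2 r0 L2u hr.
  by apply/ler_addgt0Pr => e e0; apply: limr_le => //; exact: hB.
have hi i : `|partial i u x| <= L.
  by apply: norm_partial_le tau0 (hL i); exact: (C2.2 i).1.
have hg : enorm (gradient u x) <= n%:R * L.
  by apply: enorm_le_const => i; rewrite mxE.
by rewrite ge0_ler_powR // ?nnegrE ?enorm_ge0 // (le_trans (enorm_ge0 _) hg).
Qed.

Lemma supersolution_continuous x : exterior R0 x -> {for x, continuous u}.
Proof. by move=> Rx; have [[] ] := u_super; move=> + _ _ _; exact. Qed.

Lemma paraboloid_touch : exists2 M : R, 0 <= M & forall z, 2 * R0 < enorm z ->
  exists x, [/\ enorm (z - x) <= enorm z / 2, u x <= u z &
    lambda * f (u x) <=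
      M * (u z / (enorm z / 2) `^ (2 * s)) + (n%:R * (2 * (u z / (enorm z / 2)))) `^ q].
Proof.
have [cT /ltW cT0 cTE] := @Rintegral_kern R n s s_gt0 n_ge2.
have [cZ cZ0 cZE] := @Rintegral_sqr_kern R n s s_gt0 s_lt1 n_ge2.
exists (C * (cZ + cT)); first by rewrite mulr_ge0 ?addr_ge0 // ltW.
move=> z Rz; set r := enorm z / 2; set m := u z.
have r0 : 0 < r by rewrite /r; move: Rz R0_gt0; lra.
have rR : R0 < r by rewrite /r; move: Rz; lra.
have zr : enorm z = 2 * r by rewrite /r; field.
have m0 : 0 < m := u_gt0 z.
(* [phi] equals [u z] at [z] and is at most 0 outside the ball of radius [r], where [u > 0]. The
   minimum of [u - phi] over the ball is at most 0, so it is a global contact. *)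
pose phi y := m * (1 - enorm (z - y) ^+ 2 / r ^+ 2).
have ext y : enorm (z - y) <= r -> exterior R0 y.
  move=> zy; rewrite /exterior /=.
  have := ler_enormB z (z - y); rewrite opprB addrCA subrr addr0.
  by move: zr rR zy; lra.
have phic : continuous phi.
  have c2 : continuous (fun t : R => m * (1 - t ^+ 2 / r ^+ 2)).
    move=> t; apply: cvgM; first exact: cvg_cst.
    apply: cvgB; first exact: cvg_cst.
    by apply: cvgM; [exact: exprn_continuous|exact: cvg_cst].
  move=> y; apply: (@continuous_comp _ _ _ (fun y : 'rV[R]_n => enorm (z - y))
    (fun t : R => m * (1 - t ^+ 2 / r ^+ 2)) y); last exact: c2.
  exact: continuous_enormB.
have [||y|y zy|x /= zx hx] := @EVT_exterior R n R0 (enorm z + r)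
    [set y | enorm (z - y) <= r] (fun y => u y - phi y).
- exact: closed_enorm_le.
- by exists z; rewrite /= subrr enorm0 ltW.
- by move=> /= zy; have := ler_enormB y z; rewrite enormBC; move: zy; lra.
- exact: (cvgB (supersolution_continuous (ext y zy)) (phic y)).
have phiz : phi z = m by rewrite /phi subrr enorm0 expr0n mul0r subr0 mulr1.
have hxz : u x - phi x <= 0.
  have zz : enorm (z - z) <= r by rewrite subrr enorm0 ltW.
  by have := hx z zz; rewrite phiz -/m; lra.
have touch y : u x - u y <= phi x - phi y.
  have [zy|zy] := leP (enorm (z - y)) r; first by have := hx y zy; lra.
  have phiy : phi y <= 0.
    rewrite /phi pmulr_rle0 // subr_le0 ler_pdivlMr ?exprn_gt0 // mul1r.
    by rewrite ler_sqr ?nnegrE ?enorm_ge0 ?(ltW r0) // ltW.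
  by have := u_gt0 y; lra.
have phixm : phi x <= m.
  by rewrite /phi ler_piMr ?(ltW m0) // gerBl divr_ge0 ?sqr_ge0.
have uxm : u x <= m by lra.
exists x; split => //.
(* [phi] is quadratic, so this expansion is exact; its linear part is odd about [x] and disappears
   from the integrals. *)
have phiE y : phi x - phi y =
    m / r ^+ 2 * (enorm (x - y) ^+ 2) + dotv ((2 * (m / r ^+ 2)) *: (x - z)) (y - x).
  rewrite /phi; have -> : z - y = (z - x) + (x - y) by rewrite addrA subrK.
  rewrite -[x - z]opprB -[y - x]opprB; set a := z - x; set c := x - y.
  have acN : dotv (- a) (- c) = dotv a c by rewrite dotvNr dotvC dotvNr opprK dotvC.
  by rewrite sqr_enormD dotvZl acN; ring.
have nz : enorm (x - z) <= r by rewrite enormBC.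
(* The slope is at most 2 m / r since |x - z| <= r; [cZ] and [cT] price the quadratic term within
   [r] and the constant [m] beyond it. *)
have h := @supersolution_touch x (m * ((cZ + cT) / r `^ (2 * s))) (2 * (m / r))
  (m / r ^+ 2) 1 (ext x zx).
have -> : C * (cZ + cT) * (m / r `^ (2 * s)) = C * (m * ((cZ + cT) / r `^ (2 * s))).
  by ring.
set b := (2 * (m / r ^+ 2)) *: (x - z) in phiE.
have mr0 : 0 < m / r ^+ 2 by rewrite divr_gt0 ?exprn_gt0.
have br : enorm b * r <= 2 * m.
  have mr2 : 0 <= 2 * (m / r ^+ 2) by rewrite mulr_ge0 // ltW.
  rewrite enormZ ger0_norm //.
  apply: (@le_trans _ _ (2 * (m / r ^+ 2) * r * r)).
    by rewrite ler_wpM2r ?(ltW r0) // ler_wpM2l.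
  by rewrite le_eqVlt; apply/orP; left; apply/eqP; field; rewrite gt_eqF.
apply: h => //; last first.
  move=> i t t1.
  apply: (@le_trans _ _ (phi (x + t *: delta_mx ord0 i) - phi x)); last first.
    by have := touch (x + t *: delta_mx ord0 i); lra.
  rewrite -lerN2 opprK opprB phiE opprD addrA subrr add0r [x + _]addrC addrK enormN
    enorm_scaled_delta_mx.
  have hd : dotv b (t *: delta_mx ord0 i) <= 2 * (m / r) * `|t|.
    apply: (le_trans (dotv_le _ _)); rewrite enorm_scaled_delta_mx ler_wpM2r //.
    by rewrite mulrA ler_pdivlMr.
  by move: hd; lra.
move=> e e0; near=> eps.
have eps0 : 0 < eps by [].
have epsr : eps < r by near: eps; exact: nbhs_right_lt.
apply: (@le_trans _ _ (m * ((cZ + cT) / r `^ (2 * s)))); last by rewrite lerDl ltW.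
have [_ L2u _] := u_super.
pose quad y := m / r ^+ 2 * enorm (x - y) ^+ 2 + dotv b (y - x).
(* The quadratic serves within [r]; beyond it, u x - u y <= u x <= m. Completing the square, with d
   = |x - y|, gives quad >= (m / r^2) (d - r)^2 - m >= -m, so |G| <= m and [G] is integrable against
   the kernel. *)
pose G y := Num.min (quad y) m.
have quad_ge y : - m <= quad y.
  have : - (enorm b * enorm (x - y)) <= dotv b (y - x).
    by rewrite lerNl -dotvNr (le_trans (dotv_le _ _)) // opprB.
  have k2 : m / r ^+ 2 * r ^+ 2 = m by field; rewrite gt_eqF.
  have h1 : 0 <= m / r ^+ 2 * (enorm (x - y) - r) ^+ 2 by rewrite mulr_ge0 ?sqr_ge0 // ltW.
  have h2 : enorm b <= 2 * (m / r ^+ 2 * r).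
    rewrite -(ler_pM2r r0); apply: (le_trans br).
    by rewrite -[X in 2 * X <= _]k2; lra.
  have h3 : enorm b * enorm (x - y) <= 2 * (m / r ^+ 2 * r) * enorm (x - y).
    by rewrite ler_wpM2r ?enorm_ge0.
  by rewrite /quad; lra.
have uG y : u x - u y <= G y.
  by rewrite /G le_min /quad -phiE touch /=; have := u_gt0 y; lra.
have GK y : `|G y| <= m.
  rewrite ler_norml; apply/andP; split; last by rewrite ge_min lexx orbT.
  by rewrite /G le_min quad_ge /=; lra.
have mquad : measurable_fun setT quad.
  apply: measurable_funD; last exact: measurable_dotvB.
  by apply: measurable_funM => //; apply: measurable_funX; exact: measurable_enormB.
pose D := [set y | eps < enorm (x - y)].
pose S := [set y | eps < enorm (x - y) <= r].
pose T := [set y | r < enorm (x - y)].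
have mD : measurable D by exact: measurable_enorm_gt.
have mS : measurable S by exact: measurable_enorm_oc.
have mT : measurable T by exact: measurable_enorm_gt.
have DST : D = S `|` T.
  apply/seteqP; split=> y; rewrite /D /S /T /=.
    by move=> ->; have [] := leP (enorm (x - y)) r; [left|right].
  by move=> [/andP[]//|]; exact: lt_trans.
have disj : [disjoint S & T].
  rewrite disj_set2E; apply/eqP; rewrite -subset0 => y [/andP[_ h1] h2].
  by move: h2; rewrite /T /= ltNge h1.
have iD : mu.-integrable D (EFin \o (fun y => G y * kern s x y)).
  apply: (@le_integrable_EFin _ _ _ mu _ _ (fun y => m * kern s x y)) => //.
  - apply: measurable_funTS; apply: measurable_funM; last exact: measurable_kern.
    exact: measurable_minr.
  - by move=> y _; rewrite normrM (ger0_norm (kern_ge0 s x y)) ler_wpM2r ?kern_ge0.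
  - by apply: integrableZ_EFin => //; exact: integrable_kern.
apply: (le_trans (truncated_integral_le s_gt0 s_n n_ge2 eps0 L2u uG iD)).
rewrite -/D DST Rintegral_setU -?DST //.
have iS2 : mu.-integrable S (EFin \o (fun y => enorm (x - y) ^+ 2 * kern s x y)).
  apply: (integrableS (measurable_enorm_oc 0 r x) mS _
    (integrable_sqr_kern s_gt0 s_lt1 n_ge2 x r0)) => y /andP[y0 yr].
  by rewrite /= yr (lt_trans eps0).
have iS3 : mu.-integrable S (EFin \o (fun y => m / r ^+ 2 * (enorm (x - y) ^+ 2 * kern s x y))).
  exact: integrableZ_EFin.
have ilin := integrable_dotv_kern s_gt0 n_ge2 b x r eps0.
have -> : m * ((cZ + cT) / r `^ (2 * s)) =
    m / r ^+ 2 * (cZ * r `^ (2 - 2 * s)) + m * (cT / r `^ (2 * s)).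
  rewrite powRB ?(gt_eqF r0) ?implybT // [r `^ 2]powR_mulrn ?(ltW r0) //.
  by field; rewrite !gt_eqF ?powR_gt0.
apply: lerD; last first.
  rewrite -(cTE r x r0) -RintegralZl //; last exact: integrable_kern.
  apply: le_Rintegral => //.
  - by apply: (integrableS mD mT _ iD) => y; rewrite DST; right.
  - by apply: integrableZ_EFin => //; exact: integrable_kern.
  - by move=> y _; rewrite ler_wpM2r ?kern_ge0 // ge_min lexx orbT.
apply: (@le_trans _ _ (\int[mu]_(y in S) (m / r ^+ 2 * (enorm (x - y) ^+ 2 * kern s x y)
    + dotv b (y - x) * kern s x y))).
  apply: le_Rintegral => //.
  - by apply: (integrableS mD mS _ iD) => y; rewrite DST; left.
  - exact: integrableD_EFin.
  - by move=> y _; rewrite mulrA -mulrDl ler_wpM2r ?kern_ge0 // ge_min lexx.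
rewrite RintegralD // Rintegral_odd_kern addr0 RintegralZl // ler_wpM2l ?(ltW mr0) //.
rewrite -(cZE r x r0); rewrite /Rintegral fine_le //.
- apply: integrable_fin_num => //.
- apply: integrable_fin_num; first exact: measurable_enorm_oc.
  exact: integrable_sqr_kern.
apply: ge0_subset_integral => //.
- exact: measurable_enorm_oc.
- apply/measurable_EFinP; apply: measurable_funTS; apply: measurable_funM.
    by apply: measurable_funX; exact: measurable_enormB.
  exact: measurable_kern.
- by move=> y _; rewrite lee_fin mulr_ge0 ?kern_ge0 ?sqr_ge0.
- by move=> y /andP[y0 yr]; rewrite /= yr (lt_trans eps0).
Unshelve. all: by end_near. Qed.

End supersolution.

(** * The barrier *)

(** A convex function lies above its tangent at 1; here from e^z >= 1 + z at z = - a ln t and ln t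
    <= t - 1. *)
Lemma powRN_tangent (R : realType) (t a : R) : 0 < t -> 0 <= a ->
  1 - a * (t - 1) <= t `^ (- a).
Proof.
move=> t0 a0; rewrite /powR (gt_eqF t0); apply: le_trans (expR_ge1Dx _).
rewrite mulNr lerD2l lerN2 ler_wpM2l //.
by have := @le_ln1Dx R (t - 1); rewrite addrCA subrr addr0; apply; lra.
Qed.

(** Measures a shell of relative width O(eta): for 0 <= a <= 2 both powers compare with squares, and
    (1 + 2 eta)^2 - (1 - 2 eta)^2 = 8 eta. *)
Lemma shell_weight (R : realType) (eta a : R) : 0 <= eta -> eta <= 2^-1 -> 0 <= a -> a <= 2 ->
  ((1 - eta) `^ a)^-1 - ((1 + 2 * eta) `^ a)^-1 <= 8 * eta.
Proof.
move=> e0 e1 a0 a2.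
have p1 : 0 < 1 - eta by lra.
have p2 : 1 <= 1 + 2 * eta by lra.
have p20 : 0 < 1 + 2 * eta by lra.
have h1 : ((1 - eta) `^ a)^-1 <= (1 + 2 * eta) ^+ 2.
  rewrite -powRV ?(ltW p1) //; apply: (@le_trans _ _ ((1 + 2 * eta) `^ a)).
    rewrite ge0_ler_powR ?nnegrE ?invr_ge0 ?(ltW p1) ?(ltW p20) //.
    rewrite -[X in X <= _]mul1r ler_pdivrMr //; nra.
  by rewrite -powR_mulrn ?(ltW p20) // ler_powR.
have h2 : (1 - 2 * eta) ^+ 2 <= ((1 + 2 * eta) `^ a)^-1.
  apply: (@le_trans _ _ ((1 + 2 * eta) ^+ 2)^-1).
    rewrite -[X in _ <= X]mul1r ler_pdivlMr ?exprn_gt0 // -exprMn.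
    rewrite expr_le1 //; nra.
  by rewrite lef_pV2 ?posrE ?powR_gt0 ?exprn_gt0 // -powR_mulrn ?(ltW p20) // ler_powR.
have -> : 8 * eta = (1 + 2 * eta) ^+ 2 - (1 - 2 * eta) ^+ 2 by ring.
lra.
Qed.

Section annulus.
Variables (R : realType) (n : nat) (s : R).
Hypotheses (s_gt0 : 0 < s) (n_ge2 : (2 <= n)%N).
Local Notation mu := (lebesgue_rV R n).

Lemma integrable_kern_annulus r1 r2 (x : 'rV[R]_n) : 0 < r1 ->
  mu.-integrable [set y | r1 < enorm (x - y) <= r2] (EFin \o kern s x).
Proof.
move=> r10; apply: (integrableS (measurable_enorm_gt r1 x) (measurable_enorm_oc r1 r2 x) _
  (integrable_kern s_gt0 n_ge2 x r10)).
by move=> y /andP[].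
Qed.

Lemma Rintegral_kern_annulus r1 r2 (x : 'rV[R]_n) : 0 < r1 -> r1 <= r2 ->
  \int[mu]_(y in [set y | r1 < enorm (x - y) <= r2]) kern s x y =
  \int[mu]_(y in [set y | r1 < enorm (x - y)]) kern s x y -
  \int[mu]_(y in [set y | r2 < enorm (x - y)]) kern s x y.
Proof.
move=> r10 r12.
have E : [set y | r1 < enorm (x - y)] =
    [set y | r1 < enorm (x - y) <= r2] `|` [set y | r2 < enorm (x - y)].
  apply/seteqP; split=> y /=.
    by move=> ->; have [] := leP (enorm (x - y)) r2; [left|right].
  by move=> [/andP[]//|]; exact: le_lt_trans.
rewrite [X in X - _](_ : _ = \int[mu]_(y in [set y | r1 < enorm (x - y) <= r2]) kern s x y +
   \int[mu]_(y in [set y | r2 < enorm (x - y)]) kern s x y); first by rewrite addrK.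
rewrite E Rintegral_setU //.
- exact: measurable_enorm_oc.
- exact: measurable_enorm_gt.
- by rewrite -E; exact: integrable_kern.
- rewrite disj_set2E; apply/eqP; rewrite -subset0 => y [/= /andP[_ h1] h2].
  by move: h2; rewrite ltNge h1.
Qed.

End annulus.

Lemma restrict_EFin_patch (T : Type) (R : realType) (D : set T) (f : T -> R) :
  EFin \o (f \_ D) = (EFin \o f) \_ D.
Proof. by apply/funext => y; rewrite /patch /=; case: ifP. Qed.

Lemma integrable_patch d (T : measurableType d) (R : realType)
    (mu : {measure set T -> \bar R}) (D : set T) (f : T -> R) : measurable D ->
  mu.-integrable D (EFin \o f) -> mu.-integrable setT (EFin \o (f \_ D)).
Proof. by move=> mD; rewrite restrict_EFin_patch => /(integrable_mkcond _ mD). Qed.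

(** The cut-off keeps the function bounded. It jumps at |y| = R1, but contact points will have |x|
    >= 5 R1, where it is smooth. *)
Definition barrier (R : realType) (n : nat) (gam R1 : R) : 'rV[R]_n -> R :=
  (fun y => enorm y `^ (- gam)) \_ [set y | R1 <= enorm y].

Section barrier.
Variables (R : realType) (n : nat) (s gam rho delta R1 : R).
Hypotheses (s_gt0 : 0 < s) (s_lt1 : s < 1) (s_n : 2 * s < n%:R) (n_ge2 : (2 <= n)%N).
Hypotheses (gam_gt : n%:R - 2 * s < gam) (R1_gt0 : 0 < R1) (rhoR1 : 5 * R1 <= rho).
Hypotheses (delta_gt0 : 0 < delta) (delta_lt : delta < rho / 2).
Variable x : 'rV[R]_n.
Hypothesis x_rho : enorm x = rho.
Local Notation mu := (lebesgue_rV R n).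
Local Notation K := (kern s x).
Local Notation kap := (n%:R - 2 * s).
Local Notation eta := (delta / rho).
Local Notation inv := (@inversion R n rho).
Implicit Types y : 'rV[R]_n.

Let rat y := enorm y / rho.

(** The inversion in the sphere of radius [rho] exchanges the two bounding radii, so the zone is
    invariant away from the origin; outside it only nonnegativity of the barrier is used. *)
Definition symmetric_zone : set 'rV[R]_n :=
  [set y | R1 <= enorm y /\ enorm y <= rho ^+ 2 / R1].

Definition outer_part : set 'rV[R]_n :=
  symmetric_zone `&` [set y | delta < enorm (x - y)].

Definition reflected_part : set 'rV[R]_n :=
  symmetric_zone `&` [set y | delta * rat y < enorm (x - y)].

(* [h1] is, up to the factor [rho `^ (- gam)], the integrand for the barrier at [x];
   [h2] is its transform under the inversion, which maps [reflected_part] onto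
   [outer_part]. *)
Let h1 y := (1 - rat y `^ (- gam)) * K y.
Let h2 y := (rat y `^ (- kap) - rat y `^ (gam - kap)) * K y.

Let rho_gt0 : 0 < rho.
Proof. by move: R1_gt0 rhoR1; lra. Qed.

Let kap_gt0 : 0 < kap.
Proof. by move: s_n; lra. Qed.

Let gam_gt0 : 0 < gam.
Proof. exact: lt_trans kap_gt0 gam_gt. Qed.

Lemma measurable_rat : measurable_fun setT rat.
Proof. by apply: measurable_funM => //; exact: measurable_enorm. Qed.

Lemma measurable_symmetric_zone : measurable symmetric_zone.
Proof.
rewrite /symmetric_zone [X in measurable X](_ : _ =
    [set y | `[R1, rho ^+ 2 / R1]%classic (enorm y)]).
  by apply: measurable_enorm_set; exact: measurable_itv.
apply/seteqP; split=> y /=; rewrite in_itv /=; first by case=> -> ->.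
by move=> /andP.
Qed.

Lemma measurable_outer_part : measurable outer_part.
Proof.
apply: measurableI; first exact: measurable_symmetric_zone.
exact: measurable_enorm_gt.
Qed.

Lemma measurable_reflected_part : measurable reflected_part.
Proof.
apply: measurableI; first exact: measurable_symmetric_zone.
have : measurable_fun setT (fun y => enorm (x - y) - delta * rat y).
  apply: measurable_funB; first exact: measurable_enormB.
  by apply: measurable_funM => //; exact: measurable_rat.
move=> /(_ measurableT `]0, +oo[%classic (measurable_itv _)); rewrite setTI.
rewrite [X in measurable X -> _](_ : _ = [set y | delta * rat y < enorm (x - y)]) //.
by apply/seteqP; split=> y /=; rewrite in_itv /= andbT subr_gt0.
Qed.

Lemma symmetric_zone_gt0 y : symmetric_zone y -> 0 < enorm y.
Proof. by move=> [h _]; exact: lt_le_trans h. Qed.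

Lemma symmetric_zone_inversion y : y != 0 -> symmetric_zone (inv y) <-> symmetric_zone y.
Proof.
move=> y0; have ey0 : 0 < enorm y by rewrite enorm_gt0.
rewrite /symmetric_zone /= enorm_inversion //.
rewrite ler_pdivlMr // [R1 * _]mulrC -ler_pdivlMr //.
by rewrite ler_pM2l ?exprn_gt0 // lef_pV2 ?posrE //; split=> -[].
Qed.

Lemma measurable_h1 : measurable_fun setT h1.
Proof.
apply: measurable_funM; last exact: measurable_kern.
apply: measurable_funB => //.
by apply: (measurableT_comp (measurable_powR _)); exact: measurable_rat.
Qed.

Lemma measurable_h2 : measurable_fun setT h2.
Proof.
apply: measurable_funM; last exact: measurable_kern.
by apply: measurable_funB; apply: (measurableT_comp (measurable_powR _));
  exact: measurable_rat.
Qed.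

Lemma rat_bounds y : symmetric_zone y -> R1 / rho <= rat y /\ rat y <= rho / R1.
Proof.
move=> [h1' h2']; split; first by rewrite ler_pM2r ?invr_gt0.
rewrite /rat ler_pdivrMr //; apply: (le_trans h2').
by rewrite expr2 mulrAC.
Qed.

Lemma integrable_h1 : mu.-integrable outer_part (EFin \o h1).
Proof.
have b0 : 0 < R1 / rho by rewrite divr_gt0.
have sub : outer_part `<=` [set y | delta < enorm (x - y)] by move=> y [].
apply: (@le_integrable_EFin _ _ _ mu _ _ (fun y => (1 + (R1 / rho) `^ (- gam)) * K y)).
- exact: measurable_outer_part.
- by apply: measurable_funTS; exact: measurable_h1.
- move=> y [/rat_bounds[r1 r2] _]; rewrite normrM (ger0_norm (kern_ge0 s x y)).
  rewrite ler_wpM2r ?kern_ge0 // (le_trans (ler_normB _ _)) // normr1 lerD2l.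
  rewrite ger0_norm ?powR_ge0 // !powRN lef_pV2 ?posrE ?powR_gt0 ?(lt_le_trans b0) //.
  by rewrite ge0_ler_powR ?nnegrE ?(ltW gam_gt0) ?(ltW b0) // ltW // (lt_le_trans b0).
- apply: integrableZ_EFin; first exact: measurable_outer_part.
  exact: (integrableS (measurable_enorm_gt _ _) measurable_outer_part sub
    (integrable_kern s_gt0 n_ge2 x delta_gt0)).
Qed.

Lemma integrable_h2 : mu.-integrable reflected_part (EFin \o h2).
Proof.
have b0 : 0 < R1 / rho by rewrite divr_gt0.
have db0 : 0 < delta * (R1 / rho) by rewrite mulr_gt0.
have sub : reflected_part `<=` [set y | delta * (R1 / rho) < enorm (x - y)].
  move=> y [/rat_bounds[r1 _]]; apply: le_lt_trans.
  by rewrite ler_wpM2l // ltW.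
apply: (@le_integrable_EFin _ _ _ mu _ _
  (fun y => ((R1 / rho) `^ (- kap) + (rho / R1) `^ (gam - kap)) * K y)).
- exact: measurable_reflected_part.
- by apply: measurable_funTS; exact: measurable_h2.
- move=> y [/rat_bounds[r1 r2] _]; rewrite normrM (ger0_norm (kern_ge0 s x y)).
  have ry0 := lt_le_trans b0 r1.
  rewrite ler_wpM2r ?kern_ge0 // (le_trans (ler_normB _ _)) //.
  rewrite !ger0_norm ?powR_ge0 //; apply: lerD.
    rewrite !powRN lef_pV2 ?posrE ?powR_gt0 //.
    by rewrite ge0_ler_powR ?nnegrE ?(ltW kap_gt0) ?(ltW b0) // ltW.
  rewrite ge0_ler_powR ?nnegrE ?(ltW ry0) ?subr_ge0 ?(ltW gam_gt) //.
  by rewrite divr_ge0 ?(ltW rho_gt0) // ltW.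
- apply: integrableZ_EFin; first exact: measurable_reflected_part.
  exact: (integrableS (measurable_enorm_gt _ _) measurable_reflected_part sub
    (integrable_kern s_gt0 n_ge2 x db0)).
Qed.

(** The inversion has Jacobian rat^(-2n) and multiplies the kernel by rat^(n + 2s); together they
    multiply the weight 1 - rat^gam by rat^(-kap). *)
Lemma integral_outer_reflected :
  \int[mu]_(y in outer_part) h1 y = \int[mu]_(y in reflected_part) h2 y.
Proof.
have n_gt0 : (0 < n)%N by rewrite (ltn_trans _ n_ge2).
rewrite /Rintegral integral_mkcond [X in _ = fine X]integral_mkcond.
rewrite (integral_inversion n_gt0 rho_gt0); last 2 first.
- apply: (measurable_restrictT _ measurable_outer_part).1.
  by apply: measurable_funTS; apply/measurable_EFinP; exact: measurable_h1.
- rewrite /patch memNset // => -[/symmetric_zone_gt0].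
  by rewrite enorm0 ltxx.
congr fine; apply: eq_integral => y _; rewrite /patch.
have [->|y0] := eqVneq y 0.
  rewrite /inversion scaler0 !memNset ?mule0 //.
  - by move=> [/symmetric_zone_gt0]; rewrite enorm0 ltxx.
  - by move=> [/symmetric_zone_gt0]; rewrite enorm0 ltxx.
have ey0 : 0 < enorm y by rewrite enorm_gt0.
have dxy : enorm (x - inv y) = rho * enorm (x - y) / enorm y by exact: enormB_inversion.
have -> : (inv y \in outer_part) = (y \in reflected_part).
  have dE : (delta < enorm (x - inv y)) = (delta * rat y < enorm (x - y)).
    by rewrite dxy ltr_pdivlMr // /rat mulrA ltr_pdivrMr // [rho * _]mulrC.
  apply/idP/idP; rewrite !inE => -[S D]; split.
  - exact/symmetric_zone_inversion.
  - by rewrite /= -dE.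
  - exact/symmetric_zone_inversion.
  - by rewrite /= dE.
case: (y \in reflected_part); last by rewrite mule0.
rewrite /= -EFinM; congr EFin; rewrite /h1 /h2 /kern dxy.
have ry0 : 0 < rat y by rewrite divr_gt0.
have -> : rat (inv y) = (rat y)^-1.
  by rewrite /rat enorm_inversion //; field; rewrite !gt_eqF.
have -> : rho * enorm (x - y) / enorm y = (rat y)^-1 * enorm (x - y).
  by rewrite /rat; field; rewrite !gt_eqF.
have -> : (rho / enorm y) ^+ (2 * n) = rat y `^ (- (2 * n%:R)).
  rewrite powRN -natrM powR_mulrn ?(ltW ry0) // -exprVn; congr (_ ^+ _).
  by rewrite /rat; field; rewrite !gt_eqF.
have rV0 : 0 <= (rat y)^-1 by rewrite invr_ge0 ltW.
have rV a : (rat y)^-1 `^ a = rat y `^ (- a) by rewrite powRV ?(ltW ry0) // powRN.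
have pD a b : rat y `^ (a + b) = rat y `^ a * rat y `^ b.
  by rewrite powRD // (gt_eqF ry0) implybT.
rewrite (powRM _ rV0 (enorm_ge0 _)) !rV opprK invfM mulrA mulrA; congr (_ * _).
rewrite -powRN opprK mulrBr mulr1 mulrBl -!pD.
by congr (_ `^ _ - _ `^ _); ring.
Qed.

(** [- c0] bounds the symmetrized weight at ratios t >= 2, and [M * eta] the unmatched weights on
    [thin_shell]: the tangent inequality gives 2 gam eta, and the reflected weight carries a further
    factor rat^(-kap) <= 2^kap. *)
Let c0 := (1 - 2 `^ (- gam)) * (2 `^ (gam - kap) - 1).
Let M := 2 `^ (kap + 1) * gam.

Let M_ge0 : 0 <= M.
Proof. by rewrite mulr_ge0 ?powR_ge0 // ltW. Qed.

(** Here |y| / rho lies in [2, 5], so the symmetrized weight stays away from 0; [5 * R1 <= rho]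
    places the annulus inside [symmetric_zone]. *)
Definition far_annulus : set 'rV[R]_n := [set y | 3 * rho < enorm (x - y) <= 4 * rho].

Definition thin_shell : set 'rV[R]_n :=
  [set y | delta * (1 - eta) < enorm (x - y) <= delta * (1 + 2 * eta)].

Let eta_gt0 : 0 < eta.
Proof. by rewrite divr_gt0. Qed.

Let eta_lt : eta < 2^-1.
Proof. by rewrite ltr_pdivrMr // mulrC. Qed.

Lemma far_annulus_sub y : far_annulus y ->
  [/\ symmetric_zone y, 2 <= rat y & rat y <= 5].
Proof.
move=> /andP[d3 d4].
have := ler_enormB (x - y) x; have -> : x - y - x = - y by rewrite addrAC subrr add0r.
have := ler_enormB y x; rewrite enormN enormBC x_rho => b1 b2.
have y2 : 2 * rho <= enorm y by lra.
have y5 : enorm y <= 5 * rho by lra.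
split; [split| |]; first 1 last.
- rewrite ler_pdivlMr //; apply: (@le_trans _ _ (rho * (5 * R1))).
    by rewrite mulrCA mulrA ler_wpM2r // ltW.
  by rewrite expr2 ler_wpM2l // ltW.
- by rewrite ler_pdivlMr.
- by rewrite ler_pdivrMr.
- by move: rhoR1 R1_gt0; lra.
Qed.

(** Both factors vanish at t = 1 and, as -gam < 0 < gam - kap, have opposite signs elsewhere; this
    is where gam > n - 2s enters. *)
Lemma symmetrized_le0 (t : R) : 0 < t -> (1 - t `^ (- gam)) * (1 - t `^ (gam - kap)) <= 0.
Proof.
move=> t0; have gk : 0 < gam - kap by rewrite subr_gt0.
have [t1|t1] := leP 1 t.
  rewrite mulr_ge0_le0 ?subr_ge0 ?subr_le0 //.
    by rewrite -[X in _ <= X](powRr0 t) ler_powR // oppr_le0 ltW.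
  by rewrite -[X in X <= _](powRr0 t) ler_powR // ltW.
have t1' : 0 < t <= 1 by rewrite t0 ltW.
rewrite mulr_le0_ge0 ?subr_ge0 ?subr_le0 //.
  by rewrite -[X in X <= _](powRr0 t) ger_powR // oppr_le0 ltW.
by rewrite -[X in _ <= X](powRr0 t) ger_powR // ltW.
Qed.

Lemma symmetrized_far (t : R) : 2 <= t ->
  (1 - t `^ (- gam)) * (1 - t `^ (gam - kap)) <= - c0.
Proof.
move=> t2; have gk : 0 < gam - kap by rewrite subr_gt0.
have t0 : 0 < t by lra.
rewrite -[1 - t `^ (gam - kap)]opprB mulrN lerN2 /c0; apply: ler_pM.
- rewrite subr_ge0 -[X in _ <= X](powRr0 2) ler_powR ?ler1n // oppr_le0 ltW //.
- by rewrite subr_ge0 -[X in X <= _](powRr0 2) ler_powR ?ler1n // ltW.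
- rewrite lerD2l lerN2 !powRN lef_pV2 ?posrE ?powR_gt0 //.
  by rewrite ge0_ler_powR ?nnegrE ?(ltW gam_gt0) ?(ltW t0).
- by rewrite lerD2r ge0_ler_powR ?nnegrE ?(ltW gk) ?(ltW t0).
Qed.

Let rat_gt0 y : 0 < enorm y -> 0 < rat y.
Proof. by move=> y0; rewrite divr_gt0. Qed.

Let rat_le y : rat y <= 1 + enorm (x - y) / rho.
Proof.
rewrite /rat ler_pdivrMr // mulrDl mul1r mulfVK ?gt_eqF //.
by have := ler_enormB y x; rewrite enormBC x_rho; lra.
Qed.

Let rat_ge y : 1 - enorm (x - y) / rho <= rat y.
Proof.
rewrite /rat ler_pdivlMr // mulrBl mul1r mulfVK ?gt_eqF //.
by have := ler_enormB x (x - y); rewrite opprB addrCA subrr addr0 x_rho; lra.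
Qed.

(** For points of [outer_part] missing from [reflected_part]. Since rat <= 1 + |x - y| / rho <= 1 +
    eta rat, the ratio is at most 1 / (1 - eta) <= 1 + 2 eta, and the tangent inequality bounds the
    weight. *)
Lemma outer_only y : 0 < enorm y -> delta < enorm (x - y) ->
  enorm (x - y) <= delta * rat y ->
  thin_shell y /\ 1 - rat y `^ (- gam) <= M * eta.
Proof.
move=> y0 d1 d2; have t0 := rat_gt0 y0; have := rat_le y.
set t := rat y in t0 d2 *; set d := enorm (x - y) in d1 d2 *.
have drho : d / rho <= eta * t by rewrite mulrAC ler_pM2r ?invr_gt0.
move=> ht.
have t1 : t * (1 - eta) <= 1 by lra.
have e1 : 0 < 1 - eta by move: eta_lt; lra.
have t2 : t <= 1 + 2 * eta.
  rewrite -(ler_pM2r e1); apply: (le_trans t1); move: eta_lt eta_gt0; nra.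
split.
  apply/andP; split; last by apply: (le_trans d2); rewrite ler_wpM2l // ltW.
  apply: le_lt_trans d1; rewrite -[X in _ <= X]mulr1 ler_wpM2l ?(ltW delta_gt0) //.
  by move: eta_gt0; lra.
apply: (@le_trans _ _ (gam * (t - 1))).
  by have := powRN_tangent t0 (ltW gam_gt0); lra.
apply: (@le_trans _ _ (gam * (2 * eta))).
  by rewrite ler_wpM2l ?(ltW gam_gt0) //; lra.
rewrite /M mulrA [_ * gam]mulrC -!mulrA ler_wpM2l ?(ltW gam_gt0) //.
rewrite ler_wpM2r ?(ltW eta_gt0) //.
rewrite -[X in X <= _](@powRr1 R 2) // ler_powR ?ler1n //.
by move: kap_gt0; lra.
Qed.

(** The opposite mismatch: now rat >= 1 - eta, and the tangent inequality is applied to 1 / rat. *)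
Lemma reflected_only y : 0 < enorm y -> enorm (x - y) <= delta ->
  delta * rat y < enorm (x - y) ->
  thin_shell y /\ rat y `^ (- kap) - rat y `^ (gam - kap) <= M * eta.
Proof.
move=> y0 d1 d2; have t0 := rat_gt0 y0; have := rat_ge y.
set t := rat y in t0 d2 *; set d := enorm (x - y) in d1 d2 *.
have drho : d / rho <= eta by rewrite ler_pM2r ?invr_gt0.
move=> ht.
have t1 : 1 - eta <= t by lra.
have e1 : 2^-1 < 1 - eta by move: eta_lt; lra.
have t2 : t^-1 <= 1 + 2 * eta.
  rewrite -[X in X <= _]mul1r ler_pdivrMr //.
  apply: (@le_trans _ _ ((1 + 2 * eta) * (1 - eta))); last first.
    by rewrite ler_wpM2l //; move: eta_gt0; lra.
  by move: eta_lt eta_gt0; nra.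
split.
  apply/andP; split.
    by apply: le_lt_trans d2; rewrite ler_wpM2l // ltW.
  apply: (le_trans d1); rewrite -[X in X <= _]mulr1 ler_wpM2l ?(ltW delta_gt0) //.
  by move: eta_gt0; lra.
have -> : t `^ (- kap) - t `^ (gam - kap) = t `^ (- kap) * (1 - t `^ gam).
  by rewrite mulrBr mulr1 -powRD ?(gt_eqF t0) ?implybT // [gam - _]addrC.
have ti0 : 0 < t^-1 by rewrite invr_gt0.
have g1 : 1 - t `^ gam <= gam * (2 * eta).
  have := powRN_tangent ti0 (ltW gam_gt0); rewrite powRV ?(ltW t0) // powRN invrK => h.
  have : gam * (t^-1 - 1) <= gam * (2 * eta).
    by rewrite ler_wpM2l ?(ltW gam_gt0) //; lra.
  by lra.
have g2 : t `^ (- kap) <= 2 `^ kap.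
  rewrite powRN -powRV ?(ltW t0) // ge0_ler_powR ?nnegrE ?(ltW kap_gt0) ?(ltW ti0) //.
  by apply: (le_trans t2); move: eta_lt; lra.
apply: (@le_trans _ _ (t `^ (- kap) * (gam * (2 * eta)))).
  by rewrite ler_wpM2l ?powR_ge0.
apply: (@le_trans _ _ (2 `^ kap * (gam * (2 * eta)))).
  by rewrite ler_wpM2r // mulr_ge0 ?(ltW gam_gt0) // mulr_ge0 // ltW.
rewrite /M (@powRD R 2 kap 1) ?pnatr_eq0 ?implybT // powRr1 // le_eqVlt; apply/orP; left.
by apply/eqP; ring.
Qed.

(* The two truncations differ only on [thin_shell], of relative width [O(eta)], and there
   the unmatched integrand carries another factor [O(eta)]: the total error is
   [O(eta ^+ 2 * delta `^ (- 2 * s))], which vanishes with [delta]. *)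
Lemma symmetrized_pointwise y :
  (h1 \_ outer_part) y + (h2 \_ reflected_part) y <=
  ((fun y => - c0 * K y) \_ far_annulus) y +
  ((fun y => M * eta * K y) \_ thin_shell) y.
Proof.
have K0 : 0 <= K y := kern_ge0 s x y.
have sh0 : 0 <= ((fun y => M * eta * K y) \_ thin_shell) y.
  by rewrite /patch; case: ifP => // _; rewrite mulr_ge0 // mulr_ge0 // ltW.
have [Sy|nSy] := pselect (symmetric_zone y); last first.
  have nin (D : set 'rV[R]_n) (g : 'rV[R]_n -> R) : ~ D y -> (g \_ D) y = 0.
    by move=> h; rewrite /patch memNset.
  rewrite (nin outer_part) ?(nin reflected_part) ?(nin far_annulus) ?add0r //.
  - by move=> /far_annulus_sub[].
  - by case.
  - by case.
have y0 := symmetric_zone_gt0 Sy; have t0 := rat_gt0 y0.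
have far_d : far_annulus y -> delta < enorm (x - y) /\ delta * rat y < enorm (x - y).
  move=> fy; have [_ _ t5] := far_annulus_sub fy; move: fy => /andP[d3 _].
  have : delta * rat y <= rho / 2 * 5 by rewrite ler_pM ?(ltW delta_gt0) ?(ltW t0) // ltW.
  by move: delta_lt rho_gt0; lra.
have inO : delta < enorm (x - y) -> (h1 \_ outer_part) y = h1 y.
  by move=> h; rewrite /patch mem_set.
have ninO : enorm (x - y) <= delta -> (h1 \_ outer_part) y = 0.
  by move=> h; rewrite /patch memNset // => -[_ /=]; rewrite ltNge h.
have inR : delta * rat y < enorm (x - y) -> (h2 \_ reflected_part) y = h2 y.
  by move=> h; rewrite /patch mem_set.
have ninR : enorm (x - y) <= delta * rat y -> (h2 \_ reflected_part) y = 0.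
  by move=> h; rewrite /patch memNset // => -[_ /=]; rewrite ltNge h.
have nfar : ~ far_annulus y -> ((fun y => - c0 * K y) \_ far_annulus) y = 0.
  by move=> h; rewrite /patch memNset.
have shin : thin_shell y ->
    ((fun y => M * eta * K y) \_ thin_shell) y = M * eta * K y.
  by move=> h; rewrite /patch mem_set.
have [d1|d1] := ltP delta (enorm (x - y)); have [d2|d2] := ltP (delta * rat y) (enorm (x - y)).
- rewrite inO // inR // -[leLHS]addr0; apply: lerD => //.
  have -> : h1 y + h2 y = (1 - rat y `^ (- gam)) * (1 - rat y `^ (gam - kap)) * K y.
    rewrite /h1 /h2 -mulrDl; congr (_ * _); rewrite mulrBr mulr1 mulrBl mul1r -powRD.
      rewrite (_ : - gam + (gam - kap) = - kap); first by ring.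
      by ring.
    by rewrite (gt_eqF t0) implybT.
  have [fy|nfy] := pselect (far_annulus y).
    rewrite /patch mem_set // ler_wpM2r //; apply: symmetrized_far.
    by have [] := far_annulus_sub fy.
  by rewrite nfar // mulr_le0_ge0 // symmetrized_le0.
- have [sy le] := outer_only y0 d1 d2.
  rewrite inO // ninR // nfar ?addr0 ?add0r ?shin // /h1 ?ler_wpM2r //.
  by move=> /far_d[_]; rewrite ltNge d2.
- have [sy le] := reflected_only y0 d1 d2.
  rewrite ninO // inR // nfar ?addr0 ?add0r ?shin // /h2 ?ler_wpM2r //.
  by move=> /far_d[]; rewrite ltNge d1.
- rewrite ninO // ninR // nfar ?addr0 ?add0r //.
  by move=> /far_d[]; rewrite ltNge d1.
Qed.

Lemma Rintegral_outer_le :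
  2 * \int[mu]_(y in outer_part) h1 y <=
  - c0 * \int[mu]_(y in far_annulus) K y + M * eta * \int[mu]_(y in thin_shell) K y.
Proof.
have mO := measurable_outer_part; have mR := measurable_reflected_part.
have mF : measurable far_annulus by exact: measurable_enorm_oc.
have mS : measurable thin_shell by exact: measurable_enorm_oc.
have sh0 : 0 < delta * (1 - eta) by rewrite mulr_gt0 //; move: eta_lt; lra.
have iF : mu.-integrable far_annulus (EFin \o K).
  by apply: integrable_kern_annulus => //; rewrite mulr_gt0.
have iS : mu.-integrable thin_shell (EFin \o K) by exact: integrable_kern_annulus.
have i1 := integrable_patch mO integrable_h1.
have i2 := integrable_patch mR integrable_h2.
have i3 := integrable_patch mF (integrableZ_EFin mF (- c0) iF).
have i4 := integrable_patch mS (integrableZ_EFin mS (M * eta) iS).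
(* One of the two copies is replaced by its inverted form, so that [symmetrized_pointwise] applies
   under a single integral. *)
rewrite mulrDl mul1r {2}integral_outer_reflected -!RintegralZl //.
rewrite Rintegral_mkcond [X in _ + X <= _]Rintegral_mkcond.
rewrite [X in _ <= X + _]Rintegral_mkcond [X in _ <= _ + X]Rintegral_mkcond.
rewrite -!RintegralD //; apply: le_Rintegral => //.
- exact: (integrableD_EFin measurableT i1 i2).
- exact: (integrableD_EFin measurableT i3 i4).
- by move=> y _; exact: symmetrized_pointwise.
Qed.

Definition inner_ball : set 'rV[R]_n := [set y | enorm (0 - y) <= R1].

(** Contains all y with |y| > rho^2 / R1, but is the exterior of a ball about [x], so that the tail
    formula applies; [5 * R1 <= rho] justifies the halved radius. *)
Definition outer_region : set 'rV[R]_n := [set y | rho ^+ 2 / (2 * R1) < enorm (x - y)].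

Let mE : measurable [set y : 'rV[R]_n | R1 <= enorm y].
Proof.
rewrite [X in measurable X](_ : _ = [set y | `[R1, +oo[%classic (enorm y)]).
  by apply: measurable_enorm_set; exact: measurable_itv.
by apply/seteqP; split=> y /=; rewrite in_itv /= andbT.
Qed.

Lemma barrier_ge0 y : 0 <= barrier gam R1 y.
Proof. by rewrite /barrier /patch; case: ifP => // _; exact: powR_ge0. Qed.

Lemma barrierE y : R1 <= enorm y -> barrier gam R1 y = enorm y `^ (- gam).
Proof. by move=> h; rewrite /barrier /patch mem_set. Qed.

Lemma barrier_inner y : enorm y < R1 -> barrier gam R1 y = 0.
Proof. by move=> h; rewrite /barrier /patch memNset //= => h'; move: h; rewrite ltNge h'. Qed.

Lemma barrier_le y : barrier gam R1 y <= R1 `^ (- gam).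
Proof.
have [h|h] := leP R1 (enorm y); last by rewrite barrier_inner // powR_ge0.
rewrite barrierE // !powRN lef_pV2 ?posrE ?powR_gt0 ?(lt_le_trans _ h) //.
by rewrite ge0_ler_powR ?nnegrE ?(ltW gam_gt0) ?(ltW R1_gt0) ?enorm_ge0.
Qed.

Lemma integrable_barrier :
  mu.-integrable [set y | delta < enorm (x - y)]
    (EFin \o (fun y => (barrier gam R1 x - barrier gam R1 y) * K y)).
Proof.
have mD := measurable_enorm_gt delta x.
apply: (@le_integrable_EFin _ _ _ mu _ _ (fun y => R1 `^ (- gam) * K y)) => //.
- apply: measurable_funTS; apply: measurable_funM; last exact: measurable_kern.
  apply: measurable_funB => //; apply: (measurable_restrictT _ mE).1.
  apply: measurable_funTS; apply: (measurableT_comp (measurable_powR _)).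
  exact: measurable_enorm.
- move=> y _; rewrite normrM (ger0_norm (kern_ge0 s x y)) ler_wpM2r ?kern_ge0 //.
  rewrite ler_norml lerNl opprB (le_trans _ (barrier_le y)) ?gerBl ?barrier_ge0 //=.
  by rewrite (le_trans _ (barrier_le x)) // gerBl barrier_ge0.
- by apply: integrableZ_EFin => //; exact: integrable_kern.
Qed.

(** Outside [symmetric_zone] the difference of barrier values is at most its first term rho^(-gam);
    inside, it is rho^(-gam) times the weight in [h1]. *)
Lemma barrier_pointwise y :
  ((fun y => (barrier gam R1 x - barrier gam R1 y) * K y) \_
     [set y | delta < enorm (x - y)]) y <=
  rho `^ (- gam) *
    ((h1 \_ outer_part) y + (K \_ inner_ball) y + (K \_ outer_region) y).
Proof.
have K0 : 0 <= K y := kern_ge0 s x y.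
have r0 : 0 <= rho `^ (- gam) := powR_ge0 _ _.
have I0 : 0 <= (K \_ inner_ball) y by rewrite /patch; case: ifP.
have O0 : 0 <= (K \_ outer_region) y by rewrite /patch; case: ifP.
have bx : barrier gam R1 x = rho `^ (- gam).
  by rewrite barrierE x_rho //; move: rhoR1 R1_gt0; lra.
have [d1|d1] := ltP delta (enorm (x - y)); last first.
  rewrite {1}/patch memNset /=; last by rewrite ltNge d1.
  rewrite mulr_ge0 // -addrA addr_ge0 ?addr_ge0 //.
  by rewrite /patch memNset // => -[_ /=]; rewrite ltNge d1.
rewrite {1}/patch mem_set // bx.
have top : (rho `^ (- gam) - barrier gam R1 y) * K y <= rho `^ (- gam) * K y.
  by rewrite ler_wpM2r // gerBl barrier_ge0.
have [y1|y1] := ltP (enorm y) R1.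
  apply: (le_trans top); rewrite ler_wpM2l //.
  rewrite {1}/patch memNset ?add0r; last by move=> [[/=]]; rewrite leNgt y1.
  by rewrite {1}/patch mem_set ?lerDl // /inner_ball /= sub0r enormN ltW.
have [y2|y2] := leP (enorm y) (rho ^+ 2 / R1); last first.
  apply: (le_trans top); rewrite ler_wpM2l //.
  rewrite {1}/patch memNset ?add0r; last by move=> [[_ /=]]; rewrite leNgt y2.
  rewrite {2}/patch mem_set ?lerDr // /outer_region /=.
  have := ler_enormB y x; rewrite enormBC x_rho; apply: lt_le_trans.
  have -> : rho ^+ 2 / (2 * R1) = rho ^+ 2 / R1 / 2 by field; rewrite gt_eqF.
  have : rho * 5 <= rho ^+ 2 / R1.
    by rewrite ler_pdivlMr // expr2 -mulrA ler_wpM2l // ltW.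
  by move: y2 rho_gt0; lra.
have y0 : 0 < enorm y := lt_le_trans R1_gt0 y1.
rewrite barrierE // {1}/patch mem_set //.
apply: (@le_trans _ _ (rho `^ (- gam) * h1 y)); last first.
  by rewrite ler_wpM2l // -addrA lerDl addr_ge0.
rewrite /h1 mulrA mulrBr mulr1 -powRM ?(ltW rho_gt0) ?divr_ge0 ?(ltW y0) ?(ltW rho_gt0) //.
by rewrite mulrCA divff ?mulr1 // gt_eqF.
Qed.

Lemma Rintegral_barrier_le :
  \int[mu]_(y in [set y | delta < enorm (x - y)])
    ((barrier gam R1 x - barrier gam R1 y) * K y) <=
  rho `^ (- gam) * (\int[mu]_(y in outer_part) h1 y +
    \int[mu]_(y in inner_ball) K y + \int[mu]_(y in outer_region) K y).
Proof.
have mD := measurable_enorm_gt delta x.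
have mO := measurable_outer_part.
have mI : measurable inner_ball by exact: measurable_enorm_le.
have mR : measurable outer_region by exact: measurable_enorm_gt.
have iI : mu.-integrable inner_ball (EFin \o K).
  have r2 : 0 < rho / 2 by rewrite divr_gt0.
  apply: (integrableS (measurable_enorm_gt _ _) mI _ (integrable_kern s_gt0 n_ge2 x r2)).
  move=> y; rewrite /inner_ball /= sub0r enormN => yR.
  by have := ler_enormB x y; rewrite x_rho; move: rhoR1 R1_gt0; lra.
have iR : mu.-integrable outer_region (EFin \o K).
  by apply: integrable_kern => //; rewrite divr_gt0 ?exprn_gt0 ?mulr_gt0.
have i0 := integrable_patch mD integrable_barrier.
have i1 := integrable_patch mO integrable_h1.
have i2 := integrable_patch mI iI.
have i3 := integrable_patch mR iR.
have i12 := integrableD_EFin measurableT i1 i2.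
have i123 := integrableD_EFin measurableT i12 i3.
rewrite Rintegral_mkcond [X in _ * (X + _ + _)]Rintegral_mkcond.
rewrite [X in _ * (_ + X + _)]Rintegral_mkcond [X in _ * (_ + X)]Rintegral_mkcond.
rewrite -RintegralD // -RintegralD // -RintegralZl //.
apply: le_Rintegral => //; first exact: integrableZ_EFin.
by move=> y _; exact: barrier_pointwise.
Qed.

End barrier.

(** The gain from [far_annulus] is of order rho^(-gam - 2s). Up to constants, the inner ball costs
    rho^(-n) times that and the outer region rho^(-2s) times that; both factors are at most 1 / rho
    because 2s > 1, so taking [R2] large absorbs them into half of the gain. *)
Lemma barrier_estimate (R : realType) (n : nat) (s gam R1 : R) :
  2^-1 < s -> s < 1 -> 2 * s < n%:R -> (2 <= n)%N -> n%:R - 2 * s < gam -> 0 < R1 ->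
  exists c R2 : R, [/\ 0 < c, 5 * R1 <= R2, 1 <= R2 &
    forall x : 'rV[R]_n, R2 <= enorm x -> forall e, 0 < e ->
      \forall delta \near 0^'+,
        \int[lebesgue_rV R n]_(y in [set y | delta < enorm (x - y)])
          ((barrier gam R1 x - barrier gam R1 y) * kern s x y) <=
        - (c / enorm x `^ (gam + 2 * s)) + e].
Proof.
move=> s_gt s_lt1 s_n n_ge2 gam_gt R1_gt0.
have s_gt0 : 0 < s by lra.
have [cT cT0 cTE] := @Rintegral_kern R n s s_gt0 n_ge2.
pose kap := n%:R - 2 * s.
have kap0 : 0 < kap by rewrite /kap; lra.
have gam0 : 0 < gam by rewrite /kap in kap0; lra.
pose c0 : R := (1 - 2 `^ (- gam)) * (2 `^ (gam - kap) - 1).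
pose M : R := 2 `^ (kap + 1) * gam.
have c0_gt0 : 0 < c0.
  apply: mulr_gt0; last by rewrite subr_gt0 powR_gt1 ?ltr1n // subr_gt0.
  by rewrite subr_gt0 powRN invf_lt1 ?powR_gt0 // powR_gt1 ?ltr1n.
have M0 : 0 <= M by rewrite mulr_ge0 ?powR_ge0 // ltW.
pose k34 : R := (3 `^ (2 * s))^-1 - (4 `^ (2 * s))^-1.
have k34_gt0 : 0 < k34.
  rewrite subr_gt0 ltf_pV2 ?posrE ?powR_gt0 //.
  by apply: gt0_ltr_powR; rewrite ?nnegrE ?mulr_gt0 // ltr_nat.
pose v : R := fine (lebesgue_rV R n [set y : 'rV[R]_n | enorm (0 - y) <= R1]).
have v0 : 0 <= v by rewrite fine_ge0.
pose K0 := v * 2 `^ (n%:R + 2 * s) + cT * (2 * R1) `^ (2 * s).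
have K00 : 0 <= K0.
  by rewrite addr_ge0 // mulr_ge0 ?powR_ge0 // ltW.
(* The tail formula between radii 3 rho and 4 rho gives [far_annulus] mass cT k34 rho^(-2s); the
   halving is due to [Rintegral_outer_le], which bounds twice the integral. *)
pose c1 := c0 * cT * k34 / 2.
have c10 : 0 < c1.
  by apply: divr_gt0 => //; apply: mulr_gt0 => //; apply: mulr_gt0.
exists (c1 / 2), (Num.max (Num.max 1 (5 * R1)) (2 * K0 / c1)); split.
- by rewrite divr_gt0.
- by rewrite !le_max lexx orbT.
- by rewrite !le_max lexx.
move=> x; rewrite !ge_max -andbA => /and3P[x1 xR xK] e e0.
set rho := enorm x in x1 xR xK *.
have rho0 : 0 < rho by lra.
have P0 a : 0 < rho `^ a by rewrite powR_gt0.
have PD a b : rho `^ (a + b) = rho `^ a * rho `^ b.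
  by rewrite powRD // (gt_eqF rho0) implybT.
(* Coefficient of the thin-shell error: eta^2 delta^(-2s) = delta^(2 - 2s) / rho^2 tends to 0 with
   [delta]. *)
pose Cc := rho `^ (- gam) * (4 * M * cT / rho ^+ 2).
have tau0 : 0 < 2 - 2 * s by lra.
have small : \forall delta \near 0^'+, Cc * delta `^ (2 - 2 * s) <= e.
  have h : Cc * t `^ (2 - 2 * s) @[t --> 0^'+] --> Cc * 0.
    by apply: cvgM; [exact: cvg_cst|exact: powR_cvg0].
  by rewrite mulr0 in h; apply: (cvgr_le _ h).
near=> delta.
have d0 : 0 < delta by near: delta; exact: nbhs_right_gt.
have d2 : delta < rho / 2 by near: delta; apply: nbhs_right_lt; rewrite divr_gt0.
have xrho : enorm x = rho by [].
apply: (le_trans (Rintegral_barrier_le s_gt0 s_n n_ge2 gam_gt R1_gt0 xR d0 xrho)).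
have HO := Rintegral_outer_le s_gt0 s_n n_ge2 gam_gt R1_gt0 xR d0 d2 xrho.
set IO := (X in 2 * X <= _) in HO.
set eta := delta / rho in HO.
have eta0 : 0 < eta by rewrite divr_gt0.
have eta1 : eta < 2^-1 by rewrite ltr_pdivrMr // mulrC.
have sP a : 0 < a -> (a * rho) `^ (2 * s) = a `^ (2 * s) * rho `^ (2 * s).
  by move=> a0; rewrite powRM ?ltW.
have E1 : \int[lebesgue_rV R n]_(y in far_annulus rho x) kern s x y =
    cT * k34 / rho `^ (2 * s).
  rewrite Rintegral_kern_annulus ?mulr_gt0 ?ler_wpM2r ?ler_nat // ?(ltW rho0) //.
  rewrite !cTE ?mulr_gt0 // !sP // /k34.
  by field; rewrite !gt_eqF ?powR_gt0.
have E2 : \int[lebesgue_rV R n]_(y in thin_shell rho delta x) kern s x y <=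
    cT * (8 * eta) / delta `^ (2 * s).
  have a1 : 0 < 1 - eta by clear -eta1; lra.
  have a2 : 0 < 1 + 2 * eta by clear -eta0; lra.
  rewrite Rintegral_kern_annulus ?mulr_gt0 ?ler_wpM2l // ?(ltW d0) // -/eta; last by clear -eta0; lra.
  rewrite !cTE ?mulr_gt0 // !powRM ?(ltW d0) ?(ltW a1) ?(ltW a2) //.
  have s2 : 2 * s <= 2 by clear -s_lt1; lra.
  have s20 : 0 <= 2 * s by clear -s_gt0; lra.
  have := shell_weight (ltW eta0) (ltW eta1) s20 s2 => hw.
  rewrite [leLHS](_ : _ = cT * (((1 - eta) `^ (2 * s))^-1 - ((1 + 2 * eta) `^ (2 * s))^-1)
     / delta `^ (2 * s)); last first.
    by field; rewrite !gt_eqF ?powR_gt0.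
  by rewrite ler_wpM2r ?invr_ge0 ?powR_ge0 // ler_wpM2l // ltW.
have E3 : \int[lebesgue_rV R n]_(y in @inner_ball R n R1) kern s x y <=
    v * 2 `^ (n%:R + 2 * s) / rho `^ (n%:R + 2 * s).
  have mI : measurable (@inner_ball R n R1) by exact: measurable_enorm_le.
  have a0 : 0 <= n%:R + 2 * s by rewrite addr_ge0 // mulr_ge0 // ltW.
  have -> : v * 2 `^ (n%:R + 2 * s) / rho `^ (n%:R + 2 * s) =
      ((rho / 2) `^ (n%:R + 2 * s))^-1 * v.
    rewrite powRM ?invr_ge0 ?(ltW rho0) // powRV // invfM invrK.
    by field; rewrite !gt_eqF ?powR_gt0.
  rewrite /v -(Rintegral_cst _ mI).
  apply: le_Rintegral => //.
  + have r2 : 0 < rho / 2 by rewrite divr_gt0.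
    apply: (integrableS (measurable_enorm_gt _ _) mI _ (integrable_kern s_gt0 n_ge2 x r2)).
    move=> y; rewrite /inner_ball /= sub0r enormN => yR.
    by have := ler_enormB x y; rewrite -/rho; clear -yR xR R1_gt0; lra.
  + apply: measurable_bounded_integrable => //.
    * exact: lebesgue_rV_ball.
    * exact: bounded_cst.
  + move=> y; rewrite /inner_ball /= sub0r enormN => yR.
    rewrite lef_pV2 ?posrE ?powR_gt0 ?divr_gt0 //; last first.
      by have := ler_enormB x y; rewrite -/rho; clear -yR xR R1_gt0; lra.
    rewrite ge0_ler_powR ?nnegrE ?enorm_ge0 ?divr_ge0 ?(ltW rho0) //.
    by have := ler_enormB x y; rewrite -/rho; clear -yR xR R1_gt0; lra.
have E4 : \int[lebesgue_rV R n]_(y in outer_region rho R1 x) kern s x y =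
    cT * (2 * R1) `^ (2 * s) / (rho `^ (2 * s) * rho `^ (2 * s)).
  rewrite cTE ?divr_gt0 ?exprn_gt0 ?mulr_gt0 //.
  have R10 := ltW R1_gt0.
  rewrite powRM ?invr_ge0 ?mulr_ge0 ?exprn_ge0 ?(ltW rho0) // powRV ?mulr_ge0 //.
  rewrite expr2 [(rho * rho) `^ _]powRM ?(ltW rho0) //.
  by field; rewrite !gt_eqF ?powR_gt0 ?mulr_gt0.
set A := (X in _ * (_ + X + _) <= _) in E3 *; set B := (X in _ * (_ + _ + X) <= _) in E4 *.
set F := (X in - _ * X + _) in HO E1; set T := (X in _ + _ * X) in HO E2.
have smalld : Cc * delta `^ (2 - 2 * s) <= e by near: delta.
have rho_le a : 1 <= a -> rho <= rho `^ a by move=> a1; rewrite le1r_powR.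
have r2 : rho <= rho `^ (2 * s) by apply: rho_le; clear -s_gt; lra.
have n1 : rho <= rho `^ n%:R by apply: rho_le; rewrite ler1n (ltn_trans _ n_ge2).
set r := rho `^ (2 * s) in E1 E4 r2 *.
have r0 : 0 < r := P0 _.
have rr0 : 0 < (rho * r)^-1 by rewrite invr_gt0 mulr_gt0.
have HA : A <= v * 2 `^ (n%:R + 2 * s) / (rho * r).
  apply: (le_trans E3); rewrite ler_wpM2l ?mulr_ge0 ?powR_ge0 //.
  by rewrite lef_pV2 ?posrE ?mulr_gt0 // PD ler_wpM2r // ltW.
have HB : B <= cT * (2 * R1) `^ (2 * s) / (rho * r).
  rewrite /B E4 ler_wpM2l ?mulr_ge0 ?powR_ge0 ?(ltW cT0) //.
  by rewrite lef_pV2 ?posrE ?mulr_gt0 // ler_wpM2r // ltW.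
have HAB : A + B <= c1 / 2 / r.
  apply: (@le_trans _ _ (K0 / (rho * r))); first by rewrite /K0 mulrDl lerD.
  rewrite invfM mulrA ler_wpM2r ?invr_ge0 ?(ltW r0) // ler_pdivrMr //.
  by move: xK; rewrite ler_pdivrMr //; clear; lra.
have HIO : IO <= - (c1 / r) + 4 * M * cT / rho ^+ 2 * delta `^ (2 - 2 * s).
  have HT : M * eta * T <= M * eta * (cT * (8 * eta) / delta `^ (2 * s)).
    by rewrite ler_wpM2l // mulr_ge0 // ltW.
  have -> : 4 * M * cT / rho ^+ 2 * delta `^ (2 - 2 * s) =
      (M * eta * (cT * (8 * eta) / delta `^ (2 * s))) / 2.
    rewrite powRB ?(gt_eqF d0) ?implybT // [delta `^ 2]powR_mulrn ?(ltW d0) //.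
    by rewrite /eta; field; rewrite !gt_eqF ?powR_gt0.
  have HF : c0 * F = 2 * (c1 / r) by rewrite /F E1 /c1; field; rewrite gt_eqF.
  have HO' : 2 * IO <= - c0 * F + M * eta * T by exact: HO.
  by clear -HO' HT HF; lra.
apply: (@le_trans _ _ (rho `^ (- gam) *
    (- (c1 / 2 / r) + 4 * M * cT / rho ^+ 2 * delta `^ (2 - 2 * s)))).
  suff h : IO + A + B <= - (c1 / 2 / r) + 4 * M * cT / rho ^+ 2 * delta `^ (2 - 2 * s).
    exact: (ler_wpM2l (powR_ge0 _ _) h).
  by move: HIO HAB; clear; lra.
rewrite mulrDr; apply: lerD; last by apply: le_trans smalld; rewrite /Cc mulrA.
by rewrite PD -/r powRN mulrN lerN2 invfM [leRHS]mulrCA.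
Unshelve. all: by end_near. Qed.

Lemma continuous_powRN (R : realType) (a t : R) : 0 < t -> {for t, continuous (fun r : R => r `^ (- a))}.
Proof.
move=> t0; apply/differentiable_continuous; rewrite -derivable1_diffP.
by apply: derivable_powR; rewrite in_itv /= t0.
Qed.

(** * Comparison and nonexistence *)

Section lower_bound.
Variables (R : realType) (n : nat) (s C lambda R0 q gam : R) (f : R -> R) (u : 'rV[R]_n -> R).
Hypotheses (s_gt : 2^-1 < s) (s_lt1 : s < 1) (s_n : 2 * s < n%:R) (n_ge2 : (2 <= n)%N).
Hypotheses (C_gt0 : 0 < C) (lambda_gt0 : 0 < lambda) (R0_gt0 : 0 < R0) (q_gt1 : 1 < q).
Hypotheses (gam_gt : n%:R - 2 * s < gam) (gam_q : gam + 2 * s <= q * (gam + 1)).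
Hypothesis f_pos : forall t, 0 < t -> 0 < f t.
Hypotheses (u_super : classical_supersolution C s q lambda f R0 u)
  (u_gt0 : forall x, 0 < u x).
Local Notation mu := (lebesgue_rV R n).
Local Notation phi := (@barrier R n gam (R0 + 1)).
Implicit Types x y : 'rV[R]_n.

Let s_gt0 : 0 < s. Proof. by move: s_gt; lra. Qed.
Let gam_gt0 : 0 < gam. Proof. by move: gam_gt s_n; lra. Qed.
Let R1_gt0 : 0 < R0 + 1. Proof. by move: R0_gt0; lra. Qed.
Let q_ge0 : 0 <= q. Proof. by move: q_gt1; lra. Qed.

Lemma supersolution_min (a b : R) : R0 < a -> a <= b ->
  exists2 m : R, 0 < m & forall y, a <= enorm y -> enorm y <= b -> m <= u y.
Proof.
move=> Ra ab; have i0 : 'I_n by exact: (Ordinal (ltn_trans (ltnSn 0) n_ge2)).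
have [||y [] //|y [ay _]|x [ax xb] hx] := @EVT_exterior R n R0 b
   ([set y | a <= enorm (0 - y)] `&` [set y | enorm (0 - y) <= b]) u.
- by apply: closedI; [exact: closed_enorm_ge|exact: closed_enorm_le].
- exists (b *: delta_mx ord0 i0) => /=; rewrite sub0r enormN enorm_scaled_delta_mx.
  by rewrite ger0_norm ?lexx ?ab //; move: Ra R0_gt0; lra.
- by rewrite /= sub0r enormN.
- apply: (supersolution_continuous u_super); apply: lt_le_trans Ra _.
  by move: ay; rewrite /= sub0r enormN.
- exists (u x) => // y ay yb; apply: hx.
  by split; rewrite /= sub0r enormN.
Qed.

(** At a contact point lambda f(u x) is positive, while the gradient term (n gam eps)^q rho^(-q (gam
    + 1)) is dominated by the negative fractional term, C cb eps rho^(-gam - 2s) in size: rho >= 1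
    compares the powers of rho, and the remaining eps^(q - 1) is small by assumption. *)
Lemma barrier_touch_false x (eps cb : R) : 5 * (R0 + 1) <= enorm x -> 1 <= enorm x ->
  0 < eps -> 0 < cb -> (n%:R * gam) `^ q * eps `^ (q - 1) <= C * cb ->
  (forall e, 0 < e -> \forall delta \near 0^'+,
     \int[mu]_(y in [set y | delta < enorm (x - y)]) ((phi x - phi y) * kern s x y) <=
     - (cb / enorm x `^ (gam + 2 * s)) + e) ->
  (forall y, u x - u y <= eps * (phi x - phi y)) -> False.
Proof.
move=> xR x1 e0 cb0 heps hest touch; set rho := enorm x in xR x1 hest.
have rho0 : 0 < rho by lra.
have Rx : exterior R0 x by rewrite /exterior /= -/rho; move: xR R0_gt0; lra.
have [_ L2u _] := u_super.
have P0 a : 0 < rho `^ a by rewrite powR_gt0.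
have h := supersolution_touch s_gt0 s_lt1 s_n n_ge2 C_gt0 q_ge0 u_super
  (B := eps * (- (cb / rho `^ (gam + 2 * s)))) (L := eps * (gam * rho `^ (- gam - 1)))
  (K := 0) (tau := rho / 2) Rx.
have {h} : lambda * f (u x) <= C * (eps * (- (cb / rho `^ (gam + 2 * s)))) +
    (n%:R * (eps * (gam * rho `^ (- gam - 1)))) `^ q.
  apply: h.
  - move=> e ep0; near=> delta.
    have d0 : 0 < delta by near: delta; exact: nbhs_right_gt.
    have ib := @integrable_barrier R n s gam delta (R0 + 1) s_gt0 s_n n_ge2 gam_gt R1_gt0 d0 x.
    apply: (le_trans (truncated_integral_le s_gt0 s_n n_ge2 d0 L2u touch _)).
      rewrite (_ : (fun y => _) = (fun y => eps * ((phi x - phi y) * kern s x y))); last first.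
        by apply/funext => y; rewrite mulrA.
      apply: integrableZ_EFin; first exact: measurable_enorm_gt.
      exact: ib.
    under eq_Rintegral do rewrite -mulrA.
    rewrite RintegralZl //; last exact: measurable_enorm_gt.
    have : \int[mu]_(y in [set y | delta < enorm (x - y)]) ((phi x - phi y) * kern s x y) <=
       - (cb / rho `^ (gam + 2 * s)) + e / eps.
      by near: delta; apply: hest; rewrite divr_gt0.
    rewrite -(ler_pM2l e0) => /le_trans; apply.
    by rewrite mulrDr mulrCA divff ?mulr1 // gt_eqF.
  - by rewrite divr_gt0.
  (* Convexity of t^(-gam) bounds the decrease of [phi] linearly, so [K = 0]; |t| <= rho / 2 keeps
     [y] out of the cut-off ball. *)
  - move=> i t tr; rewrite mul0r addr0.
    set y := x + t *: delta_mx ord0 i.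
    have xy : enorm (x - y) = `|t|.
      by rewrite /y opprD addrA subrr add0r enormN enorm_scaled_delta_mx.
    have b1 := ler_enormB x (x - y); rewrite opprB addrCA subrr addr0 -/rho xy in b1.
    have b2 := ler_enormB y x; rewrite enormBC xy -/rho in b2.
    have yR : R0 + 1 <= enorm y by move: xR R0_gt0; lra.
    have y0 : 0 < enorm y := lt_le_trans R1_gt0 yR.
    have phix : phi x = rho `^ (- gam) by rewrite barrierE //; move: xR R0_gt0; rewrite -/rho; lra.
    have phiy : phi y = rho `^ (- gam) * (enorm y / rho) `^ (- gam).
      rewrite barrierE // -powRM ?(ltW rho0) ?divr_ge0 ?(ltW rho0) ?(ltW y0) //.
      by rewrite mulrCA divff ?mulr1 // gt_eqF.
    have := touch y.
    have yr0 : 0 < enorm y / rho by rewrite divr_gt0.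
    have := powRN_tangent yr0 (ltW gam_gt0); set w := (_ / rho) `^ (- gam) in phiy *.
    have tt : enorm y / rho - 1 <= `|t| / rho.
      by rewrite lerBlDr -[X in _ + X](@divff _ rho) ?gt_eqF // -mulrDl ler_pM2r ?invr_gt0 //; lra.
    move=> hw; rewrite phix phiy => ht.
    have hw2 : 1 - gam * (`|t| / rho) <= w.
      by apply: le_trans hw; rewrite lerD2l lerN2 ler_wpM2l // ltW.
    have hw3 : rho `^ (- gam) * (1 - w) <= rho `^ (- gam) * (gam * (`|t| / rho)).
      by rewrite ler_wpM2l ?powR_ge0 //; lra.
    have -> : eps * (gam * rho `^ (- gam - 1)) * `|t| =
        eps * (rho `^ (- gam) * (gam * (`|t| / rho))).
      rewrite powRB ?(gt_eqF rho0) ?implybT // powRr1 ?(ltW rho0) //.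
      by field; rewrite gt_eqF.
    have : eps * (rho `^ (- gam) * (1 - w)) <= eps * (rho `^ (- gam) * (gam * (`|t| / rho))).
      by rewrite ler_wpM2l // ltW.
    by move: ht; lra.
have fx : 0 < lambda * f (u x) by rewrite mulr_gt0 // f_pos.
apply/negP; rewrite -ltNge; apply: le_lt_trans fx.
have -> : (n%:R * (eps * (gam * rho `^ (- gam - 1)))) `^ q =
    ((n%:R * gam) `^ q * eps `^ (q - 1)) * eps / rho `^ (q * (gam + 1)).
  have g0 := ltW gam_gt0; have e0' := ltW e0.
  have -> : n%:R * (eps * (gam * rho `^ (- gam - 1))) =
     (n%:R * gam) * eps * rho `^ (- (gam + 1)).
    by rewrite opprD; ring.
  have q0 : 0 < q by move: q_gt1; lra.
  have epsq : eps `^ q = eps `^ (q - 1) * eps by rewrite mulrC mulr_powRB1.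
  have rq : (rho `^ (- (gam + 1))) `^ q = (rho `^ (q * (gam + 1)))^-1.
    by rewrite -powRrM mulNr powRN [(gam + 1) * q]mulrC.
  have ng0 : 0 <= n%:R * gam by rewrite mulr_ge0.
  rewrite (powRM _ (mulr_ge0 ng0 e0') (powR_ge0 _ _)) (powRM _ ng0 e0') epsq rq.
  by rewrite !mulrA.
have hr : (rho `^ (q * (gam + 1)))^-1 <= (rho `^ (gam + 2 * s))^-1.
  by rewrite lef_pV2 ?posrE // ler_powR.
have h1 : ((n%:R * gam) `^ q * eps `^ (q - 1)) * eps / rho `^ (q * (gam + 1)) <=
    C * cb * eps / rho `^ (gam + 2 * s).
  rewrite ler_pM ?mulr_ge0 ?powR_ge0 ?invr_ge0 ?powR_ge0 ?(ltW e0) //.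
  by rewrite ler_wpM2r // ltW.
by lra.
Unshelve. all: by end_near. Qed.

Lemma supersolution_lower_bound :
  exists2 c : R, 0 < c & forall y, R0 + 1 <= enorm y -> c / enorm y `^ gam <= u y.
Proof.
have [cb [R2 [cb0 R2R R21 hest]]] := barrier_estimate s_gt s_lt1 s_n n_ge2 gam_gt R1_gt0.
have [||m m0 hm] := @supersolution_min (R0 + 1) R2.
- by rewrite ltrDl.
- by move: R2R R1_gt0; lra.
have ng : 0 < (n%:R * gam) `^ q.
  by rewrite powR_gt0 // mulr_gt0 // ltr0n (ltn_trans _ n_ge2).
have q1 : 0 < q - 1 by move: q_gt1; lra.
(* The first entry keeps [eps * phi] below [u] up to radius [R2]; the second meets the smallness
   condition of [barrier_touch_false]. *)
pose eps := Num.min (m * (R0 + 1) `^ gam) ((C * cb / (n%:R * gam) `^ q) `^ (q - 1)^-1).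
have Ccb : 0 < C * cb by rewrite mulr_gt0.
have e0 : 0 < eps by rewrite lt_min mulr_gt0 ?powR_gt0 // divr_gt0.
have heps : (n%:R * gam) `^ q * eps `^ (q - 1) <= C * cb.
  rewrite mulrC -ler_pdivlMr //.
  apply: (@le_trans _ _ (((C * cb / (n%:R * gam) `^ q) `^ (q - 1)^-1) `^ (q - 1))).
    by rewrite ge0_ler_powR ?nnegrE ?(ltW q1) ?(ltW e0) ?powR_ge0 // ge_min lexx orbT.
  by rewrite -powRrM mulVf ?gt_eqF // powRr1 // ltW // divr_gt0.
have inner y : enorm y <= R2 -> eps * phi y <= u y.
  move=> yR2; have [yR|yR] := leP (R0 + 1) (enorm y); last first.
    by rewrite barrier_inner // mulr0 ltW.
  apply: le_trans (hm y yR yR2).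
  apply: (@le_trans _ _ (eps * (R0 + 1) `^ (- gam))).
    by rewrite ler_wpM2l ?(ltW e0) //; exact: (barrier_le s_n gam_gt R1_gt0).
  by rewrite powRN ler_pdivrMr ?powR_gt0 // ge_min lexx.
suff main y : eps * phi y <= u y.
  by exists eps => // y yR; rewrite -powRN -(barrierE gam yR).
rewrite leNgt; apply/negP => hy.
pose y1 := y; have {}hy : u y1 < eps * phi y1 by [].
have y1R : R2 < enorm y1.
  by rewrite ltNge; apply/negP => /inner; rewrite leNgt hy.
pose eta := eps * phi y1 - u y1.
have eta0 : 0 < eta by rewrite subr_gt0.
(* Beyond [R3] the function [eps * phi] is at most the gap [eta] found at [y1], so a minimum of the
   difference over a bounded annulus is global. *)
pose R3 := Num.max (enorm y1) ((eps / eta) `^ gam^-1).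
have far z : R3 <= enorm z -> eps * phi z <= eta.
  rewrite ge_max => /andP[z1 z2].
  have z0 : 0 < enorm z by move: z1 y1R R21; lra.
  rewrite barrierE; last by move: z1 y1R R2R R1_gt0; lra.
  rewrite powRN ler_pdivrMr ?powR_gt0 // mulrC -ler_pdivrMr //.
  apply: (@le_trans _ _ (((eps / eta) `^ gam^-1) `^ gam)).
    by rewrite -powRrM mulVf ?gt_eqF // powRr1 // divr_ge0 // ltW.
  by rewrite ge0_ler_powR ?nnegrE ?(ltW gam_gt0) ?powR_ge0 ?enorm_ge0.
(* The plain power stands in for [phi], with which it agrees on this annulus, since continuity is
   immediate for it. *)
have [||z [] //|z [zR2 _]|x [xR2 xR3] hx] := @EVT_exterior R n R0 R3
   ([set y | R2 <= enorm (0 - y)] `&` [set y | enorm (0 - y) <= R3])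
   (fun y => u y - eps * enorm y `^ (- gam)).
- by apply: closedI; [exact: closed_enorm_ge|exact: closed_enorm_le].
- by exists y1 => /=; rewrite sub0r enormN (ltW y1R) le_max lexx.
- by rewrite /= sub0r enormN.
- rewrite /= sub0r enormN in zR2.
  have Rz : R0 < enorm z by move: zR2 R2R R0_gt0; lra.
  have cb' : {for z, continuous (fun w : 'rV[R]_n => eps * enorm w `^ (- gam))}.
    apply: (@continuous_comp _ _ _ (@enorm R n) (fun r : R => eps * r `^ (- gam)) z).
      exact: continuous_enorm.
    apply: cvgM; first exact: cvg_cst.
    by apply: continuous_powRN; move: Rz R0_gt0; lra.
  exact: (cvgB (supersolution_continuous u_super Rz) cb').
rewrite /= sub0r enormN in xR2 xR3.
have pE z : R2 <= enorm z -> phi z = enorm z `^ (- gam).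
  by move=> zR; rewrite barrierE //; move: zR R2R R1_gt0; lra.
have xmin z : R2 <= enorm z -> enorm z <= R3 ->
    u x - eps * phi x <= u z - eps * phi z.
  by move=> z2 z3; rewrite (pE _ xR2) (pE _ z2); apply: hx; split; rewrite /= sub0r enormN.
have x1 : u x - eps * phi x <= - eta.
  by have := xmin y1 (ltW y1R); rewrite /eta opprB; apply; rewrite le_max lexx.
apply: (@barrier_touch_false x eps cb) => //.
- exact: le_trans R2R xR2.
- exact: le_trans R21 xR2.
- exact: hest.
move=> z; rewrite mulrBr lerBlDr addrAC -addrA -lerBlDl.
have [z3|z3] := leP (enorm z) R3; last first.
  apply: (le_trans x1); rewrite lerNl opprB lerBlDr (le_trans (far z (ltW z3))) //.
  by rewrite lerDl ltW.
have [z2|z2] := leP (enorm z) R2; last by apply: xmin => //; exact: ltW.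
apply: (le_trans x1); apply: (@le_trans _ _ 0); first by rewrite oppr_le0 ltW.
by rewrite subr_ge0; exact: inner.
Qed.

End lower_bound.

(** * Power estimates and the choice of the exponent *)

Lemma powRN_decay (R : realType) (A a e : R) : 0 < a -> 0 < e ->
  exists2 r0 : R, 1 <= r0 & forall r, r0 <= r -> A * r `^ (- a) <= e.
Proof.
move=> a0 e0; exists (Num.max 1 ((`|A| / e) `^ a^-1)); first by rewrite le_max lexx.
move=> r; rewrite ge_max => /andP[r1 rA].
have r0 : 0 < r by lra.
apply: (@le_trans _ _ (`|A| * r `^ (- a))).
  by rewrite ler_wpM2r ?powR_ge0 // ler_norm.
rewrite powRN ler_pdivrMr ?powR_gt0 // mulrC -ler_pdivrMr //.
apply: (@le_trans _ _ (((`|A| / e) `^ a^-1) `^ a)).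
  by rewrite -powRrM mulVf ?gt_eqF // powRr1 // divr_ge0 // ltW.
by rewrite ge0_ler_powR ?nnegrE ?powR_ge0 // ltW.
Qed.

(** If al >= 0 then m^al <= 1; if al < 0 the lower bound on [m] gives m^al <= c^al r^(-gam al). The
    two decay hypotheses cover the two cases, whose bounds are added. *)
Lemma power_term_le (R : realType) (m c r gam p A al be e : R) :
  0 < m -> 0 < c -> 0 < r -> c * r `^ (- gam) <= m -> m <= 1 -> 0 <= A ->
  A * r `^ (- be) <= e -> A * c `^ al * r `^ (- (gam * al + be)) <= e ->
  A * (m `^ (al + p) * r `^ (- be)) <= 2 * e * m `^ p.
Proof.
move=> m0 c0 r0 mlow m1 A0 hA hA'.
have mal : m `^ al <= 1 + c `^ al * r `^ (- (gam * al)).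
  have [al0|al0] := leP 0 al.
    apply: (@le_trans _ _ 1); last by rewrite lerDl mulr_ge0 ?powR_ge0.
    by rewrite -[leRHS](powRr0 m) ger_powR // m0.
  apply: (@le_trans _ _ ((c * r `^ (- gam)) `^ al)); last first.
    rewrite powRM ?powR_ge0 ?(ltW c0) // -powRrM mulNr.
    by rewrite lerDr.
  rewrite -[al]opprK !(powRN _ (- al)) lef_pV2 ?posrE ?powR_gt0 ?mulr_gt0 ?powR_gt0 //.
  have nal : 0 <= - al by rewrite oppr_ge0 ltW.
  have cr : 0 <= c * r `^ (- gam) by rewrite ltW // mulr_gt0 // powR_gt0.
  by rewrite ge0_ler_powR // ?nnegrE // ltW.
have rP : r `^ (- (gam * al)) * r `^ (- be) = r `^ (- (gam * al + be)).
  by rewrite -powRD ?(gt_eqF r0) ?implybT // opprD.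
have -> : A * (m `^ (al + p) * r `^ (- be)) = A * m `^ al * r `^ (- be) * m `^ p.
  by rewrite powRD ?(gt_eqF m0) ?implybT //; ring.
rewrite ler_wpM2r ?powR_ge0 //.
apply: (@le_trans _ _ (A * (1 + c `^ al * r `^ (- (gam * al))) * r `^ (- be))).
  by rewrite ler_wpM2r ?powR_ge0 // ler_wpM2l.
have -> : A * (1 + c `^ al * r `^ (- (gam * al))) * r `^ (- be) =
    A * r `^ (- be) + A * c `^ al * (r `^ (- (gam * al)) * r `^ (- be)) by ring.
by rewrite rP; lra.
Qed.

Lemma critical_exponent (R : realType) (N s p q : R) : 1 < 2 * s < N ->
  (1 < q < N / (N + 1 - 2 * s) /\ 0 < p < (2 * s - 1) * q / (2 * s - q)) \/
  (N / (N + 1 - 2 * s) <= q /\ 0 < p < N / (N - 2 * s)) ->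
  [/\ 1 < q, 0 < p & exists2 gam, N - 2 * s < gam &
    gam + 2 * s <= q * (gam + 1) /\ gam * p < gam + 2 * s].
Proof.
move=> /andP[s1 sN].
have k0 : 0 < N - 2 * s by lra.
have k1 : 0 < N + 1 - 2 * s by lra.
case=> [[/andP[q1 qN] /andP[p0 pN]]|[qN /andP[p0 pN]]].
  have qN' : q * (N + 1 - 2 * s) < N by rewrite -ltr_pdivlMr.
  have q2s : q < 2 * s by nra.
  have q10 : 0 < q - 1 by lra.
  have q2s0 : 0 < 2 * s - q by lra.
  have pN' : p * (2 * s - q) < (2 * s - 1) * q by rewrite -ltr_pdivlMr.
  (* This value turns gam + 2s <= q (gam + 1) into an equality; gam > N - 2s and gam p < gam + 2s
     are then the upper bounds on [q] and [p]. *)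
  split=> //; exists ((2 * s - q) / (q - 1)).
    by rewrite ltr_pdivlMr //; lra.
  split.
    rewrite le_eqVlt; apply/orP; left; apply/eqP; field; rewrite gt_eqF //; lra.
  have -> : (2 * s - q) / (q - 1) + 2 * s = ((2 * s - 1) * q) / (q - 1).
    by field; rewrite gt_eqF.
  by rewrite mulrAC ltr_pM2r ?invr_gt0 // mulrC.
have qN' : N <= q * (N + 1 - 2 * s) by rewrite -ler_pdivrMr.
have q1 : 1 < q by nra.
have pN' : p * (N - 2 * s) < N by rewrite -ltr_pdivlMr.
split=> //.
(* At gam = N - 2s the two upper conditions hold, the one on [p] strictly; the increment [d] is
   small enough to keep it, and q > 1 preserves the other. *)
pose d := (N - p * (N - 2 * s)) / (p + 1).
have d0 : 0 < d by rewrite divr_gt0 //; lra.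
have dE : d * (p + 1) = N - p * (N - 2 * s) by rewrite mulfVK // gt_eqF; lra.
exists (N - 2 * s + d); first by rewrite ltrDl.
split; last by lra.
have : d <= q * d by rewrite ler_peMl ?(ltW d0) // ltW.
by lra.
Qed.

Lemma liminf_power_lower_bound (R : realType) (f : R -> R) (p : R) :
  (0 < limf_einf (fun t : R => (f t / t `^ p)%:E) 0^'+)%E ->
  exists a t0 : R, [/\ 0 < a, 0 < t0 & forall t, 0 < t -> t < t0 -> a * t `^ p <= f t].
Proof.
rewrite limf_einfE => /ereal_sup_gt[_ [V FV <-] infV].
(* The infimum over [V] may be +oo, in which case [a = 1] serves. *)
have [a a0 aV] : exists2 a : R, 0 < a &
    (a%:E <= ereal_inf ((fun t : R => (f t / t `^ p)%:E) @` V))%E.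
  case: (ereal_inf _) infV => [l||] // h; first by exists l.
  by exists 1 => //; rewrite leey.
move: FV => [e /= e0 he]; exists a, e; split => // t t0 te.
have Vt : V t by apply: he => //=; rewrite sub0r normrN gtr0_norm.
rewrite -ler_pdivlMr ?powR_gt0 // -lee_fin; apply: (le_trans aV).
by apply: ereal_inf_lbound; exists t.
Qed.

Lemma positive_lower_bound (R : realType) (f : R -> R) (a b : R) :
  (forall t, 0 < t -> 0 < f t) -> {within `]0, +oo[, continuous f} -> 0 < a -> a <= b ->
  exists2 c : R, 0 < c & forall t, a <= t -> t <= b -> c <= f t.
Proof.
move=> fp fc a0 ab; have [|c hc hmin] := @EVT_min R f a b ab.
  apply: continuous_subspaceW fc => t /=; rewrite !in_itv /= andbT => /andP[at' _].
  exact: lt_le_trans a0 at'.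
exists (f c); first by apply: fp; move: hc; rewrite in_itv /= => /andP[ac _]; exact: lt_le_trans ac.
by move=> t ta tb; apply: hmin; rewrite in_itv /= ta.
Qed.

Lemma not_blows_upP (R : realType) (n : nat) (u : 'rV[R]_n -> R) :
  ~ blows_up_at_infinity u ->
  exists M : R, forall r : R, exists2 x, r < enorm x & u x <= M.
Proof.
move=> nb; apply: contrapT => h; apply: nb => P [M [_ hM]].
have [r hr] : exists r : R, forall x, r < enorm x -> M < u x.
  apply: contrapT => h'; apply: h; exists M => r.
  apply: contrapT => h''; apply: h'; exists r => x rx.
  by rewrite ltNge; apply/negP => ux; apply: h''; exists x.
by exists r => // x /= rx; apply: hM; exact: hr.
Qed.

(** * Vanishing of the infimum and the contradiction *)

Section nonexistence.
Variables (R : realType) (n : nat) (s C lambda R0 p q gam : R) (f : R -> R) (u : 'rV[R]_n -> R).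
Hypotheses (s_gt : 2^-1 < s) (s_lt1 : s < 1) (s_n : 2 * s < n%:R) (n_ge2 : (2 <= n)%N).
Hypotheses (C_gt0 : 0 < C) (lambda_gt0 : 0 < lambda) (R0_gt0 : 0 < R0) (q_gt1 : 1 < q).
Hypotheses (p_gt0 : 0 < p) (gam_gt : n%:R - 2 * s < gam).
Hypotheses (gam_q : gam + 2 * s <= q * (gam + 1)) (gam_p : gam * p < gam + 2 * s).
Hypothesis f_pos : forall t, 0 < t -> 0 < f t.
Hypothesis f_cont : {within `]0, +oo[, continuous f}.
Hypothesis f_liminf : (0 < limf_einf (fun t : R => (f t / t `^ p)%:E) 0^'+)%E.
Hypotheses (u_super : classical_supersolution C s q lambda f R0 u)
  (u_gt0 : forall x, 0 < u x) (u_liminf : ~ blows_up_at_infinity u).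
Implicit Types x y z : 'rV[R]_n.

Let s_gt0 : 0 < s. Proof. by move: s_gt; lra. Qed.
Let gam_gt0 : 0 < gam. Proof. by move: gam_gt s_n; lra. Qed.
Let q_ge0 : 0 <= q. Proof. by move: q_gt1; lra. Qed.

(** Otherwise the values of [u] at contact points lie in the compact interval [e, max e M], where
    [f] has a positive minimum [c]; but for [z] far away with u z <= M, each of the two right-hand
    terms is at most lambda c / 3. *)
Lemma supersolution_inf0 (e : R) : 0 < e -> exists2 y, R0 + 1 <= enorm y & u y < e.
Proof.
move=> e0; apply: contrapT => noy.
have ue y : R0 + 1 <= enorm y -> e <= u y.
  by move=> yR; rewrite leNgt; apply/negP => uy; apply: noy; exists y.
have [M hM] := not_blows_upP u_liminf.
have eM : e <= Num.max e M by rewrite le_max lexx.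
have [c c0 hc] := positive_lower_bound f_pos f_cont e0 eM.
have [P P0 hP] := paraboloid_touch s_gt0 s_lt1 s_n n_ge2 C_gt0 R0_gt0 q_ge0 u_super u_gt0.
have lc : 0 < lambda * c / 3 by rewrite divr_gt0 ?mulr_gt0.
have s20 : 0 < 2 * s by rewrite mulr_gt0.
have [r1 r11 h1] := @powRN_decay R (P * Num.max e M) (2 * s) _ s20 lc.
have q0 : 0 < q by move: q_gt1; lra.
have [r2 r21 h2] := @powRN_decay R ((n%:R * (2 * Num.max e M)) `^ q) q _ q0 lc.
have [z zr uz] := hM (2 * (R0 + 1 + r1 + r2)).
have zR : 2 * R0 < enorm z by move: zr R0_gt0; lra.
have [x [zx ux hx]] := hP z zR.
set r := enorm z / 2 in zx hx.
have rz : R0 + 1 + r1 + r2 < r by rewrite /r ltr_pdivlMr // mulrC.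
have r0 : 0 < r by move: R0_gt0; lra.
have xR : R0 + 1 <= enorm x.
  have := ler_enormB z (z - x); rewrite opprB addrCA subrr addr0.
  have : enorm z = 2 * r by rewrite /r; field.
  by move: R0_gt0; lra.
have uzM : u z <= Num.max e M by rewrite le_max uz orbT.
have m0 : 0 <= Num.max e M by rewrite le_max ltW.
have fx : c <= f (u x) by apply: hc; [exact: ue|exact: le_trans ux uzM].
have t1 : P * (u z / r `^ (2 * s)) <= lambda * c / 3.
  have /h1 : r1 <= r by move: R0_gt0; lra.
  by apply: le_trans; rewrite powRN -mulrA ler_wpM2l // ler_wpM2r // invr_ge0 powR_ge0.
have t2 : (n%:R * (2 * (u z / r))) `^ q <= lambda * c / 3.
  have /h2 : r2 <= r by move: R0_gt0; lra.
  apply: le_trans; rewrite powRN -powRV ?(ltW r0) // -powRM ?invr_ge0 ?(ltW r0) ?mulr_ge0 //.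
  rewrite ge0_ler_powR // ?nnegrE ?mulr_ge0 ?divr_ge0 ?invr_ge0 ?(ltW r0) ?(ltW (u_gt0 _)) //.
  by rewrite -!mulrA !ler_wpM2l // ler_wpM2r // invr_ge0 ltW.
have : lambda * c <= lambda * f (u x) by rewrite ler_pM2l.
have := mulr_gt0 lambda_gt0 c0.
by lra.
Qed.

Lemma supersolution_false : False.
Proof.
have [cl cl0 hcl] := supersolution_lower_bound s_gt s_lt1 s_n n_ge2 C_gt0 lambda_gt0 R0_gt0
  q_gt1 gam_gt gam_q f_pos u_super u_gt0.
have [a [t0 [a0 t00 ha]]] := liminf_power_lower_bound f_liminf.
have [P P0 hP] := paraboloid_touch s_gt0 s_lt1 s_n n_ge2 C_gt0 R0_gt0 q_ge0 u_super u_gt0.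
pose b := gam + 1.
have b0 : 0 < b by rewrite /b; move: gam_gt0; lra.
(* The right-hand terms will total at most 4 e m^p against a lower bound 5 e m^p; 2^b is the loss in
   comparing [u x] with [u z]. *)
pose e := lambda * (a * (2 `^ b)^-1 `^ p) / 5.
have e0 : 0 < e by rewrite !mulr_gt0 ?powR_gt0 ?invr_gt0 ?powR_gt0.
(* Restates the lower bound at [z] in terms of r = |z| / 2. *)
pose c' := cl / 2 `^ gam.
have c'0 : 0 < c' by rewrite divr_gt0 // powR_gt0.
pose Q := (n%:R * 2) `^ q.
have s20 : 0 < 2 * s by rewrite mulr_gt0.
have q0 : 0 < q by move: q_gt1; lra.
(* These are the decay exponents in [r] left after m^(1 - p) and m^(q - p) are bounded through the
   lower bound on [m]; they are positive because gam p < gam + 2s <= q (gam + 1). *)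
have ex1 : 0 < gam * (1 - p) + 2 * s by move: gam_p; lra.
have ex2 : 0 < gam * (q - p) + q by move: gam_p gam_q; lra.
have [r1 r11 h1] := @powRN_decay R P (2 * s) _ s20 e0.
have [r2 r21 h2] := @powRN_decay R (P * c' `^ (1 - p)) _ _ ex1 e0.
have [r3 r31 h3] := @powRN_decay R Q q _ q0 e0.
have [r4 r41 h4] := @powRN_decay R (Q * c' `^ (q - p)) _ _ ex2 e0.
pose S := R0 + 1 + r1 + r2 + r3 + r4.
have [S1 S2 S3 S4] : [/\ r1 <= S, r2 <= S, r3 <= S & r4 <= S].
  by rewrite /S; move: R0_gt0; split; lra.
have RS : R0 + 1 <= S by rewrite /S; lra.
pose rho := 2 * S.
have rhoR : R0 + 1 <= rho by rewrite /rho; move: R0_gt0 RS; lra.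
have [||mr mr0 hmr] := supersolution_min n_ge2 R0_gt0 u_super u_gt0 (a := R0 + 1) (b := rho).
- by rewrite ltrDl.
- exact: rhoR.
(* [u z < mr] will push [z] beyond [rho], [u z < t0] makes the power bound on [f] available at the
   contact point, and [u z < 1] is for [power_term_le]. *)
pose eta := Num.min mr (Num.min t0 1).
have eta0 : 0 < eta by rewrite !lt_min mr0 t00 ltr01.
have [y1 y1R uy1] := supersolution_inf0 eta0.
have Rpos y : R0 + 1 <= enorm y -> 0 < enorm y by move: R0_gt0; lra.
(* At a minimizer [z] of [max w (W u)], every [x] has [u z <= u x] or [w z <= w x];
   either way [u x] is comparable to [u z] near [z], while [u z <= u y1] is small. *)
pose w y := u y * enorm y `^ b.
(* The exponent gam + 1 exceeds by one the decay rate of the lower bound on [u], so [w] grows at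
   least linearly and the minimization takes place on a bounded set. *)
have wc y : R0 + 1 <= enorm y -> cl * enorm y <= w y.
  move=> yR; have y0 := Rpos y yR.
  rewrite /w /b powRD ?(gt_eqF y0) ?implybT // powRr1 ?(ltW y0) // mulrA ler_wpM2r ?(ltW y0) //.
  by rewrite -ler_pdivrMr ?powR_gt0 //; exact: hcl.
have w1 : 0 < w y1 by rewrite mulr_gt0 // powR_gt0 // Rpos.
(* With this weight the two entries of the maximum agree at [y1], so minimality gives u z <= u y1;
   beyond the radius [B] below, [w] already exceeds [w y1]. *)
pose W := w y1 / u y1.
have W0 : 0 < W by rewrite divr_gt0.
pose B := w y1 / cl.
have [||y [] //|y [yR _]|z [zR zB] hz] := @EVT_exterior R n R0 B
   ([set y | R0 + 1 <= enorm (0 - y)] `&` [set y | enorm (0 - y) <= B])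
   (fun y => Num.max (w y) (W * u y)).
- by apply: closedI; [exact: closed_enorm_ge|exact: closed_enorm_le].
- exists y1; split; rewrite /= sub0r enormN //.
  by rewrite /B ler_pdivlMr // mulrC; exact: wc.
- by rewrite /= sub0r enormN.
- rewrite /= sub0r enormN in yR.
  have Ry : exterior R0 y by rewrite /exterior /=; lra.
  have uc := supersolution_continuous u_super Ry.
  have ec : {for y, continuous (fun y : 'rV[R]_n => enorm y `^ b)}.
    apply: (@continuous_comp _ _ _ (@enorm R n) (fun r : R => r `^ b) y).
      exact: continuous_enorm.
    by rewrite -[b]opprK; apply: continuous_powRN; exact: Rpos.
  have c1 : {for y, continuous w} by exact: (cvgM uc ec).
  have c2 : {for y, continuous (fun y => W * u y)} by exact: (cvgM (cvg_cst W) uc).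
  exact: (@continuous_max _ _ w (fun y => W * u y) y c1 c2).
rewrite /= sub0r enormN in zR zB.
have z0 := Rpos z zR.
have g1 : Num.max (w z) (W * u z) <= w y1.
  have := hz y1; rewrite /= sub0r enormN => /(_ _)/le_trans; apply.
    by split => //; rewrite /B ler_pdivlMr // mulrC; exact: wc.
  by rewrite ge_max lexx /W divfK ?lexx // gt_eqF.
have uz1 : u z <= u y1.
  by move: g1; rewrite ge_max => /andP[_]; rewrite /W mulrAC ler_pdivrMr // ler_pM2l.
have [uzm uzt uzo] : [/\ u z < mr, u z < t0 & u z < 1].
  by move: (le_lt_trans uz1 uy1); rewrite !lt_min => /and3P.
have zrho : rho < enorm z.
  by rewrite ltNge; apply/negP => /(hmr z zR); rewrite leNgt uzm.
have zmin x : R0 + 1 <= enorm x -> u z <= u x \/ w z <= w x.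
  move=> xR; have [xB|xB] := leP (enorm x) B; last first.
    right; have /andP[wz _] : (w z <= w y1) && (W * u z <= w y1) by rewrite -ge_max.
    apply: (le_trans wz); apply: le_trans (wc x xR).
    by move: xB; rewrite /B ltr_pdivrMr // mulrC => /ltW.
  have := hz x; rewrite /= sub0r enormN => /(_ (conj xR xB)).
  rewrite le_max !ge_max => /orP[/andP[h _]|/andP[_ h]]; first by right.
  by left; move: h; rewrite ler_pM2l.
have zR0 : 2 * R0 < enorm z 
  by apply: lt_trans zrho; rewrite /rho ltr_pM2l // (lt_le_trans _ RS) // ltrDl.
have [x [zx ux hx]] := hP z zR0.
set r := enorm z / 2 in zx hx.
have zr : enorm z = 2 * r by rewrite /r; field.
have rr : S < r by rewrite /r ltr_pdivlMr // mulrC.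
have r0 : 0 < r by apply: lt_trans rr; apply: lt_le_trans RS; rewrite addr_gt0.
have xR : R0 + 1 <= enorm x.
  apply: (le_trans RS); apply: (le_trans (ltW rr)).
  have := ler_enormB z (z - x); rewrite opprB addrCA subrr addr0; apply: le_trans.
  by rewrite zr lerBrDr mulr_natl mulr2n lerD2l.
have x2z : enorm x <= 2 * enorm z.
  have := ler_enormB x z; rewrite enormBC lerBlDr => /le_trans; apply.
  by rewrite [leRHS]mulr_natl mulr2n lerD2r (le_trans zx) // zr mulr_natl mulr2n lerDl ltW.
have x0 := Rpos x xR.
(* When w z <= w x, passing to [u] costs (|x| / |z|)^b <= 2^b. *)
have uxz : u z / 2 `^ b <= u x.
  rewrite ler_pdivrMr ?powR_gt0 //; case: (zmin x xR) => [h|h].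
    apply: (le_trans h); rewrite ler_peMr ?(ltW (u_gt0 x)) //.
    by rewrite ltW // powR_gt1 // ltr1n.
  rewrite -(ler_pM2r (powR_gt0 b z0)); apply: (le_trans h).
  rewrite /w -mulrA; apply: (ler_wpM2l (ltW (u_gt0 x))); rewrite -(powRM b (ler0n R 2) (ltW z0)).
  by rewrite ge0_ler_powR ?nnegrE ?mulr_ge0 ?(ltW b0) ?(ltW x0) ?(ltW z0).
set m := u z in uz1 uzm uzt uzo ux uxz hx.
have m0 : 0 < m := u_gt0 z.
have mlow : c' * r `^ (- gam) <= m.
  have := hcl z zR; rewrite zr powRM ?(ltW r0) // invfM mulrA powRN; exact.
have fx : a * (m / 2 `^ b) `^ p <= f (u x).
  apply: le_trans (ha (u x) (u_gt0 x) (le_lt_trans ux uzt)).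
  rewrite ler_wpM2l ?(ltW a0) // ge0_ler_powR ?nnegrE ?(ltW p_gt0) ?(ltW (u_gt0 x)) //.
  by rewrite divr_ge0 ?powR_ge0 // ltW.
have mp : 0 < m `^ p by rewrite powR_gt0.
have T1 : P * (m / r `^ (2 * s)) <= 2 * e * m `^ p.
  rewrite -powRN -[X in X * r `^ _](@powRr1 _ m) ?(ltW m0) //.
  rewrite (_ : m `^ 1 = m `^ (1 - p + p)); last by rewrite subrK.
  apply: (power_term_le p m0 c'0 r0 mlow (ltW uzo) P0).
    by apply: h1; exact: le_trans S1 (ltW rr).
  by apply: h2; exact: le_trans S2 (ltW rr).
have T2 : (n%:R * (2 * (m / r))) `^ q <= 2 * e * m `^ p.
  have -> : (n%:R * (2 * (m / r))) `^ q = Q * (m `^ (q - p + p) * r `^ (- q)).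
    have E : n%:R * (2 * (m / r)) = n%:R * 2 * (m / r) by rewrite mulrA.
    have n20 : 0 <= n%:R * 2 :> R by rewrite mulr_ge0.
    have r0' := ltW r0; have m0' := ltW m0.
    rewrite E subrK (powRM _ n20 (divr_ge0 m0' r0')) -/Q; congr (_ * _).
    by rewrite powRM ?invr_ge0 // powRV // powRN.
  apply: (power_term_le p m0 c'0 r0 mlow (ltW uzo) (powR_ge0 _ _)).
    by apply: h3; exact: le_trans S3 (ltW rr).
  by apply: h4; exact: le_trans S4 (ltW rr).
have : lambda * (a * (m / 2 `^ b) `^ p) <= 4 * e * m `^ p.
  apply: (@le_trans _ _ (lambda * f (u x))); first by rewrite ler_wpM2l // ltW.
  apply: (le_trans hx); rewrite [leRHS](_ : _ = 2 * e * m `^ p + 2 * e * m `^ p); last by ring.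
  exact: lerD.
have -> : lambda * (a * (m / 2 `^ b) `^ p) = 5 * e * m `^ p.
  by rewrite powRM ?invr_ge0 ?powR_ge0 ?(ltW m0) // /e; field.
have em : 0 < e * m `^ p by rewrite mulr_gt0.
by rewrite -(mulrA 5) -(mulrA 4) ler_pM2r // ler_nat.
Qed.

End nonexistence.

Theorem theorem1p1 (R : realType) (N : nat) (s C lambda R0 p q : R)
  (f : R -> R)
  (hN : (1 <= N)%N) (hs : 2^-1 < s < 1) (hNs : 1 < 2 * s < N%:R)
  (hC : 0 < C) (hlambda : 0 < lambda) (hR0 : 0 < R0)
  (f_pos : forall t : R, 0 < t -> 0 < f t)
  (f_cont : {within `]0, +oo[, continuous f})
  (f_liminf : (0 < limf_einf (fun t : R => (f t / t `^ p)%:E) 0^'+)%E)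
  (hpq :
    (1 < q < N%:R / (N%:R + 1 - 2 * s) /\
       0 < p < (2 * s - 1) * q / (2 * s - q)) \/
    (N%:R / (N%:R + 1 - 2 * s) <= q /\
       0 < p < N%:R / (N%:R - 2 * s))) :
  ~ exists u : 'rV[R]_N -> R,
      [/\ classical_supersolution C s q lambda f R0 u,
          (forall x, 0 < u x) &
          ~ blows_up_at_infinity u].
Proof.
case/andP: hs => s_gt s_lt1; case/andP: (hNs) => _ s_n.
(* An integer N > 2s > 1 is at least 2, which gives 2 - 2s <= N for the integrals near [x]. *)
have n_ge2 : (2 <= N)%N by rewrite -(@ltr_nat R); move: hNs; lra.
have [q1 p0 [gam gam_gt [gam_q gam_p]]] := critical_exponent hNs hpq.
case=> u [u_super u_gt0 u_liminf].
exact: (supersolution_false s_gt s_lt1 s_n n_ge2 hC hlambda hR0 q1 p0 gam_gt gam_q gam_p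
  f_pos f_cont f_liminf u_super u_gt0 u_liminf).
Qed.
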